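(* Fix $\star\in\{0,\boldsymbol n,s\}$. For $\beta\ge2$ let $\boldsymbol u\in K^\star$ and $\boldsymbol u_h\in K_h^\star$ denote the exact solutions of $$a^\star(\boldsymbol u,\boldsymbol v-\boldsymbol u)\ge F(\boldsymbol v-\boldsymbol u)\quad\text{for all }\boldsymbol v\in K^\star$$ and $$a^\star(\boldsymbol u_h,\boldsymbol v_h-\boldsymbol u_h)\ge F(\boldsymbol v_h-\boldsymbol u_h)\quad\text{for all }\boldsymbol v_h\in K_h^\star,$$ respectively. Then there is a constant $C>0$, depending on $\Omega$ and $\beta$ but not on $\mathcal T$, such that $$\|\boldsymbol u-\boldsymbol u_h\|_U^2\le C\begin{cases}\displaystyle\inf_{\boldsymbol v_h\in K_h^0}\Big(\|\boldsymbol u-\boldsymbol v_h\|_U^2+\langle\gamma_{\boldsymbol n}\boldsymbol u,\gamma_0(\boldsymbol v_h-\boldsymbol u)\rangle_\Gamma\Big)&(\star=0),\\[1ex]\displaystyle\inf_{\boldsymbol v_h\in K_h^{\boldsymbol n}}\Big(\|\boldsymbol u-\boldsymbol v_h\|_U^2+\langle\gamma_{\boldsymbol n}(\boldsymbol v_h-\boldsymbol u),\gamma_0\boldsymbol u\rangle_\Gamma\Big)&(\star=\boldsymbol n),\\[1ex]\displaystyle\inf_{\boldsymbol v_h\in K_h^s}\Big(\|\boldsymbol u-\boldsymbol v_h\|_U^2+\tfrac12\big(\langle\gamma_{\boldsymbol n}\boldsymbol u,\gamma_0(\boldsymbol v_h-\boldsymbol u)\rangle_\Gamma+\langle\gamma_{\boldsymbol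 n}(\boldsymbol v_h-\boldsymbol u),\gamma_0\boldsymbol u\rangle_\Gamma\big)\Big)&(\star=s).\end{cases}$$
   Context: Domain and mesh. $\Omega\subset\mathbb R^d$ ($d\in\{2,3\}$) is a bounded simply connected Lipschitz domain with boundary $\Gamma=\partial\Omega$ and outer unit normal $\boldsymbol n=\boldsymbol n_\Omega$; $f\in L^2(\Omega)$. $(\cdot,\cdot)$ and $\|\cdot\|$ are the $L^2(\Omega)$ inner product and norm; $\langle\cdot,\cdot\rangle_{\partial\omega}$ is the (extended) $L^2(\partial\omega)$ duality. $\mathcal T$ is a finite conforming mesh of $\Omega$ of open simplices $T$, $\bigcup_{T\in\mathcal T}\overline T=\overline\Omega$; $\boldsymbol n_T$ is the outer unit normal on $\partial T$; $\mathcal S=\{\partial T: T\in\mathcal T\}$ is the skeleton. $\nabla_{\mathcal T}$, $\mathrm{div}_{\mathcal T}$ are the $\mathcal T$-piecewise gradient and divergence. Spaces. $H^1(\mathcal T)=\{w\in L^2(\Omega): w|_T\in H^1(T)\ \forall T\in\mathcal T\}$, $\boldsymbol H(\mathrm{div},\mathcal T)=\{\boldsymbol q\in L^2(\Omega)^d:\boldsymbol q|_T\in\boldsymbol H(\mathrm{div},T)\ \forall T\in\mathcal T\}$. $H^{1/2}(\mathcal S)$ is the set of $\widehat u\in\prod_{T}H^{1/2}(\partial T)$ for which there is $w\in H^1(\Omega)$ with $\widehat u|_{\partial T}=w|_{\partial T}$ for all $T$; $H^{-1/2}(\mathcal S)$ is the set of $\widehat\sigma\in\prod_T H^{-1/2}(\partial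 T)$ for which there is $\boldsymbol q\in\boldsymbol H(\mathrm{div},\Omega)$ with $\widehat\sigma|_{\partial T}=(\boldsymbol q\cdot\boldsymbol n_T)|_{\partial T}$ for all $T$. Norms: $\|\widehat u\|_{1/2,\mathcal S}$ is the infimum of $(\|w\|^2+\|\nabla w\|^2)^{1/2}$ over all such $w$; $\|\widehat\sigma\|_{-1/2,\mathcal S}$ is the infimum of $(\|\boldsymbol q\|^2+\|\mathrm{div}\,\boldsymbol q\|^2)^{1/2}$ over all such $\boldsymbol q$. The restrictions to $\Gamma$ are $\widehat u|_\Gamma:=w|_\Gamma\in H^{1/2}(\Gamma)$ and $\widehat\sigma|_\Gamma:=(\boldsymbol q\cdot\boldsymbol n_\Omega)|_\Gamma\in H^{-1/2}(\Gamma)$ (independent of the chosen $w$, $\boldsymbol q$). Set $\langle\widehat u,\boldsymbol\tau\cdot\boldsymbol n\rangle_{\mathcal S}=\sum_T\langle\widehat u|_{\partial T},\boldsymbol\tau\cdot\boldsymbol n_T\rangle_{\partial T}$ and $\langle\widehat\sigma,v\rangle_{\mathcal S}=\sum_T\langle\widehat\sigma|_{\partial T},v\rangle_{\partial T}$. $U=L^2(\Omega)\times L^2(\Omega)^d\times H^{1/2}(\mathcal S)\times H^{-1/2}(\mathcal S)$ with $\|(u,\boldsymbol\sigma,\widehat u,\widehat\sigma)\|_U^2=\|u\|^2+\|\boldsymbol\sigma\|^2+\|\widehat u\|_{1/2,\mathcal S}^2+\|\widehat\sigma\|_{-1/2,\mathcal S}^2$; $V=H^1(\mathcal T)\times\boldsymbol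 H(\mathrm{div},\mathcal T)$ with $\|(v,\boldsymbol\tau)\|_V^2=\|v\|^2+\|\nabla_{\mathcal T}v\|^2+\|\boldsymbol\tau\|^2+\|\mathrm{div}_{\mathcal T}\boldsymbol\tau\|^2$ and the inner product $(\cdot,\cdot)_V$ inducing it. Forms. For $\boldsymbol u=(u,\boldsymbol\sigma,\widehat u,\widehat\sigma)\in U$, $\boldsymbol v=(v,\boldsymbol\tau)\in V$: $b(\boldsymbol u,\boldsymbol v)=(\boldsymbol\sigma,\nabla_{\mathcal T}v)+(u,v)-\langle\widehat\sigma,v\rangle_{\mathcal S}+(\boldsymbol\sigma,\boldsymbol\tau)+(u,\mathrm{div}_{\mathcal T}\boldsymbol\tau)-\langle\widehat u,\boldsymbol\tau\cdot\boldsymbol n\rangle_{\mathcal S}$, $L(\boldsymbol v)=(f,v)$. The operator $\Theta:U\to V$ is defined by $(\Theta\boldsymbol u,\boldsymbol v)_V=b(\boldsymbol u,\boldsymbol v)$ for all $\boldsymbol v\in V$, and $\Theta_\beta:=\beta\Theta$. Trace operators: $\gamma_0\boldsymbol u=\widehat u|_\Gamma$, $\gamma_{\boldsymbol n}\boldsymbol u=\widehat\sigma|_\Gamma$. For $\boldsymbol u,\boldsymbol v\in U$: $a^0(\boldsymbol u,\boldsymbol v)=b(\boldsymbol u,\Theta_\beta\boldsymbol v)+\langle\gamma_{\boldsymbol n}\boldsymbol u,\gamma_0\boldsymbol v\rangle_\Gamma$, $a^{\boldsymbol n}(\boldsymbol u,\boldsymbol v)=b(\boldsymbol u,\Theta_\beta\boldsymbol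 v)+\langle\gamma_{\boldsymbol n}\boldsymbol v,\gamma_0\boldsymbol u\rangle_\Gamma$, $a^s(\boldsymbol u,\boldsymbol v)=b(\boldsymbol u,\Theta_\beta\boldsymbol v)+\tfrac12(\langle\gamma_{\boldsymbol n}\boldsymbol u,\gamma_0\boldsymbol v\rangle_\Gamma+\langle\gamma_{\boldsymbol n}\boldsymbol v,\gamma_0\boldsymbol u\rangle_\Gamma)$, $F(\boldsymbol v)=L(\Theta_\beta\boldsymbol v)$. Orderings and cones. $\widehat v\ge0$ in $H^{1/2}(\Gamma)$ means that $\widehat v$ is the weak $H^{1/2}(\Gamma)$-limit of a sequence of non-negative Lipschitz continuous functions on $\Gamma$. $\widehat\sigma\ge0$ in $H^{-1/2}(\Gamma)$ means $\langle\widehat\sigma,\widehat v\rangle_\Gamma\ge0$ for all $\widehat v\in H^{1/2}(\Gamma)$ with $\widehat v\ge0$. $K^0=\{\boldsymbol u\in U:\gamma_0\boldsymbol u\ge0\}$, $K^{\boldsymbol n}=\{\boldsymbol u\in U:\gamma_{\boldsymbol n}\boldsymbol u\ge0\}$, $K^s=K^0\cap K^{\boldsymbol n}$. Discrete spaces. $U_h=P^0(\mathcal T)\times[P^0(\mathcal T)]^d\times S^1(\mathcal S)\times P^0(\mathcal S)\subset U$, where $P^0(\mathcal T)$ are the $\mathcal T$-element-wise constants, $P^0(\mathcal S)\subset H^{-1/2}(\mathcal S)$ consists of those elements that are constant on each facet of each $\partial T$, and $S^1(\mathcal S)\subset H^{1/2}(\mathcal S)$ consists of the globally continuous functions on the skeleton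 that are affine on each facet. $K_h^\star=K^\star\cap U_h$ for $\star\in\{0,\boldsymbol n,s\}$. *)

(* Defs.v *)
From HB Require Import structures.
From mathcomp Require Import all_boot all_order all_algebra.
From mathcomp Require Import all_classical all_reals all_analysis.
Set Implicit Arguments.
Unset Strict Implicit.
Unset Printing Implicit Defensive.
Import Order.TTheory GRing.Theory Num.Theory.
Import numFieldNormedType.Exports.
Local Open Scope classical_set_scope.
Local Open Scope ring_scope.

(* Row vectors carry the sigma-algebra generated by the coordinates. *)
Section rv_measurable.
Variables (R : realType) (n : nat).

Let coord (i : 'I_n) (x : 'rV[R]_n) : R := x 0 i.

Let rv_set0 : g_sigma_preimage coord set0.
Proof. exact: sigma_algebra0. Qed.
Let rv_setC A : g_sigma_preimage coord A -> g_sigma_preimage coord (~` A).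
Proof. exact: sigma_algebraC. Qed.
Let rv_bigcup (F : (set _)^nat) : (forall i, g_sigma_preimage coord (F i)) ->
  g_sigma_preimage coord (\bigcup_i (F i)).
Proof. exact: sigma_algebra_bigcup. Qed.

HB.instance Definition _ := @isMeasurable.Build default_measure_display
  'rV[R]_n (g_sigma_preimage coord) rv_set0 rv_setC rv_bigcup.

End rv_measurable.

Section rv_measurable_fun.
Variables (R : realType) (n : nat).

Lemma measurable_coord (i : 'I_n) :
  measurable_fun setT (fun x : 'rV[R]_n => x 0 i).
Proof.
move=> _ Y mY; rewrite setTI; apply: sub_sigma_algebra => /=.
rewrite -bigcup_seq/=; exists i => /=; first by rewrite mem_index_enum.
by exists Y => //; rewrite setTI.
Qed.

Lemma measurable_rvP d (T : measurableType d) (f : T -> 'rV[R]_n) :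
  (forall i, measurable_fun setT (fun t => f t 0 i)) -> measurable_fun setT f.
Proof.
move=> mf.
apply: (@measurability _ _ _ _ setT f (\big[setU/set0]_(i < n)
  preimage_set_system setT (fun x : 'rV[R]_n => x 0 i) measurable)) => //.
move=> _ [B + <-].
rewrite -bigcup_seq/= => -[i _ [A mA <-]].
have := mf i measurableT A mA; rewrite !setTI; exact.
Qed.

End rv_measurable_fun.

Section rv_cons.
Variables (R : realType) (n : nat).

Definition rv_cons (p : R * 'rV[R]_n) : 'rV[R]_n.+1 := row_mx p.1%:M p.2.

Lemma measurable_rv_cons : measurable_fun setT rv_cons.
Proof.
apply: measurable_rvP => i.
case: (@splitP 1 n i) => j ij; rewrite /rv_cons.
have -> : i = lshift n j by exact: val_inj.
rewrite (_ : (fun _ => _) = (fun t => t.1)); last first.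
  by apply/funext => t; rewrite (row_mxEl (t.1%:M)) ord1 mxE eqxx.
exact: measurable_fst.
have -> : i = rshift 1 j by exact: val_inj.
rewrite (_ : (fun _ => _) = (fun x : 'rV[R]_n => x 0 j) \o snd); last first.
  by apply/funext => t /=; rewrite (row_mxEr (t.1%:M)).
apply: measurableT_comp => //; exact: measurable_coord.
Qed.

Definition rv_uncons (x : 'rV[R]_n.+1) : R * 'rV[R]_n :=
  (x 0 ord0, @rsubmx _ 1 1 n x).

Lemma rv_consK : cancel rv_cons rv_uncons.
Proof.
move=> [a v]; rewrite /rv_uncons /rv_cons /=; congr pair; last first.
  by rewrite (@row_mxKr _ 1 1 n).
have := row_mxEl (a%:M : 'M[R]_1) v 0 ord0.
rewrite [RHS]mxE eqxx mulr1n => h; rewrite -[RHS]h.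
by congr (fun_of_matrix _ _ _); exact: val_inj.
Qed.

Lemma measurable_rv_uncons : measurable_fun setT rv_uncons.
Proof.
apply: measurable_fun_pair; first exact: measurable_coord.
apply: measurable_rvP => j.
rewrite (_ : (fun _ => _) = (fun x : 'rV[R]_n.+1 => x 0 (rshift 1 j))); last first.
  by apply/funext => t; rewrite mxE.
exact: measurable_coord.
Qed.

End rv_cons.

Section lebesgue_step.
Context (R : realType) (n : nat).
Variables (mu : {sigma_finite_measure set 'rV[R]_n -> \bar R}).

Definition lebesgue_step : set 'rV[R]_n.+1 -> \bar R :=
  pushforward (lebesgue_measure \x mu)%E (@rv_cons R n).

HB.instance Definition _ := Measure.copy lebesgue_step
  (@measure_function_pushforward__canonical__measure_function_Measure _ _ _ _ _
     (lebesgue_measure \x mu)%E _ (@measurable_rv_cons R n)).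

Let lebesgue_step_sigma_finite : sigma_finite setT lebesgue_step.
Proof.
have /sigma_finiteP[F [TF ndF Foo]] := sigma_finiteT (@lebesgue_measure R).
have /sigma_finiteP[G [TG ndG Goo]] := sigma_finiteT mu.
exists (fun k => @rv_uncons R n @^-1` (F k `*` G k)).
  rewrite -preimage_bigcup predeqE => x; split => //= _.
  have [k _ Fk] : (\bigcup_i F i) (rv_uncons x).1 by rewrite -TF.
  have [l _ Gl] : (\bigcup_i G i) (rv_uncons x).2 by rewrite -TG.
  exists (maxn k l) => //; split => /=.
    by move: Fk; exact/subsetPset/ndF/leq_maxl.
  by move: Gl; exact/subsetPset/ndG/leq_maxr.
move=> k; have [mF Fk] := Foo k; have [mG Gk] := Goo k; split.
  rewrite -[X in measurable X]setTI; apply: measurable_rv_uncons => //.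
  exact: measurableX.
rewrite /lebesgue_step /pushforward -comp_preimage.
rewrite (_ : @rv_uncons R n \o rv_cons (n:=n) = id); last first.
  by apply/funext => x /=; rewrite rv_consK.
by rewrite /= product_measure1E// lte_mul_pinfty// ge0_fin_numE.
Qed.

HB.instance Definition _ := Measure_isSigmaFinite.Build _ _ _ lebesgue_step
  lebesgue_step_sigma_finite.

End lebesgue_step.

(* Lebesgue measure on the Borel sets of R^n. *)
Fixpoint leb (R : realType) (n : nat) :
    {sigma_finite_measure set 'rV[R]_n -> \bar R} :=
  match n with
  | 0%N => \d_(0 : 'rV[R]_0)
  | k.+1 => lebesgue_step (leb R k)
  end.

Section sobolev.
Variables (R : realType) (n : nat).
(* The space dimension is n.+1. *)
Local Notation E := 'rV[R]_n.+1.
Local Notation mu := (leb R n.+1).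
Implicit Types (w : set E) (phi : E -> R).

Definition dotv (a b : E) : R := \sum_i a 0 i * b 0 i.

(* L^2(w); functions are represented by Borel representatives and everything
   below is invariant under modification on null sets. *)
Definition L2 w : set (E -> R) :=
  [set f : E -> R | measurable_fun w f /\
           (\int[mu]_(x in w) ((f x) ^+ 2)%:E < +oo)%E].

Definition L2v w : set (E -> E) :=
  [set q : E -> E | forall i, L2 w (fun x => q x 0 i)].

Definition ip w (f g : E -> R) : R := \int[mu]_(x in w) (f x * g x).

Definition ipv w (p q : E -> E) : R := \int[mu]_(x in w) dotv (p x) (q x).

Definition partial (i : 'I_n.+1) phi : E -> R :=
  fun x => 'D_(delta_mx 0 i) phi x.

Definition grad phi : E -> E := fun x => \row_i partial i phi x.

Fixpoint Ck (k : nat) phi : Prop :=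
  continuous phi /\
  if k is l.+1 then
    forall i, (forall x, derivable phi x (delta_mx 0 i)) /\ Ck l (partial i phi)
  else True.

Definition tsupport phi : set E := closure [set x | phi x != 0].

Definition test_fun w : set (E -> R) :=
  [set phi | [/\ forall k, Ck k phi, compact (tsupport phi)
               & tsupport phi `<=` w]].

(* An H^1 function is carried together with its weak gradient, which it
   determines almost everywhere; likewise for H(div) and the divergence. *)
Definition sob : Type := (E -> R) * (E -> E).
Definition dvf : Type := (E -> E) * (E -> R).

Definition H1 w : set sob :=
  [set u | [/\ L2 w u.1, L2v w u.2 &
    forall phi i, test_fun w phi ->
      ip w u.1 (partial i phi) = - ip w (fun x => u.2 x 0 i) phi]].

Definition Hdiv w : set dvf :=
  [set q | [/\ L2v w q.1, L2 w q.2 &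
    forall phi, test_fun w phi -> ipv w q.1 (grad phi) = - ip w q.2 phi]].

Definition H1norm w (u : sob) : R := Num.sqrt (ip w u.1 u.1 + ipv w u.2 u.2).

Definition Hdivnorm w (q : dvf) : R := Num.sqrt (ipv w q.1 q.1 + ip w q.2 q.2).

Definition H10 w : set sob :=
  [set u | H1 w u /\ forall e, 0 < e ->
    exists2 phi, test_fun w phi & H1norm w (u - (phi, grad phi)) < e].

(* Trace space.  For Lipschitz w, the trace operator of H^1(w) has kernel
   H^1_0(w), and H^{1/2}(bd w) is its range, i.e. H^1(w) / H^1_0(w).  An element is given by
   a representative u in H^1(w): "u" then stands for the trace of u, and two
   representatives are the same trace when same_trace holds. *)
Definition same_trace w (u v : sob) : Prop := H10 w (u - v).

(* H^{-1/2}(bd w), the dual of H^{1/2}(bd w); sigma u is the duality pairing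
   of sigma with the trace of u.  Only the values on H1 w are meaningful. *)
Definition Hmhalf w : set (sob -> R) :=
  [set sigma |
    [/\ forall (a : R) u v, H1 w u -> H1 w v ->
          sigma ((fun x => a * u.1 x + v.1 x), (fun x => a *: u.2 x + v.2 x))
          = a * sigma u + sigma v,
        forall u, H10 w u -> sigma u = 0 &
        exists M : R, forall u, H1 w u -> `|sigma u| <= M * H1norm w u]].

Definition same_ntrace w (sigma rho : sob -> R) : Prop :=
  forall u, H1 w u -> sigma u = rho u.

(* The normal trace q.n on bd w, as the functional given by Green's formula. *)
Definition ntrace w (q : dvf) : sob -> R :=
  fun u => ipv w q.1 u.2 + ip w q.2 u.1.

Definition bd w : set E := closure w `\` interior w.

(* The H^{1/2}(bd w) element u is the Lipschitz function phi on bd w: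
   it is the trace of a Lipschitz function with boundary values phi. *)
Definition is_lip_trace w (u : sob) phi : Prop :=
  exists psi : sob,
    [/\ H1 w psi, exists k : R, k.-lipschitz psi.1,
        forall x, bd w x -> psi.1 x = phi x & same_trace w u psi].

Definition weak_cvg_half w (s : nat -> sob) (u : sob) : Prop :=
  forall sigma, Hmhalf w sigma -> (fun k => sigma (s k)) @ \oo --> sigma u.

Definition nonneg_half w (u : sob) : Prop :=
  exists2 s : nat -> sob,
    forall k, H1 w (s k) /\ exists phi,
      [/\ exists c : R, c.-lipschitz_(bd w) phi,
          forall x, bd w x -> 0 <= phi x & is_lip_trace w (s k) phi]
    & weak_cvg_half w s u.

Definition nonneg_mhalf w (sigma : sob -> R) : Prop :=
  forall v, H1 w v -> nonneg_half w v -> 0 <= sigma v.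

(* Locally, in a suitable orthonormal frame with last axis nu, Omega is the
   subgraph of a Lipschitz function psi of the component orthogonal to nu. *)
Definition lipschitz_boundary (Om : set E) : Prop :=
  forall x, bd Om x -> exists nu : E, exists psi : E -> R,
    [/\ dotv nu nu = 1, exists k : R, k.-lipschitz psi &
        \forall y \near x,
          Om y <-> dotv y nu < psi (y - dotv y nu *: nu)].

Definition simply_connected (Om : set E) : Prop :=
  forall g : R -> E, {within `[0, 1], continuous g} ->
    (forall t, t \in `[0, 1] -> Om (g t)) -> g 0 = g 1 ->
  exists h : R * R -> E,
    [/\ {within `[0, 1] `*` `[0, 1], continuous h},
        forall s t, s \in `[0, 1] -> t \in `[0, 1] -> Om (h (s, t)),
        forall t, t \in `[0, 1] -> h (0, t) = g t /\ h (1, t) = g 0 &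
        forall s, s \in `[0, 1] -> h (s, 0) = g 0 /\ h (s, 1) = g 0].

Definition admissible_domain (Om : set E) : Prop :=
  [/\ open Om /\ Om !=set0, connected Om, bounded_set Om,
      simply_connected Om & lipschitz_boundary Om].

End sobolev.

Section mesh.
Variables (R : realType) (n : nat).
Local Notation E := 'rV[R]_n.+1.
Implicit Types v : 'I_n.+2 -> E.

Definition affinely_independent v : Prop :=
  forall l : 'I_n.+2 -> R, \sum_j l j = 0 -> \sum_j l j *: v j = 0 ->
    forall j, l j = 0.

Definition simplex v : set E :=
  [set x | exists l : 'I_n.+2 -> R,
    [/\ forall j, 0 < l j, \sum_j l j = 1 & x = \sum_j l j *: v j]].

Definition bary_of_face (J : {set 'I_n.+2}) (l : 'I_n.+2 -> R) : Prop :=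
  [/\ forall j, 0 <= l j, \sum_j l j = 1 & forall j, j \notin J -> l j = 0].

(* The closed face spanned by the vertices in J; empty if J is. *)
Definition face v (J : {set 'I_n.+2}) : set E :=
  [set x | exists2 l, bary_of_face J l & x = \sum_j l j *: v j].

(* The inclusion of the cells in Om is implied by the covering condition when
   Om has a Lipschitz boundary. *)
Record mesh (Om : set E) := Mesh {
  msize : nat ;
  vert : 'I_msize -> 'I_n.+2 -> E ;
  vert_indep : forall i, affinely_independent (vert i) ;
  cell_disjoint : forall i j, i != j ->
    simplex (vert i) `&` simplex (vert j) = set0 ;
  cell_conforming : forall i j, exists J J' : {set 'I_n.+2},
    face (vert i) [set: _]%SET `&` face (vert j) [set: _]%SET
      = face (vert i) J /\
    face (vert i) J = face (vert j) J' ;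
  cell_sub : forall i, simplex (vert i) `<=` Om ;
  cell_cover : \bigcup_i closure (simplex (vert i)) = closure Om }.

(* Surface integral over the facet opposite to vertex j: the facet is the
   image of the reference simplex under t |-> base + t *m M. *)
Definition ref_simplex : set 'rV[R]_n :=
  [set t | (forall k, 0 <= t 0 k) /\ \sum_k t 0 k <= 1].

Definition facet_base v (j : 'I_n.+2) : E := v (lift j ord0).

Definition facet_mx v (j : 'I_n.+2) : 'M[R]_(n, n.+1) :=
  \matrix_(k < n) (v (lift j (lift ord0 k)) - facet_base v j).

Definition facet_int v (j : 'I_n.+2) (phi : E -> R) : R :=
  let M := facet_mx v j in
  Num.sqrt (\det (M *m M^T)) *
  \int[leb R n]_(t in ref_simplex) phi (facet_base v j + t *m M).

End mesh.

Section dpg.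
Variables (R : realType) (n : nat) (Om : set 'rV[R]_n.+1) (T : mesh Om).
Local Notation E := 'rV[R]_n.+1.
Local Notation mu := (leb R n.+1).
Local Notation sob := (sob R n).
Local Notation dvf := (dvf R n).

Definition cell (i : 'I_(msize T)) : set E := simplex (vert i).

Definition skeleton : set E := \bigcup_i bd (cell i).

(* Carriers of prod_T H^{1/2}(bd T) and prod_T H^{-1/2}(bd T). *)
Definition tr_fam : Type := 'I_(msize T) -> sob.
Definition ntr_fam : Type := 'I_(msize T) -> sob -> R.

Definition extends_tr (uh : tr_fam) : set sob :=
  [set w | H1 Om w /\ forall i, same_trace (cell i) (uh i) w].

Definition extends_ntr (sh : ntr_fam) : set dvf :=
  [set q | Hdiv Om q /\
           forall i, same_ntrace (cell i) (sh i) (ntrace (cell i) q)].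

Definition HhalfS : set tr_fam :=
  [set uh | (forall i, H1 (cell i) (uh i)) /\ extends_tr uh !=set0].

Definition HmhalfS : set ntr_fam :=
  [set sh | (forall i, Hmhalf (cell i) (sh i)) /\ extends_ntr sh !=set0].

Definition HhalfS_norm (uh : tr_fam) : R :=
  inf [set H1norm Om w | w in extends_tr uh].

Definition HmhalfS_norm (sh : ntr_fam) : R :=
  inf [set Hdivnorm Om q | q in extends_ntr sh].

(* Restrictions to the boundary of Om; neither depends on the chosen extension
   (the first one up to same_trace). *)
Definition restr_tr (uh : tr_fam) : sob := xget 0 (extends_tr uh).

Definition restr_ntr (sh : ntr_fam) : sob -> R :=
  ntrace Om (xget 0 (extends_ntr sh)).

Definition Ucarrier : Type :=
  (E -> R) * (E -> E) * tr_fam * ntr_fam.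

Definition u_of (u : Ucarrier) : E -> R := u.1.1.1.
Definition sigma_of (u : Ucarrier) : E -> E := u.1.1.2.
Definition uhat_of (u : Ucarrier) : tr_fam := u.1.2.
Definition sigmahat_of (u : Ucarrier) : ntr_fam := u.2.

Definition Uspace : set Ucarrier :=
  [set u | [/\ L2 Om (u_of u), L2v Om (sigma_of u),
               HhalfS (uhat_of u) & HmhalfS (sigmahat_of u)]].

Definition normU (u : Ucarrier) : R :=
  Num.sqrt (ip Om (u_of u) (u_of u) + ipv Om (sigma_of u) (sigma_of u)
            + HhalfS_norm (uhat_of u) ^+ 2 + HmhalfS_norm (sigmahat_of u) ^+ 2).

(* Elements are ((v, grad_T v), (tau, div_T tau)), with piecewise operators. *)
Definition Vcarrier : Type := sob * dvf.

Definition Vspace : set Vcarrier :=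
  [set v | [/\ L2 Om v.1.1 /\ L2v Om v.1.2, forall i, H1 (cell i) v.1,
               L2v Om v.2.1 /\ L2 Om v.2.2 & forall i, Hdiv (cell i) v.2]].

Definition ipV (v v' : Vcarrier) : R :=
  ip Om v.1.1 v'.1.1 + ipv Om v.1.2 v'.1.2
  + ipv Om v.2.1 v'.2.1 + ip Om v.2.2 v'.2.2.

Definition pair_trS (uh : tr_fam) (tau : dvf) : R :=
  \sum_i ntrace (cell i) tau (uh i).

Definition pair_ntrS (sh : ntr_fam) (v : sob) : R := \sum_i sh i v.

Definition bform (u : Ucarrier) (v : Vcarrier) : R :=
  let: ((v0, gv), (tau, dtau)) := v in
  ipv Om (sigma_of u) gv + ip Om (u_of u) v0
  - pair_ntrS (sigmahat_of u) (v0, gv)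
  + ipv Om (sigma_of u) tau + ip Om (u_of u) dtau
  - pair_trS (uhat_of u) (tau, dtau).

Definition Lform (f : E -> R) (v : Vcarrier) : R := ip Om f v.1.1.

Definition Theta (u : Ucarrier) : Vcarrier :=
  xget 0 [set w | Vspace w /\ forall v, Vspace v -> ipV w v = bform u v].

Definition Theta_beta (beta : R) (u : Ucarrier) : Vcarrier :=
  let: ((v, gv), (tau, dtau)) := Theta u in
  ((fun x => beta * v x, fun x => beta *: gv x),
   (fun x => beta *: tau x, fun x => beta * dtau x)).

Definition gamma0 (u : Ucarrier) : sob := restr_tr (uhat_of u).
Definition gamman (u : Ucarrier) : sob -> R := restr_ntr (sigmahat_of u).

(* The duality on the boundary of Om, with the second argument given by a
   representative of its trace. *)
Definition pairG (sigma : sob -> R) (v : sob) : R := sigma v.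

Definition a_0 beta (u v : Ucarrier) : R :=
  bform u (Theta_beta beta v) + pairG (gamman u) (gamma0 v).

Definition a_n beta (u v : Ucarrier) : R :=
  bform u (Theta_beta beta v) + pairG (gamman v) (gamma0 u).

Definition a_s beta (u v : Ucarrier) : R :=
  bform u (Theta_beta beta v)
  + 2^-1 * (pairG (gamman u) (gamma0 v) + pairG (gamman v) (gamma0 u)).

Definition Fform beta f (v : Ucarrier) : R := Lform f (Theta_beta beta v).

Definition K0 : set Ucarrier :=
  [set u | Uspace u /\ nonneg_half Om (gamma0 u)].
Definition Kn : set Ucarrier :=
  [set u | Uspace u /\ nonneg_mhalf Om (gamman u)].
Definition Ks : set Ucarrier := K0 `&` Kn.

Definition P0T (u : E -> R) : Prop :=
  forall i, exists c, {ae mu, forall x, cell i x -> u x = c}.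

Definition P0Tv (s : E -> E) : Prop :=
  forall i, exists c, {ae mu, forall x, cell i x -> s x = c}.

Definition S1S (uh : tr_fam) : Prop :=
  exists s : E -> R,
    [/\ {within skeleton, continuous s},
        forall (i : 'I_(msize T)) j l, bary_of_face (~: [set j])%SET l ->
          s (\sum_k l k *: vert i k) = \sum_k l k * s (vert i k) &
        forall i, is_lip_trace (cell i) (uh i) s].

(* On cell i, sh is the function equal to c i j on the facet opposite to vertex
   j, acting by the surface integral on the dense class of Lipschitz psi. *)
Definition P0S (sh : ntr_fam) : Prop :=
  exists c : 'I_(msize T) -> 'I_n.+2 -> R, forall i (psi : sob),
    H1 (cell i) psi -> (exists k : R, k.-lipschitz psi.1) ->
    sh i psi = \sum_j c i j * facet_int (vert i) j psi.1.

Definition Uh : set Ucarrier :=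
  [set u | Uspace u /\
    [/\ P0T (u_of u), P0Tv (sigma_of u), S1S (uhat_of u)
      & P0S (sigmahat_of u)]].

End dpg.

Variant variant := Var0 | Varn | Vars.

Definition aform (R : realType) (n : nat) (Om : set 'rV[R]_n.+1) (T : mesh Om)
    (star : variant) : R -> Ucarrier T -> Ucarrier T -> R :=
  match star with Var0 => @a_0 _ _ _ T | Varn => @a_n _ _ _ T
                | Vars => @a_s _ _ _ T end.

Definition Kcone (R : realType) (n : nat) (Om : set 'rV[R]_n.+1) (T : mesh Om)
    (star : variant) : set (Ucarrier T) :=
  match star with Var0 => @K0 _ _ _ T | Varn => @Kn _ _ _ T
                | Vars => @Ks _ _ _ T end.

Definition Kcone_h (R : realType) (n : nat) (Om : set 'rV[R]_n.+1)
    (T : mesh Om) (star : variant) : set (Ucarrier T) :=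
  @Kcone _ _ _ T star `&` @Uh _ _ _ T.
Arguments Kcone {R n Om} T star _.
Arguments Kcone_h {R n Om} T star _.

(* Main.v *)
(* The constant depends on beta only, because the boundary pairing is a
   volume integral: <gamma_n x, gamma_0 y> = ntrace Om q w for any q in
   H(div, Om) and w in H^1(Om) having the skeleton components of x and y as
   traces.  With such fields b(x, .) is the V-product with
   ((u - div q, sigma - q), (sigma - grad w, u - w)).  Testing the definition of
   Theta z with one component of V at a time shows that sigma - t.1.2 and
   u - t.2.2, where t = Theta z, belong to H(div, Om) and H^1(Om) and can be
   taken as q and w; hence (Theta z, Theta z)_V = b(z, Theta z) together with the
   boundary pairing is an explicit quadratic form, which bounds |z|_U^2 from
   above for beta >= 2.  The exact solution satisfies b(u, .) = L on V, as the
   residual can be removed by admissible variations, so that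
   a(u, v - u) - F(v - u) is a mere boundary term.  Adding the two variational
   inequalities and Young's inequality give the bound. *)
Require Import Defs.
From mathcomp Require Import all_boot all_order all_algebra.
From mathcomp Require Import all_classical all_reals all_analysis.
From mathcomp Require Import measurable_realfun.
From mathcomp Require Import ring lra.
Import Order.TTheory GRing.Theory Num.Theory.
Import numFieldNormedType.Exports.
Local Open Scope classical_set_scope.
Local Open Scope ring_scope.
Set Implicit Arguments.
Unset Strict Implicit.
Unset Printing Implicit Defensive.

(** * Semi-inner products *)

(** Functions are not identified when they agree almost everywhere, and membership in a space is a
    predicate. The Hilbert space arguments are therefore run for semi-inner products on a domain:
    limits and Riesz representatives exist without being unique, and [Theta] is additive only inside
    inner products.

    No trace is ever constructed on a boundary. Instead, z in H^1 belongs to H^1_0 exactly when the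
    Green functional of every H(div) field vanishes at z. Questions about traces thus become
    questions about integrals that split over the cells, and no trace inequality, hence no
    mesh-dependent constant, enters: the pairings are bounded by Cauchy-Schwarz with constant 1 in
    the minimal-extension norms.

    The delicate point is the residual when both traces are constrained: neither of them can be
    varied freely, and one-sided variations have to be combined so that the terms of unknown sign
    cancel.

    In the constant 100 (4 beta + 1)^2, the continuity bound 4 beta + 1 comes from |Theta z|^2 <= 4
    |z|^2 and the boundary pairing, and 100 from the coercivity constant 10 with a matching Young
    parameter. *)

Section semi_inner.
Variables (R : realType) (H : lmodType R).
Implicit Types (D M : set H) (B : H -> H -> R) (s : nat -> H).

Definition is_subspace D :=
  D 0 /\ forall (a : R) u v, D u -> D v -> D (a *: u + v).

(** The axioms are asked on [D] only, since outside it the integrals that instantiate [B] may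
    diverge and lose bilinearity. Definiteness is absent: in the instances [B u u = 0] only makes
    [u] vanish almost everywhere. *)
Definition semi_inner D B := [/\ is_subspace D,
  forall u v, D u -> D v -> B u v = B v u,
  forall (a : R) u v w, D u -> D v -> D w ->
    B (a *: u + v) w = a * B u w + B v w &
  forall u, D u -> 0 <= B u u].

Definition cauchy_for B s := forall e : R, 0 < e -> exists N, forall k l,
  (N <= k)%N -> (N <= l)%N -> B (s k - s l) (s k - s l) < e.

Definition cvg_for B s y := forall e : R, 0 < e -> exists N, forall k,
  (N <= k)%N -> B (s k - y) (s k - y) < e.

Definition complete_for D B := forall s, (forall k, D (s k)) ->
  cauchy_for B s -> exists2 y, D y & cvg_for B s y.

Lemma subspaceZ D a u : is_subspace D -> D u -> D (a *: u).
Proof. by move=> [D0 DD] Du; have := DD a u 0 Du D0; rewrite addr0. Qed.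

Lemma subspaceD D u v : is_subspace D -> D u -> D v -> D (u + v).
Proof. by move=> [_ DD] Du Dv; have := DD 1 u v Du Dv; rewrite scale1r. Qed.

Lemma subspaceN D u : is_subspace D -> D u -> D (- u).
Proof. by move=> sD Du; rewrite -scaleN1r; exact: subspaceZ. Qed.

Lemma subspaceB D u v : is_subspace D -> D u -> D v -> D (u - v).
Proof. by move=> sD Du Dv; apply: subspaceD => //; exact: subspaceN. Qed.

Section theory.
Variables (D : set H) (B : H -> H -> R).
Hypothesis DB : semi_inner D B.
Let sD : is_subspace D. Proof. by case: DB. Qed.
Let BC u v : D u -> D v -> B u v = B v u. Proof. by case: DB => _ h _ _; exact: h. Qed.

Lemma sinZl a u w : D u -> D w -> B (a *: u) w = a * B u w.
Proof.
case: DB => -[D0 _] _ BL _ Du Dw.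
have := BL (- 1) 0 0 w D0 D0 Dw; rewrite scaler0 addr0 mulN1r addNr => B0.
by have := BL a u 0 w Du D0 Dw; rewrite addr0 B0 addr0.
Qed.

Lemma sinDl u v w : D u -> D v -> D w -> B (u + v) w = B u w + B v w.
Proof.
by case: DB => _ _ BL _ Du Dv Dw; have := BL 1 u v w Du Dv Dw; rewrite scale1r mul1r.
Qed.

Lemma sinNl u w : D u -> D w -> B (- u) w = - B u w.
Proof. by move=> Du Dw; rewrite -scaleN1r sinZl// mulN1r. Qed.

Lemma sinBl u v w : D u -> D v -> D w -> B (u - v) w = B u w - B v w.
Proof. by move=> Du Dv Dw; rewrite sinDl ?sinNl//; exact: subspaceN. Qed.

Lemma sinZr a u w : D u -> D w -> B w (a *: u) = a * B w u.
Proof. by move=> Du Dw; rewrite BC ?sinZl ?(BC Du)//; exact: subspaceZ. Qed.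

Lemma sinDr u v w : D u -> D v -> D w -> B w (u + v) = B w u + B w v.
Proof.
move=> Du Dv Dw; rewrite BC//; last exact: subspaceD.
by rewrite sinDl// (BC Du)// (BC Dv).
Qed.

Lemma sinNr u w : D u -> D w -> B w (- u) = - B w u.
Proof. by move=> Du Dw; rewrite -scaleN1r sinZr// mulN1r. Qed.

Lemma sinBr u v w : D u -> D v -> D w -> B w (u - v) = B w u - B w v.
Proof. by move=> Du Dv Dw; rewrite sinDr ?sinNr//; exact: subspaceN. Qed.

Lemma sin_ge0 u : D u -> 0 <= B u u.
Proof. by case: DB => _ _ _; exact. Qed.

Lemma sin_sqrD (t : R) u v : D u -> D v ->
  B (u + t *: v) (u + t *: v) = B u u + 2 * t * B u v + t ^+ 2 * B v v.
Proof.
move=> Du Dv; have Dtv : D (t *: v) by exact: subspaceZ.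
rewrite sinDl//; last exact: subspaceD.
by rewrite !sinDr// !sinZl// !sinZr// (BC Dv Du); ring.
Qed.

(** The degenerate case [c = 0] does occur for semi-inner products. The expression is then affine in
    [t], and an affine function bounded from below is constant. *)
Lemma quad_ge0_disc (a b c : R) : 0 <= c ->
  (forall t : R, 0 <= a + 2 * t * b + t ^+ 2 * c) -> b ^+ 2 <= a * c.
Proof.
move=> c0 h; have [c0'|] := ltP 0 c.
  have := h (- b / c).
  have -> : a + 2 * (- b / c) * b + (- b / c) ^+ 2 * c = (a * c - b ^+ 2) / c.
    by field; rewrite gt_eqF.
  by rewrite pmulr_lge0 ?invr_gt0// subr_ge0.
move=> c0'; have {c0 c0'}c0 : c = 0 by apply/eqP; rewrite eq_le c0 c0'.
subst c; rewrite mulr0; have [->|b0] := eqVneq b 0; first by rewrite expr0n.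
have := h (- (a + 1) / (2 * b)).
have -> : a + 2 * (- (a + 1) / (2 * b)) * b + (- (a + 1) / (2 * b)) ^+ 2 * 0 = -1.
  by field.
by rewrite oppr_ge0 ler10.
Qed.

Lemma sin_CS u v : D u -> D v -> B u v ^+ 2 <= B u u * B v v.
Proof.
move=> Du Dv; apply: quad_ge0_disc; first exact: sin_ge0.
move=> t; rewrite -sin_sqrD//; apply: sin_ge0.
by apply: subspaceD => //; exact: subspaceZ.
Qed.

Lemma sin_CSsqrt u v : D u -> D v ->
  `|B u v| <= Num.sqrt (B u u) * Num.sqrt (B v v).
Proof.
move=> Du Dv; rewrite -sqrtr_sqr -sqrtrM ?sin_ge0//.
by apply: ler_wsqrtr; exact: sin_CS.
Qed.

Lemma sin_eq0 u v : D u -> D v -> B u u = 0 -> B u v = 0.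
Proof.
move=> Du Dv u0; have := sin_CS Du Dv; rewrite u0 mul0r => h.
by apply/eqP; rewrite -sqrf_eq0 eq_le h sqr_ge0.
Qed.

Lemma sin_le2D u v : D u -> D v -> B (u + v) (u + v) <= 2 * B u u + 2 * B v v.
Proof.
move=> Du Dv.
have h : 0 <= B (u + (-1) *: v) (u + (-1) *: v).
  by apply: sin_ge0; apply: subspaceD => //; exact: subspaceZ.
have := sin_sqrD 1 Du Dv; rewrite scale1r => ->.
by move: h; rewrite sin_sqrD//; nra.
Qed.

Lemma cvg_for_sin s y v : (forall k, D (s k)) -> D y -> D v ->
  cvg_for B s y -> forall e : R, 0 < e ->
  exists N, forall k, (N <= k)%N -> `|B (s k) v - B y v| < e.
Proof.
move=> Ds Dy Dv sy e e0.
have d0 : 0 < e ^+ 2 / (B v v + 1).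
  by rewrite divr_gt0 ?exprn_gt0// ltr_wpDl// sin_ge0.
have [N hN] := sy _ d0; exists N => k Nk; have {hN} := hN k Nk.
have v0 := sin_ge0 Dv.
have Dsy : D (s k - y) by exact: subspaceB.
rewrite -sinBl// ltr_pdivlMr; last by rewrite ltr_wpDl.
move=> h; rewrite -(@ltr_pXn2r _ 2)// ?nnegrE ?(ltW e0)//.
rewrite real_normK ?num_real//; apply: le_lt_trans (sin_CS Dsy Dv) _.
apply: le_lt_trans h; rewrite ler_wpM2l ?sin_ge0//.
by rewrite lerDl.
Qed.

(* Minimising [B m m - 2 l m] over [M]: by the parallelogram identity a
   minimising sequence is Cauchy. *)
Lemma riesz_closure M (l : H -> R) (K : R) :
  0 <= K -> complete_for D B -> is_subspace M -> M `<=` D ->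
  (forall (a : R) u v, M u -> M v -> l (a *: u + v) = a * l u + l v) ->
  (forall m, M m -> l m ^+ 2 <= K * B m m) ->
  exists y, [/\ D y, forall m, M m -> B y m = l m &
    forall e : R, 0 < e -> exists2 m, M m & B (m - y) (m - y) < e].
Proof.
move=> K0 cD sM MD lL lK.
pose J m := B m m - 2 * l m.
have lZ a m : M m -> l (a *: m) = a * l m.
  move=> Mm; have M0 := sM.1.
  have := lL (-1) 0 0 M0 M0; rewrite scaler0 addr0 mulN1r addNr => l0.
  by have := lL a m 0 Mm M0; rewrite addr0 l0 addr0.
have lD u v : M u -> M v -> l (u + v) = l u + l v.
  by move=> Mu Mv; have := lL 1 u v Mu Mv; rewrite scale1r mul1r.
have Jlb m : M m -> - K <= J m.
  move=> Mm; rewrite /J; have := lK m Mm; have := sin_ge0 (MD _ Mm).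
  set b := B m m; set t := l m => b0 h.
  have : (2 * t) ^+ 2 <= (K + b) ^+ 2 by have := sqr_ge0 (K - b); nra.
  rewrite -[(2 * t) ^+ 2]real_normK ?num_real// ler_sqr ?nnegrE ?addr_ge0//.
  by move=> /(le_trans (ler_norm _)); lra.
pose S := [set J m | m in M].
have hS : has_inf S.
  split; first by exists (J 0), 0 => //; exact: sM.1.
  by exists (- K) => _ [m Mm <-]; exact: Jlb.
pose I := inf S.
have IJ m : M m -> I <= J m by move=> Mm; apply: ge_inf; [exact: hS.2|exists m].
have ex k : exists m, M m /\ J m < I + k.+1%:R^-1.
  have e0 : 0 < k.+1%:R^-1 :> R by rewrite invr_gt0.
  by have [_ [m Mm <-] h] := inf_adherent e0 hS; exists m.
have [s hs] := choice ex.
have Ms k : M (s k) by case: (hs k).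
have Ds k : D (s k) by exact: MD.
(* Moving the nearly minimal [s k] by [t *: m] lowers [J] by less than [k.+1%:R^-1]. This inequality
   yields both the Cauchy property and, through its discriminant, the limit equation. *)
have key k m t : M m -> 0 <= k.+1%:R^-1 + 2 * t * (B (s k) m - l m) + t ^+ 2 * B m m.
  move=> Mm; have Mtm : M (t *: m) by exact: subspaceZ.
  have := IJ _ (subspaceD sM (Ms k) Mtm).
  rewrite /J sin_sqrD//; last exact: MD.
  rewrite lD// lZ//; have := (hs k).2; rewrite /J.
  by move: k.+1%:R^-1 => d; nra.
have cs : cauchy_for B s.
  move=> e e0; have [N hN] : exists N, N.+1%:R^-1 < e / 4.
    have e40 : 0 < e / 4 by rewrite divr_gt0.
    exists (Num.truncn (e / 4)^-1).
    by rewrite invf_plt ?posrE// truncnS_gt.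
  exists N => k l' Nk Nl.
  have Md : M (s k - s l') by exact: subspaceB.
  have h j : (N <= j)%N -> j.+1%:R^-1 < e / 4.
    by move=> Nj; apply: le_lt_trans hN; rewrite lef_pV2 ?posrE// ler_nat.
  (* Opposite steps of size 1/2 along [s k - s l']: the values of [l] cancel in the sum, and half of
     [B d d] remains, bounded by the two errors. *)
  have := key k _ (- 2^-1) Md; have := key l' _ 2^-1 Md.
  have := h k Nk; have := h l' Nl.
  set d := s k - s l' in Md *.
  have -> : B d d = B (s k) d - B (s l') d by rewrite -sinBl//; exact: MD.
  by move: (_ d) (_ d) (l d) k.+1%:R^-1 l'.+1%:R^-1 => *; lra.
have [y Dy sy] := cD s Ds cs.
exists y; split => //.
  move=> m Mm; apply/eqP; rewrite -subr_eq0 -normr_le0; apply/ler_addgt0Pr => e e0.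
  rewrite add0r.
  have Dm := MD _ Mm; have b0 := sin_ge0 Dm.
  have e20 : 0 < e / 2 by rewrite divr_gt0.
  have [N1 hN1] := cvg_for_sin Ds Dy Dm sy e20.
  pose N2 := Num.truncn ((e / 2) ^+ 2 / (B m m + 1))^-1.
  pose k := maxn N1 N2.
  have hk : k.+1%:R^-1 * (B m m + 1) < (e / 2) ^+ 2.
    rewrite -ltr_pdivlMr; last by rewrite ltr_wpDl.
    have d0 : 0 < (e / 2) ^+ 2 / (B m m + 1).
      by rewrite divr_gt0 ?exprn_gt0// ltr_wpDl.
    rewrite invf_plt ?posrE//; apply: lt_le_trans (truncnS_gt _) _.
    by rewrite ler_nat ltnS leq_maxr.
  (* The discriminant bounds the defect in the limit equation: [(B (s k) m - l m) ^+ 2 <= k.+1%:R^-1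
     * B m m]. *)
  have hd := quad_ge0_disc b0 (fun t => key k m t Mm).
  have h1 := hN1 k (leq_maxl _ _).
  have h2 : `|B (s k) m - l m| <= e / 2.
    rewrite -ler_sqr ?nnegrE ?(ltW e20)// real_normK ?num_real//.
    apply: le_trans hd _; apply: le_trans (ltW hk).
    by rewrite ler_wpM2l ?invr_ge0// lerDl.
  have -> : B y m - l m = (B (s k) m - l m) - (B (s k) m - B y m) by ring.
  by apply: le_trans (ler_normB _ _) _; lra.
by move=> e e0; have [N hN] := sy e e0; exists (s N) => //; exact: hN.
Qed.

End theory.
End semi_inner.

(** * Square-integrable functions *)

(** Fatou's lemma as lower semicontinuity along pointwise limits. A bound on the tail is enough,
    which is what a Cauchy condition supplies. *)
Lemma fatou_le d (T : measurableType d) (R : realType)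
    (mu : {measure set T -> \bar R}) (D : set T) (f : nat -> T -> \bar R)
    (g : T -> \bar R) (c : \bar R) (N : nat) :
  measurable D -> (forall k, measurable_fun D (f k)) ->
  (forall k x, D x -> (0 <= f k x)%E) ->
  (forall x, D x -> f ^~ x @ \oo --> g x) ->
  (forall k, (N <= k)%N -> (\int[mu]_(x in D) f k x <= c)%E) ->
  (\int[mu]_(x in D) g x <= c)%E.
Proof.
move=> mD mf f0 fg fc.
have -> : (\int[mu]_(x in D) g x = \int[mu]_(x in D) limn_einf (f ^~ x))%E.
  by apply: eq_integral => x /set_mem Dx; rewrite (cvg_limn_einf_sup (fg x Dx)).1.
apply: le_trans (fatou mu mD mf f0) _; rewrite limn_einf_lim.
apply: lime_le; first exact: is_cvg_einfs.
exists N => // k /= Nk; apply: le_trans (fc k Nk).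
by apply: ereal_inf_lbound; exists k => /=.
Qed.

Section L2.
Variables (R : realType) (n : nat) (w : set 'rV[R]_n.+1).
Local Notation E := 'rV[R]_n.+1.
Local Notation mu := (leb R n.+1).
Hypothesis mw : measurable w.
Implicit Types f g : E -> R.

Lemma L2_integrableM f g : L2 w f -> L2 w g ->
  mu.-integrable w (EFin \o (fun x => f x * g x)).
Proof.
move=> [mf fi] [mg gi].
have mf2 : measurable_fun w (fun x => (f x ^+ 2)%:E).
  by apply/measurable_EFinP; exact: measurable_funX.
have mg2 : measurable_fun w (fun x => (g x ^+ 2)%:E).
  by apply/measurable_EFinP; exact: measurable_funX.
apply: (@le_integrable _ _ _ _ _ mw _ (fun x => (f x ^+ 2)%:E + (g x ^+ 2)%:E)%E).
- by apply/measurable_EFinP; exact: measurable_funM.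
- move=> x _ /=; rewrite lee_fin [leRHS]ger0_norm ?addr_ge0 ?sqr_ge0//.
  rewrite normrM; have := sqr_ge0 (`|f x| - `|g x|).
  have := normr_ge0 (f x); have := normr_ge0 (g x).
  by rewrite -[f x ^+ 2]real_normK ?num_real// -[g x ^+ 2]real_normK ?num_real//; nra.
- apply: integrableD => //; apply/integrableP; split => //.
  + by under eq_integral do rewrite gee0_abs ?lee_fin ?sqr_ge0//.
  + by under eq_integral do rewrite gee0_abs ?lee_fin ?sqr_ge0//.
Qed.

Lemma L2_of_integrable f : measurable_fun w f ->
  mu.-integrable w (EFin \o (fun x => f x * f x)) -> L2 w f.
Proof.
move=> mf /integrableP[_ h]; split => //.
move: h; congr (_ < _)%E; apply: eq_integral => x _.
by rewrite /= -expr2 ger0_norm ?sqr_ge0.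
Qed.

Lemma L2_subspace : is_subspace (L2 w).
Proof.
split.
  split; first exact: measurable_cst.
  by under eq_integral do rewrite expr0n/=; rewrite integral0 ltry.
move=> a f g Lf Lg.
have h x : (a *: f + g) x = a * f x + g x by [].
apply: L2_of_integrable.
  apply: measurable_funD; last by case: Lg.
  by apply: measurable_funM; [exact: measurable_cst|case: Lf].
have := @integrableD _ _ _ mu w mw _ _ (integrableD mw
  (integrableZl mw (a ^+ 2) (L2_integrableM Lf Lf))
  (integrableZl mw (2 * a) (L2_integrableM Lf Lg))) (L2_integrableM Lg Lg).
apply: eq_integrable => // x _ /=; rewrite h -EFinM -EFinD; congr (_ %:E).
ring.
Qed.

Lemma ip_semi_inner : semi_inner (L2 w) (@ip R n w).
Proof.
split; first exact: L2_subspace.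
- by move=> f g _ _; apply: eq_Rintegral => x _; rewrite mulrC.
- move=> a f g h Lf Lg Lh; rewrite /ip.
  transitivity (\int[mu]_(x in w) (a * (f x * h x) + g x * h x)).
    by apply: eq_Rintegral => x _ /=; rewrite mulrDl mulrA.
  rewrite RintegralD//; [|exact: integrableZl (L2_integrableM Lf Lh)|exact: L2_integrableM].
  by rewrite RintegralZl//; exact: L2_integrableM.
- by move=> f _; apply: Rintegral_ge0 => x _; rewrite -expr2 sqr_ge0.
Qed.

Lemma EFin_ip f : L2 w f -> (ip w f f)%:E = (\int[mu]_(x in w) (f x ^+ 2)%:E)%E.
Proof.
move=> Lf; rewrite /ip /Rintegral fineK//.
exact: (integrable_fin_num mw (L2_integrableM Lf Lf)).
Qed.

(** Riesz-Fischer with squares in place of norms: along a fast subsequence the weighted series of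
    squared increments is integrable, hence finite almost everywhere, and the weights then force
    geometric decay of the increments at each such point. *)
Lemma L2_complete : complete_for (L2 w) (@ip R n w).
Proof.
move=> s Ls cs.
(* The factor [4^-1 ^+ k] pays for the weight [4 ^+ k] in [S0] below, and [2 ^ k.+1] makes the
   integrals of the terms sum to at most 1. *)
have e0 k : 0 < 4^-1 ^+ k / (2 ^ k.+1)%:R :> R.
  by rewrite divr_gt0 ?exprn_gt0 ?ltr0n ?expn_gt0.
have [N hN] := choice (fun k => cs _ (e0 k)).
(* Partial sums make the indices monotone and larger than [N k]; the successors make them at least
   [k]. *)
pose j k := (\sum_(i < k.+1) (N i).+1)%N.
have jN k : (N k <= j k)%N.
  by rewrite /j big_ord_recr/=; apply: leq_trans (leq_addl _ _); exact: leqnSn.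
have jk k : (k <= j k)%N.
  elim: k => // k ih; rewrite /j big_ord_recr/= -[leqLHS]addn1.
  by apply: leq_add.
have jS k : (j k <= j k.+1)%N by rewrite /j [in leqRHS]big_ord_recr/= leq_addr.
pose g k := s (j k).
have Lg k : L2 w (g k) by exact: Ls.
have Ld k : L2 w (g k.+1 - g k) by apply: subspaceB => //; exact: L2_subspace.
have hd k : ip w (g k.+1 - g k) (g k.+1 - g k) < 4^-1 ^+ k / (2 ^ k.+1)%:R.
  by apply: hN; [exact: leq_trans (jN k) (jS k)|exact: jN].
pose S0 k x := ((4 ^+ k * (g k.+1 x - g k x) ^+ 2)%:E : \bar R).
have mS0 k : measurable_fun w (S0 k).
  apply/measurable_EFinP; apply: measurable_funM; first exact: measurable_cst.
  by apply: measurable_funX; have [] := Ld k.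
have S00 k x : w x -> (0 <= S0 k x)%E.
  by move=> _; rewrite lee_fin; apply: mulr_ge0; rewrite ?sqr_ge0 ?exprn_ge0.
pose S x := (\sum_(0 <= k <oo) S0 k x)%E.
have mS : measurable_fun w S.
  rewrite /S; have := @ge0_emeasurable_sum _ _ R w S0 xpredT _ _.
  by apply => // k x wx _; exact: S00.
have iS : (\int[mu]_(x in w) S x <= 1%:E)%E.
  rewrite /S integral_nneseries//.
  apply: le_trans (epsilon_trick0 xpredT ler01); apply: lee_nneseries => k _.
    by move=> _; apply: integral_ge0; exact: S00.
  rewrite /S0; under eq_integral do rewrite EFinM.
  rewrite ge0_integralZl_EFin//; last 2 first.
  - by move=> x _; rewrite lee_fin sqr_ge0.
  - by apply/measurable_EFinP; apply: measurable_funX; have [] := Ld k.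
  rewrite -(EFin_ip (Ld k)) -EFinM lee_fin.
  rewrite -ler_pdivlMl ?exprn_gt0//; apply: le_trans (ltW (hd k)) _.
  by rewrite exprVn mul1r.
have Si : mu.-integrable w S.
  apply/integrableP; split => //.
  under eq_integral => x /set_mem wx.
    rewrite gee0_abs; last by apply: nneseries_ge0 => k _ _; exact: S00.
    over.
  by apply: le_lt_trans iS _; rewrite ltry.
have [A [mA A0 hA]] := integrable_ae mw Si.
pose w0 := w `\` A.
have mw0 : measurable w0 by exact: measurableD.
have Sfin x : w0 x -> S x \is a fin_num.
  move=> [wx nAx]; apply: contrapT => nS; apply: nAx; apply: hA => /=.
  by move=> h; apply: nS; exact: h.
have gcvg x : w0 x -> cvgn (g ^~ x).
  move=> wx; have wx' := wx.1.
  have hs k : `|g k.+1 x - g k x| <= Num.sqrt (fine (S x)) * 2^-1 ^+ k.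
    have : (S0 k x <= S x)%E.
      apply: le_trans (nneseries_lim_ge k.+1 _) => //; last by move=> i _ _; exact: S00.
      by rewrite big_nat_recr//= leeDr// sume_ge0// => i _; exact: S00.
    have Sx0 : 0 <= fine (S x).
      by apply: fine_ge0; apply: nneseries_ge0 => i _ _; exact: S00.
    rewrite -[leRHS](fineK (Sfin x wx)) lee_fin => h.
    rewrite -ler_sqr ?nnegrE ?mulr_ge0 ?sqrtr_ge0 ?exprn_ge0// exprMn.
    rewrite sqr_sqrtr//.
    rewrite real_normK ?num_real// -exprM mulnC exprM exprVn.
    rewrite (_ : 2 ^+ 2 = 4) -?natrX// exprVn.
    by rewrite ler_pdivlMr ?exprn_gt0// mulrC.
  have hser : cvgn (series (telescope (g ^~ x))).
    apply: normed_cvg; apply: (@series_le_cvg _ _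
      (geometric (Num.sqrt (fine (S x))) 2^-1)).
    - by move=> k /=.
    - by move=> k; rewrite /= mulr_ge0 ?sqrtr_ge0 ?exprn_ge0.
    - by move=> k; exact: hs.
    - by apply: is_cvg_geometric_series; rewrite ger0_norm ?invf_lt1// ltr1n.
  rewrite (_ : g ^~ x = (fun k => g 0%N x + series (telescope (g ^~ x)) k)).
    by apply: is_cvgD => //; exact: is_cvg_cst.
  by apply/funext => k; exact: (eq_sum_telescope (g ^~ x) k).
(* The default value 0 on the exceptional null set keeps [f] measurable on all of [w]. *)
pose f : E -> R := fun x => if x \in w0 then limn (g ^~ x) else 0.
have mf0 : measurable_fun w0 f.
  apply: (@measurable_fun_cvg _ _ _ _ g).
    by move=> k; apply: measurable_funS mw _ (Lg k).1 => // x [].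
  by move=> x wx; rewrite /f mem_set//; exact: gcvg.
have mf : measurable_fun w f.
  rewrite -(setDUK (_ : w `&` A `<=` w)); last by move=> x [].
  rewrite setDIr setDv set0U.
  apply/measurable_funU => //; first exact: measurableI.
  split => //; have h0 : measurable_fun (w `&` A) (cst 0 : E -> R) by exact: measurable_cst.
  apply: eq_measurable_fun h0.
  by move=> x /set_mem [wx Ax]; rewrite /f /cst memNset// => -[].
(* Fatou along the subsequence: the Cauchy bound for [s k - g i] passes to the limit in [i]. The
   square integrability of [f] is then read off from that of [s k - f]. *)
have key k e : (forall l, (k <= l)%N -> ip w (s k - s l) (s k - s l) <= e) ->
    (\int[mu]_(x in w) ((s k x - f x) ^+ 2)%:E <= e%:E)%E.
  move=> he.
  have ms l : measurable_fun w (s k - s l).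
    by have := subspaceB L2_subspace (Ls k) (Ls l); case.
  rewrite (@ge0_negligible_integral _ _ _ mu w A)//; last 2 first.
  - apply/measurable_EFinP; apply: measurable_funX; apply: measurable_funB => //.
    by have [] := Ls k.
  - by move=> x _; rewrite lee_fin sqr_ge0.
  apply: (@fatou_le _ _ _ mu w0 (fun i x => ((s k x - g i x) ^+ 2)%:E) _ _ k) => //.
  - move=> i; apply/measurable_EFinP; apply: measurable_funX.
    by apply: (measurable_funS mw _ (ms (j i))) => x [].
  - by move=> i x _; rewrite lee_fin sqr_ge0.
  - move=> x wx; apply: cvg_EFin; first by apply: nearW => i.
    rewrite [X in X @ _ --> _](_ : _ = (fun i => (s k x - g i x) ^+ 2))//.
    rewrite expr2; apply: cvgM; apply: cvgB; try exact: cvg_cst.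
      by rewrite /f mem_set//; exact: gcvg.
    by rewrite /f mem_set//; exact: gcvg.
  - move=> i ki; apply: (@le_trans _ _ (ip w (s k - g i) (s k - g i))%:E); last first.
      rewrite lee_fin; apply: he; apply: leq_trans ki _.
      exact: jk.
    rewrite EFin_ip; last exact: subspaceB L2_subspace _ _.
    apply: ge0_subset_integral => //.
    + by apply/measurable_EFinP; apply: measurable_funX; exact: ms.
    + by move=> x _; rewrite lee_fin sqr_ge0.
    + by move=> x [].
have Lsf k e : (forall l, (k <= l)%N -> ip w (s k - s l) (s k - s l) <= e) ->
    L2 w (s k - f).
  move=> he; split; last by apply: le_lt_trans (key k e he) _; rewrite ltry.
  by apply: measurable_funB => //; have [] := Ls k.
have [k0 hk0] := cs 1 ltr01.
have L0 : L2 w (s k0 - f).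
  by apply: (Lsf _ 1) => l kl; apply/ltW; exact: hk0.
have Lf : L2 w f.
  by have := subspaceB L2_subspace (Ls k0) L0; rewrite opprB addrC subrK.
exists f => // e e0'; have [k1 hk1] := cs (e / 2) (divr_gt0 e0' (ltr0n _ 2)).
exists k1 => k kk1; have he l : (k <= l)%N -> ip w (s k - s l) (s k - s l) <= e / 2.
  by move=> kl; apply/ltW; apply: hk1 => //; exact: leq_trans kl.
have := key k _ he; rewrite -(EFin_ip (Lsf k _ he)) lee_fin => /le_lt_trans; apply.
by rewrite ltr_pdivrMr// ltr_pMr// ltr1n.
Qed.

End L2.

(** * Measurability and integration by parts *)

Lemma continuous_addR (R : realType) (X : topologicalType) (f g : X -> R) :
  continuous f -> continuous g -> continuous (fun x => f x + g x).
Proof. by move=> cf cg x; apply: cvgD; [exact: cf|exact: cg]. Qed.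

Lemma continuous_mulR (R : realType) (X : topologicalType) (f g : X -> R) :
  continuous f -> continuous g -> continuous (fun x => f x * g x).
Proof. by move=> cf cg x; apply: cvgM; [exact: cf|exact: cg]. Qed.

Lemma continuous_cstR (R : realType) (X : topologicalType) (c : R) :
  continuous (fun _ : X => c).
Proof. by move=> x; exact: cvg_cst. Qed.

Section rV_measurable.
Variables (R : realType) (n : nat).
Implicit Types (U : set 'rV[R]_n).

Let box (q : 'rV[rat]_n * nat) : set 'rV[R]_n :=
  [set x | forall i, `|x 0 i - ratr (q.1 0 i)| < q.2.+1%:R^-1].

Let measurable_box q : measurable (box q).
Proof.
rewrite [X in measurable X](_ : _ = \bigcap_(i in [set: 'I_n])
    ((fun x : 'rV[R]_n => x 0 i) @^-1`
      [set t | `|t - ratr (q.1 0 i)| < q.2.+1%:R^-1])); last first.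
  by apply/seteqP; split => [x h i _|x h i]; exact: h.
apply: fin_bigcap_measurable => // i _; rewrite -[X in measurable X]setTI.
apply: measurable_coord => //.
rewrite [X in measurable X](_ : _ = ball (ratr (q.1 0 i) : R) q.2.+1%:R^-1).
  exact: measurable_ball.
by apply/seteqP; split => t; rewrite /ball/= distrC.
Qed.

(** The sigma-algebra is generated by the coordinates, so an open set has to be recovered as a
    countable union: that of the cubes with rational centre and radius [k.+1%:R^-1] which it
    contains. *)
Lemma open_measurable_rV U : open U -> measurable U.
Proof.
move=> oU; pose F m := if unpickle m is Some q then
  if `[< box q `<=` U >] then box q else set0 else set0.
suff -> : U = \bigcup_m F m.
  apply: bigcup_measurable => m _; rewrite /F.
  by case: (unpickle m) => [q|]; [case: ifP => _|]; [exact: measurable_box|exact: measurable0|exact: measurable0].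
apply/seteqP; split => [x Ux|x [m _]]; last first.
  by rewrite /F; case: (unpickle m) => // q; case: asboolP => // h /h.
have /nbhs_ballP[e /= e0 eU] : nbhs x U by exact: open_nbhs_nbhs.
(* A cube of radius below [e / 2] that contains [x] stays within the ball of radius [e] around
   [x]. *)
have [k hk] : exists k, k.+1%:R^-1 < e / 2.
  exists (Num.truncn (e / 2)^-1); rewrite invf_plt ?posrE ?divr_gt0//.
  exact: truncnS_gt.
have k0 : 0 < k.+1%:R^-1 :> R by rewrite invr_gt0.
have ex i : exists q : rat, `|x 0 i - ratr q| < k.+1%:R^-1.
  have [q] := @rat_in_itvoo _ (x 0 i - k.+1%:R^-1) (x 0 i + k.+1%:R^-1)
    ltac:(by rewrite ltrBlDr -addrA ltrDl addr_gt0).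
  by rewrite in_itv/= => /andP[h1 h2]; exists q; rewrite ltr_norml;
  move: h1 h2; move: (_^-1) (ratr q) => d r h1 h2; lra.
have [q hq] := choice ex.
exists (pickle (\row_i q i, k)) => //; rewrite /F pickleK.
case: asboolP => [_ i|]; first by rewrite /= mxE.
case=> y hy; apply: eU; split => // i j; rewrite ord1.
have := hy j; have := hq j; rewrite /= !mxE => h1 h2.
rewrite /ball/= (_ : x 0 j - y 0 j = (x 0 j - ratr (q j)) - (y 0 j - ratr (q j))).
  apply: le_lt_trans (ler_normB _ _) _.
  by move: hk h1 h2; move: (_^-1) `|_| `|_| => d r1 r2 *; lra.
by ring.
Qed.

Lemma continuous_measurable_rV (f : 'rV[R]_n -> R) :
  continuous f -> measurable_fun setT f.
Proof.
move=> /continuousP cf; apply: (measurability _ (RGenOpens.measurableE R)).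
move=> _ [_ [a [b ->] <-]]; rewrite setTI; apply: open_measurable_rV.
exact/cf/interval_open.
Qed.

Lemma continuous_coord (i : 'I_n) : continuous (fun x : 'rV[R]_n => x 0 i).
Proof. exact: coord_continuous. Qed.

Lemma continuous_affine (b : 'rV[R]_n) (c : R) :
  continuous (fun x : 'rV[R]_n => c + \sum_i b 0 i * x 0 i).
Proof.
suff h (s : seq 'I_n) : continuous (fun x : 'rV[R]_n => \sum_(i <- s) b 0 i * x 0 i).
  by apply: continuous_addR; [exact: continuous_cstR|exact: h].
elim: s => [|i s ih].
  rewrite (_ : (fun _ => _) = (fun=> 0)); first exact: continuous_cstR.
  by apply/funext => y; rewrite big_nil.
rewrite (_ : (fun _ => _) =
  (fun y : 'rV[R]_n => b 0 i * y 0 i + \sum_(i <- s) b 0 i * y 0 i)); last first.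
  by apply/funext => y; rewrite big_cons.
apply: continuous_addR; last exact: ih.
by apply: continuous_mulR; [exact: continuous_cstR|exact: continuous_coord].
Qed.

End rV_measurable.

Lemma rv_cons0 (R : realType) (n : nat) (p : R * 'rV[R]_n) :
  rv_cons p 0 ord0 = p.1.
Proof. by have := rv_consK p => /(congr1 fst). Qed.

Lemma rv_consS (R : realType) (n : nat) (p : R * 'rV[R]_n) (i : 'I_n) :
  rv_cons p 0 (lift ord0 i) = p.2 0 i.
Proof.
rewrite /rv_cons (_ : lift ord0 i = rshift 1 i); first exact: row_mxEr.
exact: val_inj.
Qed.

(** Slice along the first coordinate. If some remaining coefficient is non-zero, every slice is a
    null hyperplane of one dimension less; otherwise only the slice at [- c / b 0 ord0] is
    non-empty. *)
Lemma leb_hyperplane (R : realType) (n : nat) (b : 'rV[R]_n) (c : R) :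
  b != 0 -> leb R n [set x | c + \sum_i b 0 i * x 0 i = 0] = 0%E.
Proof.
elim: n b c => [|n IH] b c; first by rewrite [b]thinmx0 eqxx.
move=> b0.
rewrite /leb -/leb /= /lebesgue_step /pushforward /product_measure1.
pose b' : 'rV[R]_n := \row_i b 0 (lift ord0 i).
have sec t : xsection (rv_cons (n:=n) @^-1`
     [set x | c + \sum_i b 0 i * x 0 i = 0]) t
   = [set y | (c + b 0 ord0 * t) + \sum_i b' 0 i * y 0 i = 0].
  rewrite /xsection; apply/seteqP; split => y; rewrite /= inE/= => h.
    rewrite -[RHS]h big_ord_recl addrA rv_cons0; congr (_ + _).
    by apply: eq_bigr => i _; rewrite rv_consS mxE.
  rewrite -[RHS]h big_ord_recl addrA rv_cons0; congr (_ + _).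
  by apply: eq_bigr => i _; rewrite rv_consS mxE.
have [b'0|b'0] := eqVneq b' 0; last first.
  under eq_integral do rewrite /= sec IH//.
  exact: integral0.
have b00 : b 0 ord0 != 0.
  apply: contra b0 => /eqP b00; apply/eqP/rowP => i; rewrite mxE.
  case: (unliftP ord0 i) => [k ->|->//].
  by have /rowP/(_ k) := b'0; rewrite !mxE.
rewrite (_ : (fun x => _) = (leb R n \o (xsection (rv_cons (n:=n) @^-1`
     [set x | c + \sum_i b 0 i * x 0 i = 0]))) \_ [set - c / b 0 ord0]).
  by rewrite -integral_mkcond integral_set1.
apply/funext => t; rewrite /= patchE; case: ifPn => // /negP tc.
rewrite sec (_ : mkset _ = set0) ?measure0//.
apply/seteqP; split => // y /=; rewrite b'0.
under eq_bigr do rewrite mxE mul0r.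
rewrite big1 ?addr0// => h; apply: tc; rewrite inE /=.
have -> : - c = b 0 ord0 * t by lra.
by field.
Qed.

(** * Simplices: barycentric coordinates, measurability, null boundary *)

Section simplex.
Variables (R : realType) (n : nat) (v : 'I_n.+2 -> 'rV[R]_n.+1).
Hypothesis vi : affinely_independent v.

(** The inverse of the matrix with rows (1, v_j) gives the barycentric coordinates as affine
    functions with coefficients [c j] and [b j]. The simplex becomes an intersection of open
    half-spaces, and [b j != 0] makes their bounding hyperplanes null. *)
Lemma barycentric : exists (b : 'I_n.+2 -> 'rV[R]_n.+1) (c : 'I_n.+2 -> R),
  (forall j, b j != 0) /\
  simplex v = [set x | forall j, 0 < c j + \sum_i b j 0 i * x 0 i].
Proof.
pose A : 'M[R]_(n.+2, 1 + n.+1) := \matrix_j row_mx (1%:M) (v j).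
have mulA (l : 'rV[R]_n.+2) :
    l *m A = row_mx (\sum_j l 0 j)%:M (\sum_j l 0 j *: v j).
  rewrite mulmx_sum_row (eq_bigr (fun j => row_mx (l 0 j)%:M (l 0 j *: v j))).
    elim/big_ind3: _ => //.
    - by rewrite raddf0 row_mx0.
    - by move=> x1 x2 y1 y2 z1 z2 -> ->; rewrite add_row_mx raddfD.
  by move=> j _; rewrite rowK scale_row_mx scale_scalar_mx mulr1.
have uA : A \in unitmx.
  rewrite -row_free_unit -kermx_eq0; apply/eqP/row_matrixP => i; rewrite row0.
  have /eq_row_mx[h1 h2] : row_mx (\sum_j row i (kermx A) 0 j)%:M
      (\sum_j row i (kermx A) 0 j *: v j) = row_mx 0 0.
    by rewrite -mulA row_mx0 -row_mul mulmx_ker row0.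
  apply/rowP => j; rewrite [LHS]mxE [RHS]mxE; apply: (@vi (fun j => kermx A i j)).
    have /matrixP/(_ 0 0) := h1; rewrite !mxE eqxx mulr1n => h; rewrite -[RHS]h.
    by apply: eq_bigr => k _; rewrite [row i _ 0 k]mxE.
  by rewrite -[RHS]h2; apply: eq_bigr => k _; rewrite [row i _ 0 k]mxE.
pose B := invmx A.
pose bary (x : 'rV[R]_n.+1) := row_mx (1%:M) x *m B.
have baryE (l : 'rV[R]_n.+2) x : \sum_j l 0 j = 1 -> x = \sum_j l 0 j *: v j ->
    bary x = l.
  by move=> l1 ->; rewrite /bary -l1 -mulA mulmxK.
have baryK x : \sum_j bary x 0 j = 1 /\ x = \sum_j bary x 0 j *: v j.
  have : bary x *m A = row_mx (1%:M) x by rewrite mulmxKV.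
  rewrite mulA => /eq_row_mx[h1 h2]; split => //.
  by have /matrixP/(_ 0 0) := h1; rewrite !mxE eqxx.
pose c j := B (lshift n.+1 (ord0 : 'I_1)) j.
pose b j : 'rV[R]_n.+1 := \row_i B (rshift 1 i) j.
have bcE x j : bary x 0 j = c j + \sum_i b j 0 i * x 0 i.
  rewrite /bary mxE big_split_ord/= big_ord1; congr (_ + _).
    by rewrite row_mxEl mxE eqxx mul1r.
  by apply: eq_bigr => i _; rewrite row_mxEr mxE mulrC.
exists b, c; split.
  (* With [b j = 0] the j-th coordinate would be constant, yet it is 1 at vertex [j] and 0 at the
     other vertices. *)
  move=> j; apply/eqP => bj0.
  have hv k i : bary (v k) 0 i = (i == k)%:R.
    rewrite (baryE (delta_mx 0 k)) ?mxE//=.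
    - by rewrite (bigD1 k)//= big1 ?addr0 ?mxE ?eqxx// => i' /negPf h; rewrite mxE h andbF.
    - rewrite (bigD1 k)//= big1 ?addr0 ?mxE ?eqxx ?scale1r// => i' /negPf h.
      by rewrite mxE h andbF scale0r.
  have hc k : bary (v k) 0 j = c j.
    by rewrite bcE bj0 big1 ?addr0// => i _; rewrite mxE mul0r.
  have h1 := hc j; have h2 := hc (lift j ord0).
  move: h1 h2; rewrite !hv eqxx (negPf (neq_lift _ _)) => <- /eqP.
  by rewrite eq_sym oner_eq0.
apply/seteqP; split => x /=.
  move=> [l [l0 l1 xl]] j; rewrite -bcE (baryE (\row_j l j)) ?mxE//.
  - by rewrite -[RHS]l1; apply: eq_bigr => k _; rewrite mxE.
  - by rewrite xl; apply: eq_bigr => k _; rewrite mxE.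
move=> h; exists (fun j => bary x 0 j); have [h1 h2] := baryK x.
by split => // j; rewrite bcE.
Qed.

Lemma simplex_measurable : measurable (simplex v).
Proof.
have [b [c [_ ->]]] := barycentric.
rewrite [X in measurable X](_ : _ = \bigcap_(j in [set: 'I_n.+2])
   [set x : 'rV[R]_n.+1 | 0 < c j + \sum_i b j 0 i * x 0 i]); last first.
  by apply/seteqP; split => [x h j _|x h j]; exact: h.
apply: fin_bigcap_measurable => // j _; apply: open_measurable_rV.
have /continuousP := @continuous_affine R n.+1 (b j) (c j).
by move=> /(_ [set t | 0 < t]); apply; exact: open_gt.
Qed.

(** A point of the closure satisfies all the weak inequalities; if it is outside the simplex one of
    them is an equality, so that it lies on a face hyperplane. *)
Lemma leb_closure_simplex :
  leb R n.+1 (closure (simplex v) `\` simplex v) = 0%E.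
Proof.
have [b [c [b0 hs]]] := barycentric.
pose Z j := [set x : 'rV[R]_n.+1 | c j + \sum_i b j 0 i * x 0 i = 0].
have cZ j : closed (Z j).
  have /continuous_closedP := @continuous_affine R n.+1 (b j) (c j).
  by move=> /(_ [set 0]); apply; exact: closed_eq.
have mZ j : measurable (Z j).
  rewrite -[X in measurable X]setCK; apply: measurableC.
  by apply: open_measurable_rV; apply: closed_openC; exact: cZ.
have sub : closure (simplex v) `\` simplex v `<=` \bigcup_(j in [set: 'I_n.+2]) Z j.
  move=> x [cx nx]; apply: contrapT => hx; apply: nx; rewrite hs => j.
  rewrite lt_neqAle; apply/andP; split.
    by apply/eqP => h; apply: hx; exists j => //; rewrite /Z/= -h.
  have hcl : closed [set x : 'rV[R]_n.+1 | 0 <= c j + \sum_i b j 0 i * x 0 i].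
    have /continuous_closedP := @continuous_affine R n.+1 (b j) (c j).
    by move=> /(_ [set t | 0 <= t]); apply; exact: closed_ge.
  move/closure_id: hcl => hcl.
  suff : [set x : 'rV[R]_n.+1 | 0 <= c j + \sum_i b j 0 i * x 0 i] x by [].
  rewrite hcl; apply: closureS cx => y; rewrite hs => h.
  exact: ltW (h j).
apply: measure_negligible.
  apply: measurableD; last exact: simplex_measurable.
  rewrite -[X in measurable X]setCK; apply: measurableC.
  by apply: open_measurable_rV; apply: closed_openC; exact: closed_closure.
apply: negligibleS sub _.
pose Z' k := if insub k is Some j then Z j else set0.
suff : (leb R n.+1).-negligible (\bigcup_k Z' k).
  apply: negligibleS.
  by move=> x [j _ Zx]; exists (nat_of_ord j) => //; rewrite /Z' valK.
apply: negligible_bigcup => k; rewrite /Z'; case: insub => [j|]; last exact: negligible_set0.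
by apply/negligibleP => //; exact: leb_hyperplane.
Qed.

End simplex.

(** * Cubes, Fubini's theorem and integrals of derivatives *)

Definition box (R : realType) (n : nat) (M : R) : set 'rV[R]_n :=
  [set x | forall i, `|x 0 i| <= M].
Arguments box {R} n M _.

Section box.
Variables (R : realType).
Implicit Types M : R.

Lemma box_measurable n M : measurable (box n M).
Proof.
rewrite [X in measurable X](_ : _ = \bigcap_(i in [set: 'I_n])
    ((fun x : 'rV[R]_n => x 0 i) @^-1` [set t | `|t| <= M])); last first.
  by apply/seteqP; split => [x h i _|x h i]; exact: h.
apply: fin_bigcap_measurable => // i _; rewrite -[X in measurable X]setTI.
apply: measurable_coord => //.
rewrite [X in measurable X](_ : _ = `[- M, M]%classic); first exact: measurable_itv.
by apply/seteqP; split => t /=; rewrite in_itv/= ler_norml.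
Qed.

Lemma lebesgue_itv_fin_num (a b : R) :
  (lebesgue_measure (`[a, b]%classic : set R) \is a fin_num)%E.
Proof. by rewrite lebesgue_measure_itv; case: ifP. Qed.

Lemma leb_box n M : (leb R n (box n M) < +oo)%E.
Proof.
elim: n => [|n IH].
  by rewrite /leb /= diracE; case: (_ \in _); rewrite ltry.
rewrite /leb -/leb /= /lebesgue_step /pushforward.
rewrite (_ : rv_cons (n:=n) @^-1` box n.+1 M = `[- M, M]%classic `*` box n M).
  rewrite product_measure1E//; last exact: box_measurable.
  rewrite lte_mul_pinfty// ?measure_ge0//.
    exact: lebesgue_itv_fin_num.
apply/seteqP; split => [[t y] h|[t y] [/= h1 h2] i].
  split; first by have := h ord0; rewrite rv_cons0/= in_itv/= ler_norml.
  by move=> i; have := h (lift ord0 i); rewrite rv_consS.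
case: (unliftP ord0 i) => [j ->|->]; first by rewrite rv_consS; exact: h2.
by rewrite rv_cons0; move: h1; rewrite in_itv/= ler_norml.
Qed.

Lemma box_compact n M : compact (box n M).
Proof.
have := @rV_compact R n (fun=> `[- M, M]%classic) (fun=> @segment_compact R _ _).
rewrite (_ : mkset _ = box n M)//.
by apply/seteqP; split => x h i; have := h i; rewrite /= in_itv/= ler_norml.
Qed.

Lemma bounded_support_integrable d (T : measurableType d)
    (mu : {measure set T -> \bar R}) (A : set T) (g : T -> R) (K : R) :
  measurable A -> (mu A < +oo)%E -> measurable_fun setT g ->
  (forall x, `|g x| <= K) -> (forall x, ~ A x -> g x = 0) ->
  mu.-integrable setT (EFin \o g).
Proof.
move=> mA Aoo mg gK g0.
have -> : EFin \o g = (EFin \o g) \_ A.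
  apply/funext => x; rewrite patchE; case: ifPn => // /negP xA /=.
  by rewrite g0// => Ax; apply: xA; rewrite inE.
apply/(integrable_mkcond (EFin \o g) mA).1; apply: measurable_bounded_integrable => //.
  exact: measurable_funTS.
exists K; split; first exact: num_real.
by move=> M KM x _; exact: le_trans (gK x) (ltW KM).
Qed.

Lemma box_support_bounded n M (g : 'rV[R]_n -> R) : continuous g ->
  (forall x, ~ box n M x -> g x = 0) -> exists K, forall x, `|g x| <= K.
Proof.
move=> cg g0.
have : compact (g @` box n M).
  by apply: continuous_compact; [exact: continuous_subspaceT|exact: box_compact].
move=> /compact_bounded[K [Kr hK]].
exists (`|K| + 1) => x; have [bx|/g0 ->] := pselect (box n M x).
  by apply: hK; [rewrite (le_lt_trans (ler_norm K))// ltrDl|exists x].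
by rewrite normr0 addr_ge0.
Qed.

Lemma integrable_box n M (g : 'rV[R]_n -> R) : continuous g ->
  (forall x, ~ box n M x -> g x = 0) -> (leb R n).-integrable setT (EFin \o g).
Proof.
move=> cg g0; have [K hK] := box_support_bounded cg g0.
apply: (@bounded_support_integrable _ _ (leb R n) (box n M) g K) => //;
  [exact: box_measurable|exact: leb_box|].
exact: continuous_measurable_rV.
Qed.

Lemma continuous_ballP (X Y : pseudoMetricType R) (f : X -> Y) :
  (forall x e, 0 < e -> exists2 d, 0 < d & forall y, ball x d y ->
    ball (f x) e (f y)) -> continuous f.
Proof.
move=> h x; apply/cvg_ballP => e e0; have [d d0 hd] := h x e e0.
by apply/nbhs_ballP; exists d.
Qed.

Lemma continuous_rv_cons1 n (y : 'rV[R]_n) : continuous (fun t => rv_cons (t, y)).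
Proof.
apply: continuous_ballP => t e e0; exists e => // s ts.
split => // i j; rewrite ord1.
by case: (unliftP ord0 j) => [k ->|->]; rewrite ?rv_consS ?rv_cons0//=; exact: ballxx.
Qed.

Lemma continuous_rv_cons2 n (t : R) : continuous (fun y : 'rV[R]_n => rv_cons (t, y)).
Proof.
apply: continuous_ballP => y e e0; exists e => // s [_ ys].
split => // i j; rewrite ord1.
by case: (unliftP ord0 j) => [k ->|->]; rewrite ?rv_consS ?rv_cons0//=; exact: ballxx.
Qed.

Lemma addr_delta_mx n (h : R) (j k : 'I_n) (z : 'rV[R]_n) :
  (h *: delta_mx 0 j + z) 0 k = h * (k == j)%:R + z 0 k.
Proof. by rewrite !mxE eqxx. Qed.

Lemma rv_cons_shift0 n (y : 'rV[R]_n) (t h : R) :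
  rv_cons (h + t, y) = h *: delta_mx 0 ord0 + rv_cons (t, y).
Proof.
apply/rowP => i; rewrite addr_delta_mx.
case: (unliftP ord0 i) => [j ->|->]; first by rewrite !rv_consS mulr0 add0r.
by rewrite !rv_cons0 eqxx mulr1.
Qed.

Lemma rv_cons_shiftS n (y : 'rV[R]_n) (t h : R) (j : 'I_n) :
  rv_cons (t, h *: delta_mx 0 j + y) =
  h *: delta_mx 0 (lift ord0 j) + rv_cons (t, y).
Proof.
apply/rowP => i; rewrite addr_delta_mx.
case: (unliftP ord0 i) => [k ->|->].
  by rewrite !rv_consS addr_delta_mx (inj_eq lift_inj).
by rewrite !rv_cons0 (negbTE (neq_lift _ _)) mulr0 add0r.
Qed.

Lemma box_rv_cons n M (t : R) (y : 'rV[R]_n) :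
  box n.+1 M (rv_cons (t, y)) -> `|t| <= M /\ box n M y.
Proof.
move=> h; split; first by have := h ord0; rewrite rv_cons0.
by move=> i; have := h (lift ord0 i); rewrite rv_consS.
Qed.

Lemma integral_derive_line (M : R) (F : R -> R) :
  (forall t, derivable F t 1) -> continuous (fun t => 'D_1 F t) ->
  (forall t, M < `|t| -> F t = 0) -> (forall t, M < `|t| -> 'D_1 F t = 0) ->
  (\int[lebesgue_measure]_t ('D_1 F t)%:E = 0)%E.
Proof.
(* [a] is positive and exceeds [M] even when [M] is negative, so [F] vanishes at both ends of
   [[- a, a]]. *)
move=> dF cF F0 dF0; pose a := `|M| + 1.
have Ma : M < a by rewrite /a (le_lt_trans (ler_norm M))// ltrDl.
have a0 : 0 < a by rewrite /a ltr_wpDl.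
have Fc : continuous F.
  by move=> t; apply: differentiable_continuous; exact/derivable1_diffP.
rewrite (_ : (fun _ => _) = (fun t => ('D_1 F t)%:E) \_ `[- a, a]); last first.
  apply/funext => t; rewrite patchE; case: ifPn => // /negP h.
  rewrite dF0// ltNge; apply/negP => tM; apply: h; rewrite inE/= in_itv/= -ler_norml.
  exact: le_trans tM (ltW Ma).
rewrite -integral_mkcond (@continuous_FTC2 _ _ F); first last.
- by move=> t _; rewrite derive1E.
- split; first by move=> t _; exact: dF.
  + by apply: cvg_at_right_filter; exact: Fc.
  + by apply: cvg_at_left_filter; exact: Fc.
- exact: continuous_subspaceT.
- by rewrite -subr_gt0 opprK addr_gt0.
by rewrite !F0 ?subee// ?normrN gtr0_norm.
Qed.

(** Both orders are needed: the line variable innermost for a derivative along the first axis,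
    outermost for the other axes, where the induction on the dimension acts on the slices. *)
Lemma integral_leb n (g : 'rV[R]_n.+1 -> R) M : continuous g ->
  (forall x, ~ box n.+1 M x -> g x = 0) ->
  (\int[leb R n.+1]_x (g x)%:E =
    \int[lebesgue_measure]_t \int[leb R n]_y (g (rv_cons (t, y)))%:E)%E /\
  (\int[leb R n.+1]_x (g x)%:E =
    \int[leb R n]_y \int[lebesgue_measure]_t (g (rv_cons (t, y)))%:E)%E.
Proof.
move=> cg g0; have [K hK] := box_support_bounded cg g0.
have mg : measurable_fun setT g by exact: continuous_measurable_rV.
have gi : (lebesgue_measure \x leb R n)%E.-integrable setT
    ((EFin \o g) \o rv_cons (n:=n)).
  apply: (@bounded_support_integrable _ _ (lebesgue_measure \x leb R n)%E
    (`[- M, M]%classic `*` box n M) (g \o rv_cons (n:=n)) K) => //.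
  - by apply: measurableX; [exact: measurable_itv|exact: box_measurable].
  - rewrite /= product_measure1E//; last exact: box_measurable.
    rewrite lte_mul_pinfty//; last exact: leb_box.
    exact: lebesgue_itv_fin_num.
  - by apply: measurableT_comp => //; exact: measurable_rv_cons.
  - by move=> x; exact: hK.
  - move=> [t y] h; apply: g0 => /box_rv_cons[h1 h2]; apply: h; split => //=.
    by rewrite in_itv/= -ler_norml.
have -> : (\int[leb R n.+1]_x (g x)%:E =
    \int[lebesgue_measure \x leb R n]_z ((EFin \o g) \o rv_cons (n:=n)) z)%E.
  have mge : measurable_fun setT (EFin \o g) by exact/measurable_EFinP.
  rewrite -(@integral_pushforward _ _ (measurableTypeR R * 'rV[R]_n)%type 'rV[R]_n.+1
    R (@rv_cons R n) (@measurable_rv_cons R n) _ _ _ mge gi measurableT).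
  by apply: eq_measure_integral => A mA; first exact: measurable_rv_cons.
by split; [rewrite -integral12_prod_meas1|rewrite -integral21_prod_meas1].
Qed.

Lemma integral_derive_rv_cons0 n (f : 'rV[R]_n.+1 -> R) M (y : 'rV[R]_n) :
  (forall x, derivable f x (delta_mx 0 ord0)) -> continuous (partial ord0 f) ->
  (forall x, ~ box n.+1 M x -> f x = 0) ->
  (forall x, ~ box n.+1 M x -> partial ord0 f x = 0) ->
  (\int[lebesgue_measure]_t (partial ord0 f (rv_cons (t, y)))%:E = 0)%E.
Proof.
move=> df cf f0 pf0; pose F t := f (rv_cons (t, y)).
have quo t (h : R) : h^-1 *: ((F \o shift t) (h *: 1) - F t) =
    h^-1 *: ((f \o shift (rv_cons (t, y))) (h *: delta_mx 0 ord0) - f (rv_cons (t, y))).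
  by rewrite /F /= /shift /= -rv_cons_shift0 [h *: 1]mulr1.
have dF t : derivable F t 1.
  by rewrite /derivable; under eq_fun do rewrite quo; exact: df.
have DF t : 'D_1 F t = partial ord0 f (rv_cons (t, y)).
  by rewrite /partial /derive; under eq_fun do rewrite quo.
have cF : continuous (fun t => 'D_1 F t).
  rewrite (_ : (fun t => _) = partial ord0 f \o (fun t => rv_cons (t, y))).
    by move=> t; apply: continuous_comp; [exact: continuous_rv_cons1|exact: cf].
  by apply/funext => t; exact: DF.
have sup t : M < `|t| -> ~ box n.+1 M (rv_cons (t, y)).
  by move=> h /box_rv_cons[]; rewrite leNgt h.
rewrite -[RHS](@integral_derive_line M F dF cF).
- by apply: eq_integral => t _; rewrite DF.
- by move=> t /sup; exact: f0.
- by move=> t /sup; rewrite DF; exact: pf0.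
Qed.

(** Fubini reduces a derivative along the first axis to the fundamental theorem of calculus on
    lines, and any other one to the same statement for the slices [f (t, .)]. Applied to a product
    of test functions, this is integration by parts. *)
Lemma integral_partial n (i : 'I_n.+1) (f : 'rV[R]_n.+1 -> R) (M : R) :
  (forall x, derivable f x (delta_mx 0 i)) -> continuous (partial i f) ->
  (forall x, ~ box n.+1 M x -> f x = 0) ->
  (forall x, ~ box n.+1 M x -> partial i f x = 0) ->
  (\int[leb R n.+1]_x (partial i f x)%:E = 0)%E.
Proof.
move=> df cf f0 pf0; have [e1 e2] := integral_leb cf pf0.
elim: n i f df cf f0 pf0 e1 e2 => [|n IH] i f df cf f0 pf0 e1 e2.
  case: (unliftP ord0 i) => [[]//|ii]; subst i.
  rewrite e2 (eq_integral (fun=> 0%E)) ?integral0// => y _.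
  exact: (integral_derive_rv_cons0 (M := M)).
case: (unliftP ord0 i) => [j ij|ii]; subst i; last first.
  rewrite e2 (eq_integral (fun=> 0%E)) ?integral0// => y _.
  exact: (integral_derive_rv_cons0 (M := M)).
rewrite e1 (eq_integral (fun=> 0%E)) ?integral0// => t _.
pose ft y := f (rv_cons (t, y)).
have quo y (h : R) : h^-1 *: ((ft \o shift y) (h *: delta_mx 0 j) - ft y) =
    h^-1 *: ((f \o shift (rv_cons (t, y))) (h *: delta_mx 0 (lift ord0 j)) - f (rv_cons (t, y))).
  by rewrite /ft /= /shift /= rv_cons_shiftS.
have dft y : derivable ft y (delta_mx 0 j).
  by rewrite /derivable; under eq_fun do rewrite quo; exact: df.
have pft y : partial j ft y = partial (lift ord0 j) f (rv_cons (t, y)).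
  by rewrite /partial /derive; under eq_fun do rewrite quo.
have cft : continuous (partial j ft).
  rewrite (_ : partial j ft = partial (lift ord0 j) f \o (fun y => rv_cons (t, y))).
    by move=> y; apply: continuous_comp; [exact: continuous_rv_cons2|exact: cf].
  by apply/funext => y; exact: pft.
have sup y : ~ box n.+1 M y -> ~ box n.+2 M (rv_cons (t, y)).
  by move=> h /box_rv_cons[].
have f0t y : ~ box n.+1 M y -> ft y = 0 by move=> /sup; exact: f0.
have pf0t y : ~ box n.+1 M y -> partial j ft y = 0.
  by move=> /sup; rewrite pft; exact: pf0.
have [e3 e4] := integral_leb cft pf0t.
rewrite -[RHS](IH j ft dft cft f0t pf0t e3 e4).
by apply: eq_integral => y _; rewrite pft.
Qed.

End box.

(** * Annihilators and products of semi-inner product spaces *)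

Section semi_inner_constructions.
Variables (R : realType) (H H' : lmodType R).

Lemma semi_inner_sub (D D' : set H) (B : H -> H -> R) :
  semi_inner D B -> is_subspace D' -> D' `<=` D -> semi_inner D' B.
Proof.
move=> [sD BC BL Bp] sD' DD'; split => //.
- by move=> u v Du Dv; apply: BC; exact: DD'.
- by move=> a u v w Du Dv Dw; apply: BL; exact: DD'.
- by move=> u Du; apply: Bp; exact: DD'.
Qed.

(** A weak derivative identity says that a pair (function, derivative) is orthogonal in L^2 to pairs
    built from test functions. H^1, H(div) and the broken test space all have this form, so
    linearity and completeness are proved once for all of them. *)
Definition annihilator (D : set H) (B : H -> H -> R) (C : set H) : set H :=
  [set u | D u /\ forall c, C c -> B u c = 0].

Lemma annihilator_subspace (D C : set H) (B : H -> H -> R) :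
  semi_inner D B -> C `<=` D -> is_subspace (annihilator D B C).
Proof.
move=> DB CD; have [sD BC BL Bp] := DB; split.
  split; first by case: sD.
  move=> c Cc; have := sinZl DB 0 sD.1 (CD c Cc).
  by rewrite scale0r mul0r.
move=> a u v [Du hu] [Dv hv]; split; first exact: sD.2.
by move=> c Cc; rewrite BL ?hu ?hv ?mulr0 ?addr0//; exact: CD.
Qed.

Lemma annihilator_complete (D C : set H) (B : H -> H -> R) :
  semi_inner D B -> C `<=` D -> complete_for D B ->
  complete_for (annihilator D B C) B.
Proof.
move=> DB CD cD s sA cs.
have Ds k : D (s k) by case: (sA k).
have [y Dy sy] := cD s Ds cs; exists y => //; split => // c Cc.
apply/eqP; rewrite -normr_le0; apply/ler_addgt0Pr => e e0; rewrite add0r.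
have [N hN] := cvg_for_sin DB Ds Dy (CD c Cc) sy e0.
have := hN N (leqnn N); rewrite (sA N).2// sub0r normrN.
exact: ltW.
Qed.

Definition sum_form (B : H -> H -> R) (B' : H' -> H' -> R) (u v : H * H') : R :=
  B u.1 v.1 + B' u.2 v.2.

Lemma semi_inner_prod (D : set H) (D' : set H') (B : H -> H -> R)
    (B' : H' -> H' -> R) :
  semi_inner D B -> semi_inner D' B' ->
  semi_inner (D `*` D') (sum_form B B').
Proof.
move=> [sD BC BL Bp] [sD' BC' BL' Bp']; split.
- split; first by split; [exact: sD.1|exact: sD'.1].
  by move=> a u v [u1 u2] [v1 v2]; split; [exact: sD.2|exact: sD'.2].
- by move=> u v [u1 u2] [v1 v2]; rewrite /sum_form BC// BC'.
- move=> a u v w [u1 u2] [v1 v2] [w1 w2].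
  by rewrite /sum_form BL// BL'//; ring.
- by move=> u [u1 u2]; apply: addr_ge0; [exact: Bp|exact: Bp'].
Qed.

Lemma complete_prod (D : set H) (D' : set H') (B : H -> H -> R)
    (B' : H' -> H' -> R) : semi_inner D B -> semi_inner D' B' ->
  complete_for D B -> complete_for D' B' ->
  complete_for (D `*` D') (sum_form B B').
Proof.
move=> DB DB' cD cD' s Ds cs.
have ge1 k l : 0 <= B (s k - s l).1 (s k - s l).1.
  by apply: (sin_ge0 DB); apply: subspaceB; [case: DB|case: (Ds k)|case: (Ds l)].
have ge2 k l : 0 <= B' (s k - s l).2 (s k - s l).2.
  by apply: (sin_ge0 DB'); apply: subspaceB; [case: DB'|case: (Ds k)|case: (Ds l)].
have [|y1 D1 s1] := cD (fun k => (s k).1) (fun k => (Ds k).1).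
  move=> e e0; have [N hN] := cs e e0; exists N => k l Nk Nl.
  by apply: le_lt_trans (hN k l Nk Nl); rewrite lerDl; exact: ge2.
have [|y2 D2 s2] := cD' (fun k => (s k).2) (fun k => (Ds k).2).
  move=> e e0; have [N hN] := cs e e0; exists N => k l Nk Nl.
  by apply: le_lt_trans (hN k l Nk Nl); rewrite lerDr; exact: ge1.
exists (y1, y2) => // e e0; have e20 : 0 < e / 2 by rewrite divr_gt0.
have [N1 h1] := s1 _ e20; have [N2 h2] := s2 _ e20.
exists (maxn N1 N2) => k; rewrite geq_max => /andP[k1 k2].
by rewrite [e]splitr; apply: ltrD; [exact: h1|exact: h2].
Qed.

End semi_inner_constructions.

(** * Vector-valued square-integrable functions *)

Section L2v.
Variables (R : realType) (n : nat) (w : set 'rV[R]_n.+1).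
Local Notation E := 'rV[R]_n.+1.
Local Notation mu := (leb R n.+1).
Hypothesis mw : measurable w.
Implicit Types p q : E -> E.

Lemma L2v_subspace : is_subspace (L2v w).
Proof.
split => [i|a p q Lp Lq i].
  rewrite (_ : (fun x => _) = (0 : E -> R)); first exact: (L2_subspace mw).1.
  by apply/funext => x; rewrite mxE.
rewrite (_ : (fun x => _) = a *: (fun x => p x 0 i) + (fun x => q x 0 i) :> (E -> R)).
  by apply: (L2_subspace mw).2; [exact: Lp|exact: Lq].
by apply/funext => x; rewrite !mxE.
Qed.

Lemma ipvE p q : L2v w p -> L2v w q ->
  ipv w p q = \sum_i ip w (fun x => p x 0 i) (fun x => q x 0 i).
Proof.
move=> Lp Lq; rewrite /ipv /dotv.
have h (s : seq 'I_n.+1) :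
    mu.-integrable w (EFin \o (fun x => \sum_(i <- s) p x 0 i * q x 0 i)) /\
    \int[mu]_(x in w) (\sum_(i <- s) p x 0 i * q x 0 i) =
    \sum_(i <- s) ip w (fun x => p x 0 i) (fun x => q x 0 i).
  elim: s => [|i s [ih1 ih2]].
    have -> : (fun x => \sum_(i <- [::]) p x 0 i * q x 0 i) = (cst 0 : E -> R).
      by apply/funext => x; rewrite big_nil.
    split; first exact: integrable0.
    by rewrite big_nil /Rintegral integral0.
  have -> : (fun x => \sum_(i <- i :: s) p x 0 i * q x 0 i) =
      (fun x => p x 0 i * q x 0 i + \sum_(i <- s) p x 0 i * q x 0 i).
    by apply/funext => x; rewrite big_cons.
  have hi := L2_integrableM mw (Lp i) (Lq i).
  split; first exact: (integrableD mw hi ih1).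
  by rewrite big_cons -ih2 RintegralD.
exact: (h _).2.
Qed.

Lemma ipv_semi_inner : semi_inner (L2v w) (@ipv R n w).
Proof.
have sL := L2v_subspace; split => //.
- move=> p q Lp Lq; rewrite !ipvE//; apply: eq_bigr => i _.
  by have [_ h _ _] := ip_semi_inner mw; apply: h; [exact: Lp|exact: Lq].
- move=> a p q r Lp Lq Lr; rewrite !ipvE//; last exact: sL.2.
  rewrite mulr_sumr -big_split/=; apply: eq_bigr => i _.
  have [_ _ h _] := ip_semi_inner mw.
  rewrite -(h a _ _ _ (Lp i) (Lq i) (Lr i)); congr (ip w _ _).
  by apply/funext => x; rewrite !mxE.
- move=> p Lp; rewrite ipvE//; apply: sumr_ge0 => i _.
  by apply: (sin_ge0 (ip_semi_inner mw)); exact: Lp.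
Qed.

Lemma L2v_complete : complete_for (L2v w) (@ipv R n w).
Proof.
move=> s Ls cs; have sL := L2v_subspace.
have sub p q i : (fun x => (p - q) x 0 i) =
    (fun x => p x 0 i) - (fun x => q x 0 i) :> (E -> R).
  by apply/funext => x; rewrite !mxE.
have ex i : exists y, L2 w y /\ cvg_for (@ip R n w) (fun k x => s k x 0 i) y.
  have [||y Ly sy] := @L2_complete R n w mw (fun k x => s k x 0 i); last by exists y.
  - by move=> k; exact: Ls.
  - move=> e e0; have [N hN] := cs e e0; exists N => k l Nk Nl.
    apply: le_lt_trans (hN k l Nk Nl).
    have Ld : L2v w (s k - s l) by exact: (subspaceB sL (Ls k) (Ls l)).
    rewrite ipvE// (bigD1 i)//= -sub lerDl; apply: sumr_ge0 => j _.
    by apply: (sin_ge0 (ip_semi_inner mw)); exact: Ld.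
have [y hy] := choice ex.
have Ly : L2v w (fun x => \row_i y i x).
  move=> i; rewrite (_ : (fun x => _) = y i); first by case: (hy i).
  by apply/funext => x; rewrite mxE.
pose Y : E -> E := fun x => \row_i y i x.
exists Y => // e e0.
have Ld k : L2v w (s k - Y) by exact: (subspaceB sL (Ls k) Ly).
have e1 : 0 < e / 2 / n.+1%:R by rewrite !divr_gt0.
have [N hN] := choice (fun i => (hy i).2 _ e1).
exists (\max_i N i)%N => k Nk.
rewrite ipvE//.
apply: (@le_lt_trans _ _ (\sum_(i < n.+1) (e / 2 / n.+1%:R))).
  apply: ler_sum => i _; apply/ltW.
  have := hN i k (leq_trans (leq_bigmax i) Nk).
  rewrite sub; have -> : (fun x => Y x 0 i) = y i by apply/funext => x; rewrite mxE.
  exact.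
rewrite sumr_const card_ord -[ltLHS]mulr_natr divfK//.
by rewrite ltr_pdivrMr// ltr_pMr// ltr1n.
Qed.

End L2v.

(** * Sobolev spaces *)

Section test_fun.
Variables (R : realType) (n : nat).
Local Notation E := 'rV[R]_n.+1.
Local Notation mu := (leb R n.+1).
Implicit Types (w : set E) (phi psi : E -> R).

Lemma Ck_continuous k phi : Ck k phi -> continuous phi.
Proof. by case: k => [|k] []. Qed.

Lemma test_continuous w phi : test_fun w phi -> continuous phi.
Proof. by move=> [/(_ 0%N)/Ck_continuous]. Qed.

Lemma test_derivable w phi x i : test_fun w phi -> derivable phi x (delta_mx 0 i).
Proof. by move=> [/(_ 1%N)[_ /(_ i)[+ _]] _ _]; exact. Qed.

Lemma test_partial_continuous w phi i : test_fun w phi -> continuous (partial i phi).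
Proof. by move=> [/(_ 1%N)[_ /(_ i)[_ []]]]. Qed.

Lemma test_partial w phi i : test_fun w phi -> test_fun w (partial i phi).
Proof.
move=> [Cphi cphi sphi].
have sub0 : [set x | partial i phi x != 0] `<=` tsupport phi.
  move=> x /eqP hx; apply: contrapT => nx; apply: hx.
  rewrite /partial (@near_eq_derive _ _ _ phi (cst 0)) ?derive_cst//.
  have oT : open (~` tsupport phi) by apply: closed_openC; exact: closed_closure.
  apply: filterS (open_nbhs_nbhs (conj oT nx)) => y hy.
  by apply/eqP/negPn/negP => h; apply: hy; exact: subset_closure.
have sub : tsupport (partial i phi) `<=` tsupport phi.
  have /closure_id cl := @closed_closure _ [set x | phi x != 0].
  by move=> x hx; rewrite /tsupport cl; exact: closureS hx.
split.
- by move=> k; have [_ /(_ i)[_]] := Cphi k.+1.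
- by apply: (subclosed_compact _ cphi) => //; exact: closed_closure.
- by move=> x /sub; exact: sphi.
Qed.

Lemma test0 w phi x : test_fun w phi -> ~ w x -> phi x = 0.
Proof.
move=> [_ _ sphi] wx; apply/eqP/negPn/negP => h; apply: wx; apply: sphi.
exact: subset_closure.
Qed.

Lemma coord_le_norm (x : E) i : `|x 0 i| <= `|x|.
Proof.
rewrite [leRHS](mx_normrE x); apply: (@le_bigmax _ _ _ 0 (fun ij : 'I_1 * 'I_n.+1 => `|x ij.1 ij.2|) (0, i)).
Qed.

Lemma test_box w phi : test_fun w phi ->
  exists M, forall x, ~ box n.+1 M x -> phi x = 0.
Proof.
move=> [_ /compact_bounded[M [Mr hM]] _]; exists (M + 1) => x nx.
apply/eqP/negPn/negP => h; apply: nx => i.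
apply: le_trans (coord_le_norm x i) _; apply: hM; first by rewrite ltrDl.
exact: subset_closure.
Qed.

Lemma continuous_box_L2 w M phi : measurable w -> continuous phi ->
  (forall x, ~ box n.+1 M x -> phi x = 0) -> L2 w phi.
Proof.
move=> mw cphi phi0.
apply: L2_of_integrable.
  by apply: measurable_funTS; exact: continuous_measurable_rV.
apply: (@integrableS _ _ _ _ setT) => //.
apply: (@integrable_box _ _ M (fun x => phi x * phi x)).
  exact: continuous_mulR.
by move=> x /phi0 ->; rewrite mul0r.
Qed.

Lemma test_L2 w w' phi : measurable w' -> test_fun w phi -> L2 w' phi.
Proof.
move=> mw' tphi; have [M hM] := test_box tphi.
exact: (continuous_box_L2 mw' (test_continuous tphi) hM).
Qed.

Lemma test_grad_L2v w w' phi : measurable w' -> test_fun w phi ->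
  L2v w' (grad phi).
Proof.
move=> mw' tphi i; rewrite (_ : (fun x => _) = partial i phi).
  exact: test_L2 (test_partial i tphi).
by apply/funext => x; rewrite mxE.
Qed.

Lemma ip_support w w' (f g : E -> R) : w' `<=` w -> (forall x, ~ w' x -> g x = 0) ->
  ip w f g = ip w' f g.
Proof.
move=> ww' g0; rewrite /ip Rintegral_mkcond [RHS]Rintegral_mkcond; congr Rintegral.
apply/funext => x; rewrite !patchE; case: ifPn => [/set_mem xw|/negP xw]; case: ifPn => // /negP xw'.
  by rewrite g0 ?mulr0// => h; apply: xw'; rewrite inE.
by rewrite g0 ?mulr0// => h; apply: xw; rewrite inE; exact: ww'.
Qed.

(** A derivative of [phi * psi] has integral zero over the whole space, and since [psi] is supported
    in [w''] the integrals over [w'] are the same. The support of [phi] may leave [w']: this makes a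
    global test function an H^1 function on each cell. *)
Lemma test_ibp w w' w'' phi psi i : w'' `<=` w' ->
  test_fun w phi -> test_fun w'' psi ->
  ip w' phi (partial i psi) = - ip w' (partial i phi) psi.
Proof.
move=> sww tphi tpsi.
have s1 := fun x => @test0 _ _ x tpsi; have s2 := fun x => @test0 _ _ x (test_partial i tpsi).
rewrite !(ip_support _ sww)// -!(ip_support _ (@subsetT _ w''))//.
apply/eqP; rewrite -subr_eq0 opprK; apply/eqP.
have [M hM] := test_box tpsi.
have [M' hM'] := test_box (test_partial i tpsi).
pose K := Num.max M M'.
have hK1 x : ~ box n.+1 K x -> psi x = 0.
  by move=> h; apply: hM => h'; apply: h => j; rewrite (le_trans (h' j))// le_max lexx.
have hK2 x : ~ box n.+1 K x -> partial i psi x = 0.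
  by move=> h; apply: hM' => h'; apply: h => j; rewrite (le_trans (h' j))// le_max lexx orbT.
have dphi x := @test_derivable _ phi x i tphi.
have dpsi x := @test_derivable _ psi x i tpsi.
have c1 := test_continuous tphi; have c2 := test_continuous tpsi.
have c3 := test_partial_continuous (i := i) tphi; have c4 := test_partial_continuous (i := i) tpsi.
have pM x : partial i (phi * psi) x = phi x * partial i psi x + partial i phi x * psi x.
  by rewrite /partial deriveM//; congr (_ + _); rewrite mulrC.
have hI : (\int[mu]_x (partial i (phi * psi) x)%:E = 0)%E.
  apply: (@integral_partial R n i (phi * psi) K).
  - by move=> x; exact: derivableM.
  - rewrite (_ : partial i (phi * psi) = (fun x => phi x * partial i psi x + partial i phi x * psi x)).
      by apply: continuous_addR; exact: continuous_mulR.
    by apply/funext => x; exact: pM.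
  - by move=> x /hK1 h; rewrite /GRing.mul/= h mulr0.
  - by move=> x h; rewrite pM hK1// hK2// !mulr0 addr0.
rewrite /ip -RintegralD//; first last.
- apply: (@integrable_box _ _ K (fun x => partial i phi x * psi x)).
    exact: continuous_mulR.
  by move=> x /hK1 ->; rewrite mulr0.
- apply: (@integrable_box _ _ K (fun x => phi x * partial i psi x)).
    exact: continuous_mulR.
  by move=> x /hK2 ->; rewrite mulr0.
rewrite /Rintegral (_ : (fun x => (phi x * partial i psi x + partial i phi x * psi x)%:E)
  = (fun x => (partial i (phi * psi) x)%:E)); last by apply/funext => x; rewrite pM.
by rewrite hI.
Qed.

Lemma Ck_lin k a phi psi : Ck k phi -> Ck k psi ->
  Ck k (a *: phi + psi) /\ forall i, (0 < k)%N ->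
  partial i (a *: phi + psi) = a *: partial i phi + partial i psi.
Proof.
elim: k phi psi => [|k ih] phi psi.
  move=> [c1 _] [c2 _]; split => //; split => //.
  by apply: continuous_addR => //; apply: continuous_mulR => //; exact: continuous_cstR.
move=> [c1 h1] [c2 h2].
have pE i : partial i (a *: phi + psi) = a *: partial i phi + partial i psi.
  apply/funext => x; rewrite /partial deriveD ?deriveZ//.
  + exact: (h1 i).1.
  + by apply: derivableZ; exact: (h1 i).1.
  + exact: (h2 i).1.
split; last by move=> i _; exact: pE.
split; first by apply: continuous_addR => //; apply: continuous_mulR => //; exact: continuous_cstR.
move=> i; split.
  move=> x; apply: derivableD; last exact: (h2 i).1.
  by apply: derivableZ; exact: (h1 i).1.
by rewrite pE; exact: (ih _ _ (h1 i).2 (h2 i).2).1.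
Qed.

Lemma test_subspace w : is_subspace (test_fun w).
Proof.
split.
  have C0 k : Ck k (0 : E -> R).
    elim: k => [|k ih]; first by split => //; exact: continuous_cstR.
    split; first exact: continuous_cstR.
    move=> i; rewrite (_ : partial i 0 = 0); last first.
      by apply/funext => x; rewrite /partial derive_cst.
    by split => // x; exact: derivable_cst.
  have s0 : tsupport (0 : E -> R) = set0.
    rewrite /tsupport (_ : mkset _ = set0) ?closure0//.
    by apply/seteqP; split => // x /=; rewrite eqxx.
  by split => //; rewrite s0//; exact: compact0.
move=> a phi psi tphi tpsi.
have [C1 k1 s1] := tphi; have [C2 k2 s2] := tpsi.
have sub : tsupport (a *: phi + psi) `<=` tsupport phi `|` tsupport psi.
  rewrite /tsupport -closureU; apply: closureS => x /= h.
  have [p0|p0] := eqVneq (phi x) 0; last by left.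
  right; apply: contraNneq h => q0.
  by rewrite [X in X == _](_ : _ = a * phi x + psi x)// p0 q0 mulr0 addr0.
split.
- by move=> k; exact: (Ck_lin a (C1 k) (C2 k)).1.
- apply: (subclosed_compact _ (compactU k1 k2)) => //; exact: closed_closure.
- by move=> x /sub[/s1|/s2].
Qed.

Lemma grad_lin w a phi psi : test_fun w phi -> test_fun w psi ->
  grad (a *: phi + psi) = a *: grad phi + grad psi.
Proof.
move=> [C1 _ _] [C2 _ _]; apply/funext => x; apply/rowP => i.
rewrite !mxE (_ : partial i _ = a *: partial i phi + partial i psi) ?mxE//.
exact: (Ck_lin a (C1 1%N) (C2 1%N)).2.
Qed.

Lemma test_sub w w' phi : w `<=` w' -> test_fun w phi -> test_fun w' phi.
Proof. by move=> ww' [C k s]; split => // x /s; exact: ww'. Qed.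

End test_fun.

Lemma mulr_div_addr1_le (R : realType) (a e : R) : 0 <= a -> 0 < e ->
  a * (e / (a + 1)) <= e.
Proof. by move=> a0 e0; rewrite mulrA ler_pdivrMr ?ltr_wpDl//; nra. Qed.

Section sobolev_spaces.
Variables (R : realType) (n : nat).
Local Notation E := 'rV[R]_n.+1.
Local Notation sob := (sob R n).
Local Notation dvf := (dvf R n).
Implicit Types (w : set E) (u v z : sob) (q tau : dvf) (phi : E -> R).

Lemma L2_sub w w' (f : E -> R) : measurable w -> measurable w' -> w' `<=` w ->
  L2 w f -> L2 w' f.
Proof.
move=> mw mw' sw [mf fi]; split; first exact: measurable_funS mf.
apply: le_lt_trans fi; apply: ge0_subset_integral => //.
- by apply/measurable_EFinP; exact: measurable_funX.
- by move=> x _; rewrite lee_fin sqr_ge0.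
Qed.

Lemma L2v_sub w w' (p : E -> E) : measurable w -> measurable w' -> w' `<=` w ->
  L2v w p -> L2v w' p.
Proof. by move=> mw mw' sw Lp i; exact: L2_sub (Lp i). Qed.

Lemma dotv_delta (x : E) (a : R) i : dotv x (a *: delta_mx 0 i) = x 0 i * a.
Proof.
rewrite /dotv (bigD1 i)//= big1 ?addr0; first by rewrite !mxE !eqxx mulr1.
by move=> j /negPf ji; rewrite !mxE ji andbF mulr0 mulr0.
Qed.

Lemma dotvC (x y : E) : dotv x y = dotv y x.
Proof. by apply: eq_bigr => i _; rewrite mulrC. Qed.

Lemma ipv_deltar w (p : E -> E) phi i :
  ipv w p (fun x => phi x *: delta_mx 0 i) = ip w (fun x => p x 0 i) phi.
Proof. by apply: eq_Rintegral => x _; rewrite dotv_delta. Qed.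

Lemma ipv_deltal w (p : E -> E) phi i :
  ipv w (fun x => phi x *: delta_mx 0 i) p = ip w phi (fun x => p x 0 i).
Proof. by apply: eq_Rintegral => x _; rewrite dotvC dotv_delta mulrC. Qed.

Lemma L2v_delta w phi i : measurable w -> L2 w phi ->
  L2v w (fun x => phi x *: delta_mx 0 i).
Proof.
move=> mw Lphi j; have [->|ji] := eqVneq j i.
  by rewrite (_ : (fun x => _) = phi)//; apply/funext => x; rewrite !mxE !eqxx mulr1.
rewrite (_ : (fun x => _) = (0 : E -> R)); first exact: (L2_subspace mw).1.
by apply/funext => x; rewrite !mxE (negPf ji) andbF mulr0.
Qed.

Definition ipH1 w : sob -> sob -> R := sum_form (@ip R n w) (@ipv R n w).
Definition ipHdiv w : dvf -> dvf -> R := sum_form (@ipv R n w) (@ip R n w).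

Lemma ipH1_semi_inner w : measurable w ->
  semi_inner (L2 w `*` L2v w) (ipH1 w).
Proof. by move=> mw; apply: semi_inner_prod; [exact: ip_semi_inner|exact: ipv_semi_inner]. Qed.

Lemma ipHdiv_semi_inner w : measurable w ->
  semi_inner (L2v w `*` L2 w) (ipHdiv w).
Proof. by move=> mw; apply: semi_inner_prod; [exact: ipv_semi_inner|exact: ip_semi_inner]. Qed.

Let C1 w : set sob := [set c | exists phi i, test_fun w phi /\
  c = (partial i phi, fun x => phi x *: delta_mx 0 i)].

Let Cd w : set dvf := [set c | exists2 phi, test_fun w phi & c = (grad phi, phi)].

Let C1_sub w : measurable w -> C1 w `<=` L2 w `*` L2v w.
Proof.
move=> mw _ [phi [i [tphi ->]]]; split => /=; first exact: test_L2 (test_partial i tphi).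
by apply: L2v_delta => //; exact: test_L2 tphi.
Qed.

Let Cd_sub w : measurable w -> Cd w `<=` L2v w `*` L2 w.
Proof.
move=> mw _ [phi tphi ->]; split => /=; first exact: test_grad_L2v tphi.
exact: test_L2 tphi.
Qed.

Let H1E w : H1 w = annihilator (L2 w `*` L2v w) (ipH1 w) (C1 w).
Proof.
apply/seteqP; split => [u [u1 u2 hu]|u [[u1 u2] hu]].
  split => // _ [phi [i [tphi ->]]]; rewrite /ipH1 /sum_form/= ipv_deltar hu//.
  by rewrite addNr.
split => // phi i tphi; apply/eqP; rewrite -addr_eq0; apply/eqP.
have := hu _ (ex_intro _ phi (ex_intro _ i (conj tphi erefl))).
by rewrite /ipH1 /sum_form/= ipv_deltar.
Qed.

Let HdivE w : Hdiv w = annihilator (L2v w `*` L2 w) (ipHdiv w) (Cd w).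
Proof.
apply/seteqP; split => [u [u1 u2 hu]|u [[u1 u2] hu]].
  by split => // _ [phi tphi ->]; rewrite /ipHdiv /sum_form/= hu// addNr.
split => // phi tphi; apply/eqP; rewrite -addr_eq0; apply/eqP.
exact: hu _ (ex_intro2 _ _ phi tphi erefl).
Qed.

Lemma H1_L2 w : H1 w `<=` L2 w `*` L2v w. Proof. by move=> u []. Qed.
Lemma Hdiv_L2 w : Hdiv w `<=` L2v w `*` L2 w. Proof. by move=> u []. Qed.

Lemma H1_subspace w : measurable w -> is_subspace (H1 w).
Proof.
move=> mw; rewrite H1E; apply: annihilator_subspace; [exact: ipH1_semi_inner|exact: C1_sub].
Qed.

Lemma Hdiv_subspace w : measurable w -> is_subspace (Hdiv w).
Proof.
move=> mw; rewrite HdivE; apply: annihilator_subspace; [exact: ipHdiv_semi_inner|exact: Cd_sub].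
Qed.

Lemma H1_semi_inner w : measurable w -> semi_inner (H1 w) (ipH1 w).
Proof.
move=> mw; apply: semi_inner_sub (ipH1_semi_inner mw) (H1_subspace mw) _; exact: H1_L2.
Qed.

Lemma Hdiv_semi_inner w : measurable w -> semi_inner (Hdiv w) (ipHdiv w).
Proof.
move=> mw; apply: semi_inner_sub (ipHdiv_semi_inner mw) (Hdiv_subspace mw) _; exact: Hdiv_L2.
Qed.

Lemma H1_complete w : measurable w -> complete_for (H1 w) (ipH1 w).
Proof.
move=> mw; rewrite H1E; apply: annihilator_complete.
- exact: ipH1_semi_inner.
- exact: C1_sub.
- apply: complete_prod; [exact: ip_semi_inner|exact: ipv_semi_inner|exact: L2_complete|exact: L2v_complete].
Qed.

Lemma test_H1 w w' phi : measurable w' -> test_fun w phi -> H1 w' (phi, grad phi).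
Proof.
move=> mw' tphi; split => /=; [exact: test_L2 tphi|exact: test_grad_L2v tphi|].
move=> psi i tpsi; rewrite (test_ibp (w := w) (w'' := w'))//; congr (- ip _ _ _).
by apply/funext => x; rewrite mxE.
Qed.

Lemma test_Hdiv w w' phi i : measurable w' -> test_fun w phi ->
  Hdiv w' (fun x => phi x *: delta_mx 0 i, partial i phi).
Proof.
move=> mw' tphi; split => /=.
- by apply: L2v_delta => //; exact: test_L2 tphi.
- exact: test_L2 (test_partial i tphi).
- move=> psi tpsi; rewrite ipv_deltal -(test_ibp (w := w) (w'' := w'))//.
  by congr (ip _ _ _); apply/funext => x; rewrite mxE.
Qed.

Lemma ipv_support w w' (p q : E -> E) : w' `<=` w -> (forall x, ~ w' x -> q x = 0) ->
  ipv w p q = ipv w' p q.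
Proof.
move=> ww' q0.
have d0 x : ~ w' x -> dotv (p x) (q x) = 0.
  by move=> /q0 ->; rewrite /dotv big1// => i _; rewrite mxE mulr0.
rewrite /ipv Rintegral_mkcond [RHS]Rintegral_mkcond; congr Rintegral.
apply/funext => x; rewrite !patchE; case: ifPn => [/set_mem xw|/negP xw]; case: ifPn => // /negP xw'.
  by rewrite d0// => h; apply: xw'; rewrite inE.
by rewrite d0// => h; apply: xw; rewrite inE; exact: ww'.
Qed.

Lemma grad0 w phi x : test_fun w phi -> ~ w x -> grad phi x = 0.
Proof.
by move=> tphi wx; apply/rowP => i; rewrite !mxE; exact: (test0 (test_partial i tphi)).
Qed.

Lemma H1_sub w w' u : measurable w -> measurable w' -> w' `<=` w ->
  H1 w u -> H1 w' u.
Proof.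
move=> mw mw' sw [u1 u2 hu]; split; [exact: L2_sub u1|exact: L2v_sub u2|].
move=> phi i tphi; rewrite -!(@ip_support _ _ w w')//; first exact: hu (test_sub sw tphi).
  by move=> x; exact: test0.
by move=> x; exact: test0 (test_partial i tphi).
Qed.

Lemma Hdiv_sub w w' q : measurable w -> measurable w' -> w' `<=` w ->
  Hdiv w q -> Hdiv w' q.
Proof.
move=> mw mw' sw [q1 q2 hq]; split; [exact: L2v_sub q1|exact: L2_sub q2|].
move=> phi tphi; rewrite -(@ip_support _ _ w w')//; last by move=> x; exact: test0.
rewrite -(@ipv_support w w')//; first exact: hq (test_sub sw tphi).
by move=> x; exact: grad0.
Qed.

(** The Green functional is the H(div) product with the swapped pair (gradient, function), from
    which [ntrace] inherits bilinearity and its Cauchy-Schwarz bound. *)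
Lemma ntrace_ipHdiv w q u : ntrace w q u = ipHdiv w q (u.2, u.1).
Proof. by []. Qed.

Lemma ntrace_ipH1 w q u : measurable w -> Hdiv w q -> H1 w u ->
  ntrace w q u = ipH1 w u (q.2, q.1).
Proof.
move=> mw [q1 q2 _] [u1 u2 _]; rewrite /ntrace /ipH1 /sum_form/= addrC.
have [_ -> // _ _] := ip_semi_inner mw.
by have [_ -> // _ _] := ipv_semi_inner mw.
Qed.

Lemma H1norm_sqr w u : measurable w -> H1 w u -> H1norm w u ^+ 2 = ipH1 w u u.
Proof. by move=> mw Hu; rewrite sqr_sqrtr//; exact: (sin_ge0 (H1_semi_inner mw)). Qed.

Lemma Hdivnorm_sqr w q : measurable w -> Hdiv w q ->
  Hdivnorm w q ^+ 2 = ipHdiv w q q.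
Proof. by move=> mw Hq; rewrite sqr_sqrtr//; exact: (sin_ge0 (Hdiv_semi_inner mw)). Qed.

Lemma ntrace_le w q u : measurable w -> Hdiv w q -> L2 w u.1 -> L2v w u.2 ->
  `|ntrace w q u| <= Hdivnorm w q * H1norm w u.
Proof.
move=> mw [q1 q2 _] u1 u2; rewrite ntrace_ipHdiv.
have Lu : (L2v w `*` L2 w) (u.2, u.1) by [].
have Lq : (L2v w `*` L2 w) q by [].
have := sin_CSsqrt (ipHdiv_semi_inner mw) Lq Lu.
by rewrite {3}/ipHdiv /sum_form/= [X in _ * Num.sqrt X]addrC.
Qed.

Lemma ntrace_linr w q (a : R) u v : measurable w -> Hdiv w q -> H1 w u -> H1 w v ->
  ntrace w q (a *: u + v) = a * ntrace w q u + ntrace w q v.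
Proof.
move=> mw Hq Hu Hv; have := (H1_subspace mw).2 a u v Hu Hv => Huv.
rewrite !ntrace_ipH1//; have [_ _ h _] := ipH1_semi_inner mw.
apply: h; [exact: H1_L2|exact: H1_L2|by case: Hq].
Qed.

Lemma ntrace_linl w (a : R) q q' u : measurable w -> Hdiv w q -> Hdiv w q' ->
  L2 w u.1 -> L2v w u.2 ->
  ntrace w (a *: q + q') u = a * ntrace w q u + ntrace w q' u.
Proof.
move=> mw Hq Hq' u1 u2; rewrite !ntrace_ipHdiv.
have [_ _ h _] := ipHdiv_semi_inner mw.
by apply: h => //; exact: Hdiv_L2.
Qed.

Lemma ntrace_test w q phi : Hdiv w q -> test_fun w phi ->
  ntrace w q (phi, grad phi) = 0.
Proof. by move=> [_ _ h] tphi; rewrite /ntrace/= h// addNr. Qed.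

(* A function orthogonal to all normal traces is a limit of test functions:
   the part d of z orthogonal in H^1 to the test functions satisfies
   div (grad d) = d, so that (grad d, d) can be taken as the field. *)
Lemma H10P w z : measurable w ->
  H10 w z <-> H1 w z /\ forall tau, Hdiv w tau -> ntrace w tau z = 0.
Proof.
move=> mw; have sI := H1_semi_inner mw; have sH := H1_subspace mw.
split=> [[Hz hz]|[Hz hz]].
  split => // tau Ht; apply/eqP; rewrite -normr_le0; apply/ler_addgt0Pr => e e0.
  rewrite add0r; have d0 : 0 < e / (Hdivnorm w tau + 1).
    by rewrite divr_gt0// ltr_wpDl// sqrtr_ge0.
  have [phi tphi hphi] := hz _ d0.
  have Hphi := test_H1 mw tphi.
  have Hd : H1 w (z - (phi, grad phi)) by exact: (subspaceB sH Hz Hphi).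
  have -> : ntrace w tau z = ntrace w tau (z - (phi, grad phi)).
    have := ntrace_linr (-1) mw Ht Hphi Hz.
    by rewrite scaleN1r addrC (ntrace_test Ht tphi) mulr0 add0r => ->.
  have [d1 d2 _] := Hd.
  apply: le_trans (ntrace_le mw Ht d1 d2) _.
  apply: (@le_trans _ _ (Hdivnorm w tau * (e / (Hdivnorm w tau + 1)))).
    by apply: ler_wpM2l; [exact: sqrtr_ge0|exact: ltW].
  by apply: mulr_div_addr1_le => //; exact: sqrtr_ge0.
split => // e e0.
pose M : set sob := [set m | exists2 phi, test_fun w phi & m = (phi, grad phi)].
have MD : M `<=` H1 w by move=> _ [phi tphi ->]; exact: test_H1 tphi.
have sM : is_subspace M.
  split.
    exists 0; first exact: (test_subspace w).1.
    congr pair; apply/funext => x; apply/rowP => i.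
    by rewrite !mxE /partial derive_cst.
  move=> a _ _ [phi tphi ->] [psi tpsi ->]; exists (a *: phi + psi).
    exact: (test_subspace w).2.
  by rewrite (grad_lin a tphi tpsi).
have lL a u v : M u -> M v ->
    ipH1 w z (a *: u + v) = a * ipH1 w z u + ipH1 w z v.
  move=> Mu Mv; have Hu := MD _ Mu; have Hv := MD _ Mv.
  by rewrite (sinDr sI)// ?(sinZr sI)//; exact: subspaceZ.
have [y [Hy ym yl]] := riesz_closure sI (sin_ge0 sI Hz) (H1_complete mw) sM MD lL
    (fun m Mm => sin_CS sI Hz (MD m Mm)).
pose d := z - y.
have Hd : H1 w d by exact: subspaceB.
have dm m : M m -> ipH1 w d m = 0.
  by move=> Mm; rewrite /d (sinBl sI)// ?ym ?subrr//; exact: MD.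
have dz : ipH1 w d z = 0.
  have Hq : Hdiv w (d.2, d.1).
    have [d1 d2 _] := Hd; split => //= phi tphi.
    apply/eqP; rewrite -addr_eq0 addrC; apply/eqP.
    exact: (dm (phi, grad phi) (ex_intro2 _ _ phi tphi erefl)).
  have := hz _ Hq; rewrite /ntrace/= addrC.
  by [].
(* [y] is a limit of test functions, and [d] is orthogonal to all of them. *)
have dy : ipH1 w d y = 0.
  apply/eqP; rewrite -sqrf_eq0 eq_le sqr_ge0 andbT.
  apply/ler_addgt0Pr => f f0; rewrite add0r.
  have dd0 : 0 <= ipH1 w d d by exact: (sin_ge0 sI).
  have g0 : 0 < f / (ipH1 w d d + 1) by rewrite divr_gt0// ltr_wpDl.
  have [m Mm hm] := yl _ g0; have Hm := MD _ Mm.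
  have -> : ipH1 w d y ^+ 2 = ipH1 w d (m - y) ^+ 2.
    by rewrite (sinBr sI)// (dm m Mm) sub0r sqrrN.
  apply: le_trans (sin_CS sI Hd (subspaceB sH Hm Hy)) _.
  apply: (@le_trans _ _ (ipH1 w d d * (f / (ipH1 w d d + 1)))).
    by apply: ler_wpM2l => //; exact: ltW.
  exact: mulr_div_addr1_le.
have dd : ipH1 w d d = 0 by rewrite {2}/d (sinBr sI)// dz dy subrr.
have e2 : 0 < e ^+ 2 / 2 by rewrite divr_gt0 ?exprn_gt0.
have [m Mm hm] := yl _ e2; have Hm := MD _ Mm.
have [phi tphi em] := Mm; exists phi => //; rewrite -em.
have Hzm : H1 w (z - m) by exact: subspaceB.
rewrite -(@ltr_pXn2r _ 2)// ?nnegrE ?sqrtr_ge0 ?(ltW e0)// H1norm_sqr//.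
have -> : z - m = d + (y - m) by rewrite /d addrA subrK.
have Hym : H1 w (y - m) by exact: subspaceB.
apply: le_lt_trans (sin_le2D sI Hd Hym) _; rewrite dd mulr0 add0r.
have -> : ipH1 w (y - m) (y - m) = ipH1 w (m - y) (m - y).
  have Hmy : H1 w (m - y) by exact: subspaceB.
  by rewrite -opprB (sinNl sI)// ?(sinNr sI) ?opprK//; exact: subspaceN.
by rewrite mulrC -ltr_pdivlMr.
Qed.

End sobolev_spaces.

(** * Integrals over a mesh *)

Section agree.
Variables (R : realType) (n : nat) (w : set 'rV[R]_n.+1).
Local Notation E := 'rV[R]_n.+1.
Hypothesis mw : measurable w.

Lemma L2_agree (f g : E -> R) : {in w, f =1 g} -> L2 w f -> L2 w g.
Proof.
move=> fg [mf fi]; split; first exact: eq_measurable_fun mf.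
move: fi; congr (_ < _)%E; apply: eq_integral => x xw; by rewrite fg.
Qed.

Lemma L2v_agree (p q : E -> E) : {in w, p =1 q} -> L2v w p -> L2v w q.
Proof. by move=> pq Lp i; apply: L2_agree (Lp i) => x xw; rewrite pq. Qed.

Lemma ip_agree (f f' g g' : E -> R) : {in w, f =1 f'} -> {in w, g =1 g'} ->
  ip w f g = ip w f' g'.
Proof. by move=> ff gg; apply: eq_Rintegral => x xw; rewrite ff// gg. Qed.

Lemma ipv_agree (f f' g g' : E -> E) : {in w, f =1 f'} -> {in w, g =1 g'} ->
  ipv w f g = ipv w f' g'.
Proof. by move=> ff gg; apply: eq_Rintegral => x xw; rewrite ff// gg. Qed.

Lemma H1_agree (u v : sob R n) : {in w, u.1 =1 v.1} -> {in w, u.2 =1 v.2} ->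
  H1 w u -> H1 w v.
Proof.
move=> h1 h2 [u1 u2 hu]; split; [exact: L2_agree u1|exact: L2v_agree u2|].
move=> phi i tphi; rewrite -(ip_agree h1 (fun _ _ => erefl)) hu//; congr (- _).
by apply: ip_agree => // x xw; rewrite h2.
Qed.

Lemma Hdiv_agree (u v : dvf R n) : {in w, u.1 =1 v.1} -> {in w, u.2 =1 v.2} ->
  Hdiv w u -> Hdiv w v.
Proof.
move=> h1 h2 [u1 u2 hu]; split; [exact: L2v_agree u1|exact: L2_agree u2|].
move=> phi tphi; rewrite -(ipv_agree h1 (fun _ _ => erefl)) hu//; congr (- _).
by apply: ip_agree => // x xw; rewrite h2.
Qed.

Lemma Hmhalf_lin (sigma : sob R n -> R) (a : R) u v : Hmhalf w sigma ->
  H1 w u -> H1 w v -> sigma (a *: u + v) = a * sigma u + sigma v.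
Proof. by move=> [h _ _] Hu Hv; rewrite -h. Qed.

End agree.

Section extend0.
Variables (R : realType) (n : nat).
Local Notation E := 'rV[R]_n.+1.

Definition extend0 (V : zmodType) (w : set E) (f : E -> V) : E -> V :=
  fun x => if x \in w then f x else 0.

Lemma extend0_in (V : zmodType) (w : set E) (f : E -> V) : {in w, extend0 w f =1 f}.
Proof. by move=> x xw; rewrite /extend0 xw. Qed.

Lemma extend0_out (V : zmodType) (w w' : set E) (f : E -> V) : w `&` w' = set0 ->
  {in w', extend0 w f =1 (0 : E -> V)}.
Proof.
move=> ww' x /set_mem xw'; rewrite /extend0; case: ifPn => // /set_mem xw.
by have : (w `&` w') x by []; rewrite ww'.
Qed.

Lemma extend0_support (V : zmodType) (w : set E) (f : E -> V) x :
  ~ w x -> extend0 w f x = 0.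
Proof. by move=> nx; rewrite /extend0 memNset. Qed.

Lemma L2_extend0 (w w' : set E) (f : E -> R) : measurable w -> measurable w' ->
  w' `<=` w -> L2 w' f -> L2 w (extend0 w' f).
Proof.
move=> mw mw' sw [mf fi].
have me : measurable_fun w (extend0 w' f).
  rewrite -(setDUK sw); apply/measurable_funU => //; first exact: measurableD.
  split.
    by apply: eq_measurable_fun mf => x xw; rewrite extend0_in.
  have h0 : measurable_fun (w `\` w') (cst 0 : E -> R) by exact: measurable_cst.
  by apply: eq_measurable_fun h0 => x /set_mem[_ nx]; rewrite extend0_support.
split => //; move: fi; congr (_ < _)%E.
rewrite integral_mkcond [RHS]integral_mkcond; apply: eq_integral => x _.
rewrite !patchE /extend0; case: ifPn => [/set_mem xw'|].
  by rewrite (mem_set (sw _ xw')).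
by rewrite expr0n/=; case: ifP.
Qed.

Lemma L2v_extend0 (w w' : set E) (p : E -> E) : measurable w -> measurable w' ->
  w' `<=` w -> L2v w' p -> L2v w (extend0 w' p).
Proof.
move=> mw mw' sw Lp i; rewrite (_ : (fun x => _) = extend0 w' (fun x => p x 0 i)).
  exact: L2_extend0.
by apply/funext => x; rewrite /extend0; case: ifP => // _; rewrite mxE.
Qed.

End extend0.

Section mesh_integrals.
Variables (R : realType) (n : nat) (Om : set 'rV[R]_n.+1) (T : mesh Om).
Hypothesis oOm : open Om.
Local Notation E := 'rV[R]_n.+1.
Local Notation mu := (leb R n.+1).
Local Notation sob := (sob R n).
Local Notation dvf := (dvf R n).
Local Notation C := (@cell R n Om T).

Lemma measurable_dom : measurable Om. Proof. exact: open_measurable_rV. Qed.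

Lemma measurable_cell i : measurable (C i).
Proof. exact: simplex_measurable (@vert_indep _ _ _ T i). Qed.

Lemma cell_dom i : C i `<=` Om. Proof. exact: cell_sub. Qed.

Let mOm := measurable_dom.
Let mC := measurable_cell.
Let sC := cell_dom.

(** The mesh covers the domain only by closed cells. What the open cells miss lies on their
    boundaries, which are null because the cells are simplices. *)
Lemma cells_cover : mu (Om `\` \big[setU/set0]_(i <- enum 'I_(msize T)) C i) = 0%E.
Proof.
set N := _ `\` _.
have mN : measurable N by apply: measurableD => //; exact: bigsetU_measurable.
apply: measure_negligible => //.
pose Z k := if insub k is Some i then closure (C i) `\` C i else set0.
have : mu.-negligible (\bigcup_k Z k).
  apply: negligible_bigcup => k; rewrite /Z; case: insub => [i|]; last exact: negligible_set0.
  apply/negligibleP; last exact: leb_closure_simplex (@vert_indep _ _ _ T i).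
  apply: measurableD => //; rewrite -[X in measurable X]setCK; apply: measurableC.
  by apply: open_measurable_rV; apply: closed_openC; exact: closed_closure.
apply: negligibleS => x [Ox nx].
have : (\bigcup_i closure (C i)) x by rewrite (@cell_cover _ _ _ T); exact: subset_closure.
move=> [i _ ci]; exists (nat_of_ord i) => //; rewrite /Z valK; split => //.
by move=> h; apply: nx; rewrite -bigcup_seq; exists i => //=; rewrite mem_enum.
Qed.

Lemma Rintegral_cells (f : E -> R) : mu.-integrable Om (EFin \o f) ->
  \int[mu]_(x in Om) f x = \sum_i \int[mu]_(x in C i) f x.
Proof.
move=> fi; rewrite /Rintegral.
set D := \big[setU/set0]_(i <- enum 'I_(msize T)) C i.
have mD : measurable D by exact: bigsetU_measurable.
have sD : D `<=` Om by rewrite /D -bigcup_seq => x [i _ /sC].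
rewrite (@negligible_integral _ _ _ mu Om (Om `\` D))//; [|exact: measurableD|exact: cells_cover].
rewrite setDD setIidr//.
have -> : (\int[mu]_(x in D) (f x)%:E = \sum_(i <- enum 'I_(msize T)) \int[mu]_(x in C i) (f x)%:E)%E.
  apply: integral_bigsetU_EFin => //; first exact: enum_uniq.
    apply/trivIsetP => i j _ _ ij; exact: cell_disjoint.
  by apply: measurable_funS mOm sD _; case/integrableP: fi.
rewrite big_enum/= sum_fine//.
by move=> i _; apply: (integrable_fin_num (mC i)); exact: (integrableS mOm).
Qed.

Lemma ip_cells (f g : E -> R) : L2 Om f -> L2 Om g ->
  ip Om f g = \sum_i ip (C i) f g.
Proof. by move=> Lf Lg; apply: Rintegral_cells; exact: L2_integrableM. Qed.

Lemma ipv_cells (p q : E -> E) : L2v Om p -> L2v Om q ->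
  ipv Om p q = \sum_i ipv (C i) p q.
Proof.
move=> Lp Lq; rewrite ipvE//.
under eq_bigr => j _ do rewrite (ip_cells (Lp j) (Lq j)).
rewrite exchange_big/=; apply: eq_bigr => i _; rewrite ipvE//.
  exact: (L2v_sub mOm (mC i) (@sC i)).
exact: (L2v_sub mOm (mC i) (@sC i)).
Qed.

Lemma ntrace_cells (q : dvf) (u : sob) : (L2v Om `*` L2 Om) q ->
  (L2 Om `*` L2v Om) u -> ntrace Om q u = \sum_i ntrace (C i) q u.
Proof.
by move=> [q1 q2] [u1 u2]; rewrite /ntrace ipv_cells// ip_cells// -big_split.
Qed.

Lemma H1_cell u i : H1 Om u -> H1 (C i) u.
Proof. exact: H1_sub. Qed.

Lemma Hdiv_cell q i : Hdiv Om q -> Hdiv (C i) q.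
Proof. exact: Hdiv_sub. Qed.

(** By duality: each Green functional over the domain is the sum of those over the cells, which
    vanish. Consequently all global extensions of one skeleton trace have the same trace on the
    boundary of the domain. *)
Lemma H10_cells z : H1 Om z -> (forall i, H10 (C i) z) -> H10 Om z.
Proof.
move=> Hz hz; apply/(H10P z mOm); split => // tau Ht.
rewrite ntrace_cells; [|exact: Hdiv_L2|exact: H1_L2].
rewrite big1// => i _; have [+ _] := H10P z (mC i); move=> /(_ (hz i))[_]; apply.
exact: Hdiv_cell.
Qed.

Definition ext0 (i : 'I_(msize T)) (V W : zmodType) (u : (E -> V) * (E -> W)) :=
  (extend0 (C i) u.1, extend0 (C i) u.2).

(** The zero extension from a cell is in general not in H^1 of the domain, but the broken space asks
    for membership on each cell separately. This is how a function on one cell becomes a test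
    function. *)
Lemma H1_ext0 i j u : H1 (C i) u -> H1 (C j) (ext0 i u).
Proof.
have [->|ij] := eqVneq j i.
  by move=> h; apply: H1_agree h => x xw; rewrite /= extend0_in.
move=> _; have := (H1_subspace (mC j)).1; apply: H1_agree => x xw;
  by rewrite /= (extend0_out _ (cell_disjoint _) xw)// eq_sym.
Qed.

Lemma Hdiv_ext0 i j u : Hdiv (C i) u -> Hdiv (C j) (ext0 i u).
Proof.
have [->|ij] := eqVneq j i.
  by move=> h; apply: Hdiv_agree h => x xw; rewrite /= extend0_in.
move=> _; have := (Hdiv_subspace (mC j)).1; apply: Hdiv_agree => x xw;
  by rewrite /= (extend0_out _ (cell_disjoint _) xw)// eq_sym.
Qed.

End mesh_integrals.

Section semi_inner_zero.
Variables (R : realType) (H : lmodType R) (D : set H) (B : H -> H -> R).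
Hypothesis DB : semi_inner D B.

Lemma sin_subspace : is_subspace D. Proof. by case: DB. Qed.

Lemma sin_set0 : D 0. Proof. by case: sin_subspace. Qed.

Lemma sinC u v : D u -> D v -> B u v = B v u.
Proof. by case: DB => _ h _ _; exact: h. Qed.

Lemma sin0l u : D u -> B 0 u = 0.
Proof. by move=> Du; rewrite -(scale0r 0) (sinZl DB)// ?mul0r//; exact: sin_set0. Qed.

Lemma sin0r u : D u -> B u 0 = 0.
Proof. by move=> Du; rewrite sinC ?sin0l//; exact: sin_set0. Qed.

End semi_inner_zero.

(** * Fields lifting the skeleton unknowns *)

Section dpg_spaces.
Variables (R : realType) (n : nat) (Om : set 'rV[R]_n.+1) (T : mesh Om).
Hypothesis oOm : open Om.
Local Notation sob := (sob R n).
Local Notation dvf := (dvf R n).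
Local Notation C := (@cell R n Om T).
Local Notation U := (Ucarrier T).
Local Notation V := (Vcarrier R n).
Implicit Types (z : U).

Let mOm : measurable Om := measurable_dom oOm.
Let mC := @measurable_cell R n Om T.
Let sC := @cell_dom R n Om T.

Definition L2prod : set V := (L2 Om `*` L2v Om) `*` (L2v Om `*` L2 Om).

Lemma ipVE : ipV Om = sum_form (ipH1 Om) (ipHdiv Om) :> (V -> V -> R).
Proof.
apply/funext => v; apply/funext => v'.
by rewrite /ipV /sum_form /ipH1 /ipHdiv /sum_form/= addrA.
Qed.

Lemma ipV_semi_inner : semi_inner L2prod (ipV Om).
Proof.
rewrite ipVE; apply: semi_inner_prod; [exact: ipH1_semi_inner|exact: ipHdiv_semi_inner].
Qed.

(** Each element involves one cell and one factor of V, so that orthogonality to all of them is the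
    conjunction of the weak derivative identities on every cell. *)
Let CV : set V := [set c | exists i,
  (exists phi j, test_fun (C i) phi /\
     c = ((partial j phi, fun x => phi x *: delta_mx 0 j), 0)) \/
  (exists2 phi, test_fun (C i) phi & c = (0, (grad phi, phi)))].

Let CV_sub : CV `<=` L2prod.
Proof.
move=> _ [i [[phi [j [tphi ->]]]|[phi tphi ->]]]; split => /=.
- split => /=; first exact: test_L2 (test_partial j tphi).
  by apply: L2v_delta => //; exact: test_L2 tphi.
- exact: (sin_set0 (ipHdiv_semi_inner mOm)).
- exact: (sin_set0 (ipH1_semi_inner mOm)).
- by split => /=; [exact: test_grad_L2v tphi|exact: test_L2 tphi].
Qed.

Let ipV_inl (v : V) (c : sob) : L2prod v -> (L2 Om `*` L2v Om) c ->
  ipV Om v (c, 0) = ipH1 Om v.1 c.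
Proof.
move=> [v1 v2] hc; rewrite ipVE /sum_form/=.
by rewrite (sin0r (ipHdiv_semi_inner mOm) v2) addr0.
Qed.

Let ipV_inr (v : V) (c : dvf) : L2prod v -> (L2v Om `*` L2 Om) c ->
  ipV Om v (0, c) = ipHdiv Om v.2 c.
Proof.
move=> [v1 v2] hc; rewrite ipVE /sum_form/=.
by rewrite (sin0r (ipH1_semi_inner mOm) v1) add0r.
Qed.

Let VE : Vspace T = annihilator L2prod (ipV Om) CV.
Proof.
apply/seteqP; split => [v [[v1 v2] hv [t1 t2] ht]|v [Lv hv]].
  have Lv : L2prod v by [].
  split => // _ [i [[phi [j [tphi ->]]]|[phi tphi ->]]].
    rewrite ipV_inl//; last first.
      split => /=; first exact: test_L2 (test_partial j tphi).
      by apply: L2v_delta => //; exact: test_L2 tphi.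
    rewrite /ipH1 /sum_form/= ipv_deltar.
    rewrite (ip_support _ (@sC i)); last by move=> x; exact: test0 (test_partial j tphi).
    rewrite (ip_support _ (@sC i)); last by move=> x; exact: test0 tphi.
    by have [_ _ ->//] := hv i; rewrite addNr.
  rewrite ipV_inr//; last by split => /=; [exact: test_grad_L2v tphi|exact: test_L2 tphi].
  rewrite /ipHdiv /sum_form/=.
  rewrite (ipv_support _ (@sC i)); last by move=> x; exact: grad0 tphi.
  rewrite (ip_support _ (@sC i)); last by move=> x; exact: test0 tphi.
  by have [_ _ ->//] := ht i; rewrite addNr.
have [[v1 v2] [t1 t2]] := Lv; split => // i.
  split; [exact: (L2_sub mOm)|exact: (L2v_sub mOm)|] => phi j tphi.
  have := hv _ (ex_intro _ i (or_introl (ex_intro _ phi (ex_intro _ j (conj tphi erefl))))).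
  rewrite ipV_inl//; last first.
    split => /=; first exact: test_L2 (test_partial j tphi).
    by apply: L2v_delta => //; exact: test_L2 tphi.
  rewrite /ipH1 /sum_form/= ipv_deltar.
  rewrite (ip_support _ (@sC i)); last by move=> x; exact: test0 (test_partial j tphi).
  rewrite (ip_support _ (@sC i)); last by move=> x; exact: test0 tphi.
  by move/eqP; rewrite addr_eq0 => /eqP.
split; [exact: (L2v_sub mOm)|exact: (L2_sub mOm)|] => phi tphi.
have := hv _ (ex_intro _ i (or_intror (ex_intro2 _ _ phi tphi erefl))).
rewrite ipV_inr//; last by split => /=; [exact: test_grad_L2v tphi|exact: test_L2 tphi].
rewrite /ipHdiv /sum_form/=.
rewrite (ipv_support _ (@sC i)); last by move=> x; exact: grad0 tphi.
rewrite (ip_support _ (@sC i)); last by move=> x; exact: test0 tphi.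
by move/eqP; rewrite addr_eq0 => /eqP.
Qed.

Lemma Vspace_L2 : Vspace T `<=` L2prod.
Proof. by rewrite VE => v []. Qed.

Lemma Vspace_subspace : is_subspace (Vspace T).
Proof. by rewrite VE; apply: annihilator_subspace; [exact: ipV_semi_inner|exact: CV_sub]. Qed.

Lemma Vspace_semi_inner : semi_inner (Vspace T) (ipV Om).
Proof. exact: semi_inner_sub ipV_semi_inner Vspace_subspace Vspace_L2. Qed.

Lemma Vspace_complete : complete_for (Vspace T) (ipV Om).
Proof.
rewrite VE; apply: annihilator_complete; [exact: ipV_semi_inner|exact: CV_sub|].
rewrite ipVE; apply: complete_prod; [exact: ipH1_semi_inner|exact: ipHdiv_semi_inner|..].
  by apply: complete_prod; [exact: ip_semi_inner|exact: ipv_semi_inner|exact: L2_complete|exact: L2v_complete].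
by apply: complete_prod; [exact: ipv_semi_inner|exact: ip_semi_inner|exact: L2v_complete|exact: L2_complete].
Qed.

Lemma Vspace_inl (v : sob) : (L2 Om `*` L2v Om) v -> (forall i, H1 (C i) v) ->
  Vspace T (v, 0).
Proof.
move=> Lv hv; split => //=; first exact: (sin_set0 (ipHdiv_semi_inner mOm)).
by move=> i; exact: (Hdiv_subspace (mC i)).1.
Qed.

Lemma Vspace_inr (t : dvf) : (L2v Om `*` L2 Om) t -> (forall i, Hdiv (C i) t) ->
  Vspace T (0, t).
Proof.
move=> Lt ht; split => //=; first exact: (sin_set0 (ipH1_semi_inner mOm)).
by move=> i; exact: (H1_subspace (mC i)).1.
Qed.

(* [w] and [q] are global fields whose traces on the skeleton are the last two
   components of [z]. *)
Definition lifts (z : U) (w : sob) (q : dvf) : Prop :=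
  [/\ Uspace z, extends_tr (uhat_of z) w & extends_ntr (sigmahat_of z) q].

Lemma lifts_exist z : Uspace z -> exists w q, lifts z w q.
Proof.
by move=> Uz; have [_ _ [_ [w hw]] [_ [q hq]]] := Uz; exists w, q.
Qed.

Lemma ntrace_same_trace i tau u w : Hdiv (C i) tau -> H1 (C i) u -> H1 (C i) w ->
  same_trace (C i) u w -> ntrace (C i) tau u = ntrace (C i) tau w.
Proof.
move=> Ht Hu Hw /(H10P _ (mC i))[_ /(_ _ Ht)].
have := ntrace_linr (-1) (mC i) Ht Hw Hu; rewrite scaleN1r addrC mulN1r => ->.
by move/eqP; rewrite addrC subr_eq0 => /eqP.
Qed.

(** On each cell the representative in [uhat_of z] can be replaced by the global field [w]; the
    local Green formulas then add up to one integral over the domain. *)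
Lemma pair_trS_lift z w q tau : lifts z w q -> (L2v Om `*` L2 Om) tau ->
  (forall i, Hdiv (C i) tau) -> pair_trS (uhat_of z) tau = ntrace Om tau w.
Proof.
move=> [[_ _ [Hu _] _] [Hw sw] _] Lt Ht.
rewrite (ntrace_cells T)//; last exact: H1_L2.
apply: eq_bigr => i _; apply: ntrace_same_trace => //.
exact: (H1_cell _ _ Hw).
Qed.

Lemma pair_ntrS_lift z w q v : lifts z w q -> (L2 Om `*` L2v Om) v ->
  (forall i, H1 (C i) v) -> pair_ntrS (sigmahat_of z) v = ntrace Om q v.
Proof.
move=> [_ _ [Hq sq]] Lv Hv; rewrite (ntrace_cells T)//; last exact: Hdiv_L2.
by apply: eq_bigr => i _; exact: sq.
Qed.

Definition riesz_field (z : U) (w : sob) (q : dvf) : V :=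
  ((u_of z - q.2, sigma_of z - q.1), (sigma_of z - w.2, u_of z - w.1)).

Lemma riesz_field_L2 z w q : lifts z w q -> L2prod (riesz_field z w q).
Proof.
move=> [[zu zs _ _] [[w1 w2 _] _] [[q1 q2 _] _]].
have s1 := L2_subspace mOm; have s2 := L2v_subspace mOm.
by split; split => /=; [exact: (subspaceB s1)|exact: (subspaceB s2)|exact: (subspaceB s2)|exact: (subspaceB s1)].
Qed.

Lemma bformE z w q v : lifts z w q -> Vspace T v ->
  bform z v = ipV Om (riesz_field z w q) v.
Proof.
move=> hz [[v1 v2] hv [t1 t2] ht].
case: v v1 v2 hv t1 t2 ht => -[v0 gv] [tau dtau]/= v1 v2 hv t1 t2 ht.
have [[zu zs _ _] [[w1 w2 _] _] [[q1 q2 _] _]] := hz.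
rewrite (pair_ntrS_lift hz)//= (pair_trS_lift hz)//= /ipV /ntrace/=.
have i1 := ip_semi_inner mOm; have i2 := ipv_semi_inner mOm.
rewrite !(sinBl i1)// !(sinBl i2)//.
have [_ c1 _ _] := i1; have [_ c2 _ _] := i2.
by rewrite (c2 tau)// (c1 dtau)//; ring.
Qed.

(** A [riesz_field] is in general only in [L2prod], its entries having no derivatives. Its
    projection onto the complete space [Vspace], provided here, satisfies the equation of
    [Theta]. *)
Lemma Vspace_riesz (F : V) : L2prod F ->
  exists y : V, Vspace T y /\ forall v, Vspace T v -> ipV Om y v = ipV Om F v.
Proof.
move=> LF; have sV := Vspace_semi_inner; have sL := ipV_semi_inner.
have [||||||y [Vy hy _]] := @riesz_closure R V (Vspace T) (ipV Om) sV (Vspace T)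
  (ipV Om F) (ipV Om F F).
- exact: (sin_ge0 sL).
- exact: Vspace_complete.
- exact: Vspace_subspace.
- by [].
- move=> a u v Vu Vv; have Lu := Vspace_L2 Vu; have Lv := Vspace_L2 Vv.
  rewrite (sinDr sL)// ?(sinZr sL)//; exact: subspaceZ (sin_subspace sL) _.
- by move=> v Vv; exact: (sin_CS sL LF (Vspace_L2 Vv)).
by exists y.
Qed.

(** [Theta] is an [xget] with default 0, so its defining equation becomes available only once a
    solution is known to exist. *)
Lemma Theta_exists z : Uspace z -> exists w : V, Vspace T w /\
  forall v, Vspace T v -> ipV Om w v = bform z v.
Proof.
move=> Uz; have [w [q hz]] := lifts_exist Uz.
have [y [Vy hy]] := Vspace_riesz (riesz_field_L2 hz).
by exists y; split => // v Vv; rewrite hy// -bformE.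
Qed.

Lemma Theta_Vspace z : Uspace z -> Vspace T (Theta z).
Proof. by move=> /Theta_exists h; have [] := xgetPex 0 h. Qed.

Lemma ipV_Theta z v : Uspace z -> Vspace T v -> ipV Om (Theta z) v = bform z v.
Proof. by move=> /Theta_exists h Vv; have [_] := xgetPex 0 h; exact. Qed.

End dpg_spaces.

(** * Linearity of liftings, boundary traces and cones *)

Section lifts.
Variables (R : realType) (n : nat) (Om : set 'rV[R]_n.+1) (T : mesh Om).
Hypothesis oOm : open Om.
Local Notation E := 'rV[R]_n.+1.
Local Notation sob := (sob R n).
Local Notation dvf := (dvf R n).
Local Notation C := (@cell R n Om T).
Local Notation U := (Ucarrier T).
Implicit Types (z : U) (w v : sob) (q tau : dvf).

Let mOm : measurable Om := measurable_dom oOm.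
Let mC := @measurable_cell R n Om T.

Lemma H10_subspace (w : set E) : measurable w -> is_subspace (H10 w).
Proof.
move=> mw; have sH := H1_subspace mw; split.
  apply/(H10P _ mw); split; first exact: sH.1.
  move=> tau Ht; have := ntrace_linr (-1) mw Ht sH.1 sH.1.
  by rewrite scaler0 addr0 mulN1r addNr.
move=> a u v /(H10P _ mw)[Hu hu] /(H10P _ mw)[Hv hv].
apply/(H10P _ mw); split; first exact: sH.2.
by move=> tau Ht; rewrite ntrace_linr// hu// hv// mulr0 addr0.
Qed.

Lemma Hmhalf_ntrace (w : set E) q : measurable w -> Hdiv w q -> Hmhalf w (ntrace w q).
Proof.
move=> mw Hq; split.
- by move=> a u v Hu Hv; exact: ntrace_linr.
- by move=> u /(H10P _ mw)[_]; exact.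
- by exists (Hdivnorm w q) => u [u1 u2 _]; exact: ntrace_le.
Qed.

Lemma lifts_lin (a : R) z z' w w' q q' : lifts z w q -> lifts z' w' q' ->
  lifts (a *: z + z') (a *: w + w') (a *: q + q').
Proof.
move=> [[zu zs [zt _] [zn _]] [Hw sw] [Hq sq]]
  [[zu' zs' [zt' _] [zn' _]] [Hw' sw'] [Hq' sq']].
have etr : extends_tr (uhat_of (a *: z + z')) (a *: w + w').
  split; first exact: ((H1_subspace mOm).2 a _ _ Hw Hw').
  move=> i; rewrite /same_trace.
  have -> : uhat_of (a *: z + z') i - (a *: w + w') =
      a *: (uhat_of z i - w) + (uhat_of z' i - w').
    by rewrite scalerBr opprD addrACA.
  exact: ((H10_subspace (mC i)).2 a _ _ (sw i) (sw' i)).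
have entr : extends_ntr (sigmahat_of (a *: z + z')) (a *: q + q').
  split; first exact: ((Hdiv_subspace mOm).2 a _ _ Hq Hq').
  move=> i u Hu; have [u1 u2 _] := Hu.
  rewrite ntrace_linl//; [|exact: (Hdiv_cell oOm)|exact: (Hdiv_cell oOm)].
  by rewrite -(sq i u Hu) -(sq' i u Hu).
split => //; split.
- exact: ((L2_subspace mOm).2 a _ _ zu zu').
- exact: ((L2v_subspace mOm).2 a _ _ zs zs').
- split; last by exists (a *: w + w').
  by move=> i; exact: ((H1_subspace (mC i)).2 a _ _ (zt i) (zt' i)).
- split; last by exists (a *: q + q').
  move=> i; have Hs := zn i; have Hs' := zn' i.
  have [_ v1 [M1 hM1]] := Hs; have [_ v2 [M2 hM2]] := Hs'.
  have e u : sigmahat_of (a *: z + z') i u =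
      a * sigmahat_of z i u + sigmahat_of z' i u by [].
  split.
  + move=> b u v Hu Hv; rewrite !e.
    rewrite -[X in sigmahat_of z i X]/(b *: u + v) -[X in sigmahat_of z' i X]/(b *: u + v).
    by rewrite (Hmhalf_lin _ Hs)// (Hmhalf_lin _ Hs')//; ring.
  + by move=> u Hu; rewrite e v1// v2// mulr0 addr0.
  + exists (`|a| * M1 + M2) => u Hu; rewrite e mulrDl -mulrA.
    apply: le_trans (ler_normD _ _) _; apply: lerD; last exact: hM2.
    by rewrite normrM ler_wpM2l// hM1.
Qed.

Lemma lifts0 : lifts (0 : U) 0 0.
Proof.
have etr : extends_tr (uhat_of (0 : U)) 0.
  split; first exact: (H1_subspace mOm).1.
  by move=> i; rewrite /same_trace subr0; exact: (H10_subspace (mC i)).1.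
have n0 i u : H1 (C i) u -> ntrace (C i) 0 u = 0.
  move=> [u1 u2 _]; have Hq := (Hdiv_subspace (mC i)).1.
  have := ntrace_linl (-1) (mC i) Hq Hq u1 u2.
  by rewrite scaler0 addr0 mulN1r addNr.
have entr : extends_ntr (sigmahat_of (0 : U)) 0.
  split; first exact: (Hdiv_subspace mOm).1.
  by move=> i u Hu; rewrite n0.
split => //; split.
- exact: (L2_subspace mOm).1.
- exact: (L2v_subspace mOm).1.
- by split; [move=> i; exact: (H1_subspace (mC i)).1|exists 0].
- split; last by exists 0.
  move=> i; split => //.
  + by move=> a u v _ _; rewrite /= mulr0 addr0.
  + by exists 0 => u _; rewrite mul0r normr0.
Qed.

Lemma liftsZ (a : R) z w q : lifts z w q -> lifts (a *: z) (a *: w) (a *: q).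
Proof. by move=> h; have := lifts_lin a h lifts0; rewrite !addr0. Qed.

Lemma liftsD z z' w w' q q' : lifts z w q -> lifts z' w' q' ->
  lifts (z + z') (w + w') (q + q').
Proof. by move=> h h'; have := lifts_lin 1 h h'; rewrite !scale1r. Qed.

Lemma liftsB z z' w w' q q' : lifts z w q -> lifts z' w' q' ->
  lifts (z - z') (w - w') (q - q').
Proof.
move=> h h'; have h2 := liftsZ (-1) h'.
by rewrite !scaleN1r in h2; exact: (liftsD h h2).
Qed.

(** The source of the variations: two square-integrable functions and two global fields, chosen
    independently, make up an element of U. *)
Definition mkU (f : E -> R) (s : E -> E) w q : U :=
  (f, s, (fun=> w), (fun i => ntrace (C i) q)).

Lemma lifts_mkU f s w q : L2 Om f -> L2v Om s -> H1 Om w -> Hdiv Om q ->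
  lifts (mkU f s w q) w q.
Proof.
move=> Lf Ls Hw Hq.
have etr : extends_tr (uhat_of (mkU f s w q)) w.
  by split => // i; rewrite /same_trace subrr; exact: (H10_subspace (mC i)).1.
have entr : extends_ntr (sigmahat_of (mkU f s w q)) q by split.
split => //; split => //.
- by split; [move=> i; exact: (H1_cell oOm)|exists w].
- split; last by exists q.
  by move=> i; apply: Hmhalf_ntrace => //; exact: (Hdiv_cell oOm).
Qed.

Lemma ntrace_lifts_cells z w q v : lifts z w q -> H1 Om v ->
  ntrace Om q v = \sum_i sigmahat_of z i v.
Proof.
move=> [_ _ [Hq sq]] Hv; rewrite (ntrace_cells T oOm); [|exact: Hdiv_L2|exact: H1_L2].
by apply: eq_bigr => i _; rewrite sq//; exact: (H1_cell oOm).
Qed.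

(** On a global H^1 function the Green functional of an extension is the sum of the actions of the
    cell components, and this sum does not see which extension was chosen. *)
Lemma gamman_lifts z w q v : lifts z w q -> H1 Om v -> gamman z v = ntrace Om q v.
Proof.
move=> hz Hv; have [Uz ht [Hq sq]] := hz.
have hn : extends_ntr (sigmahat_of z) (xget 0 (extends_ntr (sigmahat_of z))).
  by apply: xgetPex; exists q.
have hz' : lifts z w (xget 0 (extends_ntr (sigmahat_of z))) by split.
by rewrite (ntrace_lifts_cells hz Hv) -(ntrace_lifts_cells hz' Hv).
Qed.

Lemma gamma0_lifts z w q : lifts z w q -> H1 Om (gamma0 z) /\ same_trace Om (gamma0 z) w.
Proof.
move=> [_ hw _]; have [Hw sw] := hw.
have [H0 s0] : extends_tr (uhat_of z) (gamma0 z) by apply: xgetPex; exists w.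
split => //; apply: (H10_cells oOm (T := T)); first exact: (subspaceB (H1_subspace mOm) H0 Hw).
move=> i; have := subspaceB (H10_subspace (mC i)) (sw i) (s0 i).
by rewrite opprB addrC addrA subrK.
Qed.

Lemma ntrace_same_dom q w v : Hdiv Om q -> H1 Om w -> H1 Om v ->
  same_trace Om w v -> ntrace Om q w = ntrace Om q v.
Proof.
move=> Hq Hw Hv /(H10P _ mOm)[_ /(_ _ Hq)].
have := ntrace_linr (-1) mOm Hq Hv Hw; rewrite scaleN1r addrC mulN1r => ->.
by move/eqP; rewrite addrC subr_eq0 => /eqP.
Qed.

Lemma pairG_lifts z z' w w' q q' : lifts z w q -> lifts z' w' q' ->
  pairG (gamman z) (gamma0 z') = ntrace Om q w'.
Proof.
move=> hz hz'; have [H0 s0] := gamma0_lifts hz'.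
have [_ [Hw' _] _] := hz'; have [_ _ [Hq _]] := hz.
by rewrite /pairG (gamman_lifts hz)//; exact: ntrace_same_dom.
Qed.

(** The functionals that test weak convergence vanish on [H10], so the same approximating sequence
    serves both representatives. *)
Lemma nonneg_half_same w v : H1 Om w -> H1 Om v -> same_trace Om w v ->
  nonneg_half Om w -> nonneg_half Om v.
Proof.
move=> Hw Hv hwv [s hs sw]; exists s => // sigma Hs.
suff <- : sigma w = sigma v by exact: sw.
have [_ s0 _] := Hs; have := Hmhalf_lin (-1) Hs Hv Hw.
rewrite scaleN1r mulN1r addrC s0// => /eqP.
by rewrite eq_sym addrC subr_eq0 => /eqP.
Qed.

Lemma K0P z w q : lifts z w q -> K0 z <-> nonneg_half Om w.
Proof.
move=> hz; have [Uz [Hw _] _] := hz; have [H0 s0] := gamma0_lifts hz.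
split=> [[_ h]|h]; first exact: (nonneg_half_same H0 Hw s0 h).
have s0' : same_trace Om w (gamma0 z).
  by have := subspaceN (H10_subspace mOm) s0; rewrite opprB.
by split; [|exact: (nonneg_half_same Hw H0 s0' h)].
Qed.

Lemma KnP z w q : lifts z w q ->
  Kn z <-> forall v, H1 Om v -> nonneg_half Om v -> 0 <= ntrace Om q v.
Proof.
move=> hz; have [Uz _ _] := hz; split=> [[_ h] v Hv nv|h].
  by rewrite -(gamman_lifts hz)//; exact: h.
by split => // v Hv nv; rewrite (gamman_lifts hz)//; exact: h.
Qed.

Lemma is_lip_traceD (w : set E) u v (phi psi : E -> R) : measurable w ->
  is_lip_trace w u phi -> is_lip_trace w v psi ->
  is_lip_trace w (u + v) (phi + psi).
Proof.
move=> mw [a [Ha [k1 l1] b1 t1]] [b [Hb [k2 l2] b2 t2]]; exists (a + b); split.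
- exact: (subspaceD (H1_subspace mw) Ha Hb).
- exists (k1 + k2) => -[x y] xy; rewrite /= opprD addrACA.
  apply: le_trans (ler_normD _ _) _; rewrite mulrDl.
  by apply: lerD; [exact: (l1 (x, y))|exact: (l2 (x, y))].
- by move=> x hx; rewrite -[LHS]/(a.1 x + b.1 x) b1// b2.
- rewrite /same_trace opprD addrACA.
  exact: (subspaceD (H10_subspace mw) t1 t2).
Qed.

(** Makes the variation from [w] to [w + v] with a non-negative [v] admissible in the study of the
    residual. *)
Lemma nonneg_halfD w v : H1 Om w -> H1 Om v -> nonneg_half Om w ->
  nonneg_half Om v -> nonneg_half Om (w + v).
Proof.
move=> Hw Hv [s hs sw] [t ht tv]; exists (fun k => s k + t k).
  move=> k; have [H1s [p [[c1 l1] p0 pl]]] := hs k.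
  have [H1t [p' [[c2 l2] p'0 p'l]]] := ht k.
  split; first exact: (subspaceD (H1_subspace mOm) H1s H1t).
  exists (p + p'); split.
  - exists (c1 + c2) => -[x y] xy; rewrite /= opprD addrACA.
    apply: le_trans (ler_normD _ _) _; rewrite mulrDl.
    by apply: lerD; [exact: (l1 (x, y))|exact: (l2 (x, y))].
  - by move=> x hx; apply: addr_ge0; [exact: p0|exact: p'0].
  - exact: is_lip_traceD.
move=> sigma Hs.
have e u u' : H1 Om u -> H1 Om u' -> sigma (u + u') = sigma u + sigma u'.
  by move=> Hu Hu'; have := Hmhalf_lin 1 Hs Hu Hu'; rewrite scale1r mul1r.
rewrite e// (_ : (fun k => _) = (fun k => sigma (s k) + sigma (t k))); last first.
  by apply/funext => k; rewrite e//; [case: (hs k)|case: (ht k)].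
by apply: cvgD; [exact: sw|exact: tv].
Qed.

Lemma nonneg_half0 : nonneg_half Om 0.
Proof.
exists (fun=> 0); last by move=> sigma _; exact: cvg_cst.
move=> k; have H0 := (H1_subspace mOm).1; split => //; exists 0; split => //.
  by exists 0 => -[x y] _; rewrite /= subrr normr0 mul0r.
exists 0; split => //.
  by exists 0 => -[x y] _; rewrite /= subrr normr0 mul0r.
by rewrite /same_trace subr0; exact: (H10_subspace mOm).1.
Qed.

End lifts.

(** * Continuity and coercivity *)

Lemma inf_sqr_approx (R : realType) (S : set R) (e : R) : S !=set0 ->
  (forall x, S x -> 0 <= x) -> 0 < e ->
  exists2 x, S x & x ^+ 2 <= inf S ^+ 2 + e.
Proof.
move=> S0 Sge0 e0.
have lb0 : has_inf S by split => //; exists 0 => x /Sge0.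
have I0 : 0 <= inf S by apply: lb_le_inf => // x /Sge0.
have d0 : 0 < Num.sqrt (inf S ^+ 2 + e) - inf S.
  rewrite subr_gt0 -{1}(ger0_norm I0) -sqrtr_sqr.
  by rewrite ltr_sqrt ?ltrDl// ltr_wpDl// sqr_ge0.
have [x Sx] := inf_adherent d0 lb0; rewrite addrC subrK => hx.
exists x => //; rewrite -[leRHS]sqr_sqrtr; last by rewrite addr_ge0 ?sqr_ge0 ?ltW.
by rewrite ler_sqr ?nnegrE ?sqrtr_ge0 ?Sge0// ltW.
Qed.

Section estimates.
Variables (R : realType) (n : nat) (Om : set 'rV[R]_n.+1) (T : mesh Om).
Hypothesis oOm : open Om.
Local Notation sob := (sob R n).
Local Notation dvf := (dvf R n).
Local Notation U := (Ucarrier T).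
Implicit Types (z : U) (w v : sob) (q tau : dvf).

Let mOm : measurable Om := measurable_dom oOm.
Let i1 := ip_semi_inner mOm.
Let i2 := ipv_semi_inner mOm.

Definition energy z w q : R := ip Om (u_of z) (u_of z)
  + ipv Om (sigma_of z) (sigma_of z) + ipH1 Om w w + ipHdiv Om q q.

Lemma normU_sqr z : Uspace z -> normU z ^+ 2 =
  ip Om (u_of z) (u_of z) + ipv Om (sigma_of z) (sigma_of z)
  + HhalfS_norm (uhat_of z) ^+ 2 + HmhalfS_norm (sigmahat_of z) ^+ 2.
Proof.
move=> [zu zs _ _]; rewrite sqr_sqrtr//.
by rewrite !addr_ge0 ?sqr_ge0//; [exact: (sin_ge0 i1)|exact: (sin_ge0 i2)].
Qed.

Lemma normU_le_energy z w q : lifts z w q -> normU z ^+ 2 <= energy z w q.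
Proof.
move=> [Uz hw hq]; rewrite normU_sqr// /energy.
have [Hw _] := hw; have [Hq _] := hq.
rewrite -(H1norm_sqr mOm Hw) -(Hdivnorm_sqr mOm Hq).
have le0 (S : set R) x : S x -> (forall y, S y -> 0 <= y) -> inf S ^+ 2 <= x ^+ 2.
  move=> Sx S0; have I0 : 0 <= inf S by apply: lb_le_inf; [exists x|move=> y /S0].
  rewrite ler_sqr ?nnegrE//; last exact: S0.
  by apply: ge_inf => //; exists 0 => y /S0.
by rewrite -!addrA !lerD2l lerD// le0//;
  [exists w|move=> _ [? _ <-]; exact: sqrtr_ge0|exists q|move=> _ [? _ <-]; exact: sqrtr_ge0].
Qed.

(** The skeleton norms are infima. Almost minimal extensions carry estimates in terms of [energy]
    over to [normU], up to an arbitrary [e]. *)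
Lemma energy_approx z e : Uspace z -> 0 < e ->
  exists w q, lifts z w q /\ energy z w q <= normU z ^+ 2 + e.
Proof.
move=> Uz e0; have e20 : 0 < e / 2 by rewrite divr_gt0.
have [w0 [q0 [_ hw0 hq0]]] := lifts_exist Uz.
have [||_ [w hw <-] lw] :=
    (fun h1 h2 => @inf_sqr_approx R [set H1norm Om w | w in extends_tr (uhat_of z)] (e / 2) h1 h2 e20).
- by exists (H1norm Om w0), w0.
- by move=> _ [? _ <-]; exact: sqrtr_ge0.
have [||_ [q hq <-] lq] :=
    (fun h1 h2 => @inf_sqr_approx R [set Hdivnorm Om q | q in extends_ntr (sigmahat_of z)] (e / 2) h1 h2 e20).
- by exists (Hdivnorm Om q0), q0.
- by move=> _ [? _ <-]; exact: sqrtr_ge0.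
exists w, q; split; first by split.
rewrite /energy normU_sqr// -(H1norm_sqr mOm hw.1) -(Hdivnorm_sqr mOm hq.1).
rewrite /HhalfS_norm /HmhalfS_norm; move: lw lq => *; lra.
Qed.

(** [Theta z] is a projection of a [riesz_field] and hence not longer. Each of the two L^2
    components of [z] enters two of the four differences in that field, whence 2 + 2 = 4. *)
Lemma ipV_Theta_le z : Uspace z -> ipV Om (Theta z) (Theta z) <= 4 * normU z ^+ 2.
Proof.
move=> Uz; apply/ler_addgt0Pr => e e0; have e40 : 0 < e / 4 by rewrite divr_gt0.
have [w [q [hz]]] := energy_approx Uz e40.
have VT := Theta_Vspace oOm Uz.
have sL := ipV_semi_inner oOm; have LT := Vspace_L2 oOm VT.
have LF := riesz_field_L2 oOm hz.
set F := riesz_field z w q in LF.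
have h1 : ipV Om (Theta z) (Theta z) <= ipV Om F F.
  have e1 : ipV Om (Theta z) (Theta z) = ipV Om F (Theta z).
    by rewrite ipV_Theta// (bformE oOm hz).
  have := sin_CS sL LF LT; rewrite -e1 expr2.
  have := sin_ge0 sL LT; rewrite le_eqVlt => /predU1P[<- _|h].
    exact: (sin_ge0 sL).
  by rewrite ler_pM2r.
have [[zu zs _ _] [[w1 w2 _] _] [[q1 q2 _] _]] := hz.
have h2 : ipV Om F F <= 4 * (ip Om (u_of z) (u_of z) + ipv Om (sigma_of z) (sigma_of z))
    + 2 * ipH1 Om w w + 2 * ipHdiv Om q q.
  rewrite /ipV /F /riesz_field/= /ipH1 /ipHdiv /sum_form.
  have sub1 f g : L2 Om f -> L2 Om g ->
      ip Om (f - g) (f - g) <= 2 * ip Om f f + 2 * ip Om g g.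
    move=> Lf Lg; have := sin_le2D i1 Lf (subspaceN (L2_subspace mOm) Lg).
    by rewrite (sinNl i1)// ?(sinNr i1)// ?opprK//; exact: (subspaceN (L2_subspace mOm)).
  have sub2 f g : L2v Om f -> L2v Om g ->
      ipv Om (f - g) (f - g) <= 2 * ipv Om f f + 2 * ipv Om g g.
    move=> Lf Lg; have := sin_le2D i2 Lf (subspaceN (L2v_subspace mOm) Lg).
    by rewrite (sinNl i2)// ?(sinNr i2)// ?opprK//; exact: (subspaceN (L2v_subspace mOm)).
  have := sub1 _ _ zu q2; have := sub1 _ _ zu w1.
  have := sub2 _ _ zs q1; have := sub2 _ _ zs w2.
  by move=> *; lra.
have g1 : 0 <= ipH1 Om w w by apply: (sin_ge0 (ipH1_semi_inner mOm)).
have g2 : 0 <= ipHdiv Om q q by apply: (sin_ge0 (ipHdiv_semi_inner mOm)).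
by rewrite /energy; move: h1 h2 g1 g2 => *; lra.
Qed.

Lemma ntrace_CS q w : Hdiv Om q -> H1 Om w ->
  ntrace Om q w ^+ 2 <= ipHdiv Om q q * ipH1 Om w w.
Proof.
move=> [q1 q2 _] [w1 w2 _]; rewrite ntrace_ipHdiv.
have := @sin_CS _ _ _ _ (ipHdiv_semi_inner mOm) q (w.2, w.1) (conj q1 q2) (conj w2 w1).
by rewrite {3}/ipHdiv /sum_form/= [X in _ * X]addrC.
Qed.

Lemma young_sqr (a b c t : R) : 0 <= b -> 0 <= c -> 0 < t -> a ^+ 2 <= b * c ->
  2 * a <= t * b + t^-1 * c.
Proof.
move=> b0 c0 t0 h; have ti : 0 < t^-1 by rewrite invr_gt0.
have s0 : 0 <= t * b + t^-1 * c by rewrite addr_ge0// mulr_ge0// ltW.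
have [a0|a0] := lerP a 0; first by apply: le_trans s0; rewrite mulr_ge0_le0.
rewrite -ler_sqr ?nnegrE ?mulr_ge0 ?(ltW a0)//.
have -> : (t * b + t^-1 * c) ^+ 2 = (t * b - t^-1 * c) ^+ 2 + 4 * (b * c).
  by field; rewrite gt_eqF.
by have := sqr_ge0 (t * b - t^-1 * c); move: h => *; nra.
Qed.

(** Cauchy-Schwarz for the Green functional of almost minimal extensions; the constant 1 is due to
    the choice of the skeleton norms. *)
Lemma pairG_young z z' (t : R) : Uspace z -> Uspace z' -> 0 < t ->
  2 * pairG (gamman z) (gamma0 z') <= t * normU z ^+ 2 + t^-1 * normU z' ^+ 2.
Proof.
move=> Uz Uz' t0; apply/ler_addgt0Pr => e e0; have ti : 0 < t^-1 by rewrite invr_gt0.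
(* Chosen so that the two extension errors, weighted by [t] and [t^-1], add up to [e]. *)
have d0 : 0 < e / (t + t^-1) by rewrite divr_gt0// addr_gt0.
have [w [q [hz he]]] := energy_approx Uz d0.
have [w' [q' [hz' he']]] := energy_approx Uz' d0.
rewrite (pairG_lifts oOm hz hz').
have [[zu zs _ _] [Hw _] [Hq _]] := hz; have [[zu' zs' _ _] [Hw' _] [Hq' _]] := hz'.
have g1 := sin_ge0 (H1_semi_inner mOm) Hw; have g2 := sin_ge0 (Hdiv_semi_inner mOm) Hq.
have g1' := sin_ge0 (H1_semi_inner mOm) Hw'; have g2' := sin_ge0 (Hdiv_semi_inner mOm) Hq'.
have k1 := sin_ge0 i1 zu; have k2 := sin_ge0 i2 zs.
have k1' := sin_ge0 i1 zu'; have k2' := sin_ge0 i2 zs'.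
apply: le_trans (young_sqr g2 g1' t0 (ntrace_CS Hq Hw')) _.
have -> : e = t * (e / (t + t^-1)) + t^-1 * (e / (t + t^-1)).
  by rewrite -mulrDl mulrCA divff ?mulr1// gt_eqF// addr_gt0.
rewrite addrACA -!mulrDr; apply: lerD; apply: ler_wpM2l; rewrite ?(ltW t0) ?(ltW ti)//.
  by apply: le_trans he; rewrite /energy; lra.
by apply: le_trans he'; rewrite /energy; lra.
Qed.

Lemma bform_Theta_young z z' (t : R) : Uspace z -> Uspace z' -> 0 < t ->
  2 * bform z (Theta z') <= 4 * (t * normU z ^+ 2 + t^-1 * normU z' ^+ 2).
Proof.
move=> Uz Uz' t0; have ti : 0 < t^-1 by rewrite invr_gt0.
have V1 := Theta_Vspace oOm Uz; have V2 := Theta_Vspace oOm Uz'.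
have sV := Vspace_semi_inner T oOm.
rewrite -ipV_Theta//.
apply: le_trans (young_sqr (sin_ge0 sV V1) (sin_ge0 sV V2) t0 (sin_CS sV V1 V2)) _.
have h1 := ler_wpM2l (ltW t0) (ipV_Theta_le Uz).
have h2 := ler_wpM2l (ltW ti) (ipV_Theta_le Uz').
apply: le_trans (lerD h1 h2) _; rewrite le_eqVlt; apply/orP; left; apply/eqP.
by move: (normU z) (normU z') t^-1 => *; ring.
Qed.

End estimates.

(** The right side minus the left side is 5 |u - a - d|^2 + |u + a|^2 + |u + d|^2 + 13 |a|^2 + 13
    |d|^2. The inner factor 2 is the one that [2 <= beta] will dominate. *)
Lemma sin_coercive (R : realType) (H : lmodType R) (D : set H)
    (B : H -> H -> R) (u a d : H) : semi_inner D B -> D u -> D a -> D d ->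
  B u u + B (u - d) (u - d) + B (u - a) (u - a) <=
  10 * (2 * (B a a + B d d) + B (u - a) (u - d)).
Proof.
move=> DB Du Da Dd; have sD := sin_subspace DB.
have Dua := subspaceB sD Du Da; have Dud := subspaceB sD Du Dd.
have Duad := subspaceB sD Dua Dd.
have h1 := sin_ge0 DB Duad.
have h2 := sin_ge0 DB (subspaceD sD Du Da); have h3 := sin_ge0 DB (subspaceD sD Du Dd).
have h4 := sin_ge0 DB Da; have h5 := sin_ge0 DB Dd; have h6 := sin_ge0 DB Du.
move: h1 h2 h3 h4 h5 h6.
have Dna := subspaceN sD Da; have Dnd := subspaceN sD Dd.
have D1 := subspaceD sD Du Da; have D2 := subspaceD sD Du Dd.
rewrite !(sinDl DB)// !(sinDr DB)// !(sinNl DB)// !(sinNr DB)//.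
rewrite (sinC DB Da Du) (sinC DB Dd Du) (sinC DB Dd Da).
by move: (B a a) (B d d) (B u u) (B u a) (B u d) (B a d) => *; lra.
Qed.

(** * Fields recovered from the optimal test function, and coercivity *)

Section optimal_test.
Variables (R : realType) (n : nat) (Om : set 'rV[R]_n.+1) (T : mesh Om).
Hypothesis oOm : open Om.
Local Notation E := 'rV[R]_n.+1.
Local Notation sob := (sob R n).
Local Notation dvf := (dvf R n).
Local Notation C := (@cell R n Om T).
Local Notation U := (Ucarrier T).
Implicit Types (z : U) (w v : sob) (q tau : dvf).

Let mOm : measurable Om := measurable_dom oOm.
Let mC := @measurable_cell R n Om T.
Let sC := @cell_dom R n Om T.
Let i1 := ip_semi_inner mOm.
Let i2 := ipv_semi_inner mOm.

Lemma ipC (w : set E) (f g : E -> R) : ip w f g = ip w g f.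
Proof. by apply: eq_Rintegral => x _; rewrite mulrC. Qed.

Lemma ipvC (w : set E) (f g : E -> E) : ipv w f g = ipv w g f.
Proof. by apply: eq_Rintegral => x _; rewrite dotvC. Qed.

Lemma ip_ext0 i (f g : E -> R) : ip Om f (extend0 (C i) g) = ip (C i) f g.
Proof.
rewrite (ip_support _ (@sC i)); last by move=> x; exact: extend0_support.
by apply: ip_agree => // x; exact: extend0_in.
Qed.

Lemma ipv_ext0 i (f g : E -> E) : ipv Om f (extend0 (C i) g) = ipv (C i) f g.
Proof.
rewrite (ipv_support _ (@sC i)); last by move=> x; exact: extend0_support.
by apply: ipv_agree => // x; exact: extend0_in.
Qed.

Lemma ntrace_ext0r i q v : ntrace Om q (ext0 i v) = ntrace (C i) q v.
Proof. by rewrite /ntrace /ext0/= ip_ext0 ipv_ext0. Qed.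

Lemma ntrace_ext0l i q v : ntrace Om (ext0 i q) v = ntrace (C i) q v.
Proof.
by rewrite /ntrace /ext0/= ipC ip_ext0 ipvC ipv_ext0 ipC ipvC.
Qed.

Lemma Vspace_ext0l i v : H1 (C i) v -> Vspace T (ext0 i v, 0).
Proof.
move=> Hv; have [v1 v2 _] := Hv; apply: (Vspace_inl oOm).
  by split; [exact: (L2_extend0 mOm (mC i))|exact: (L2v_extend0 mOm (mC i))].
by move=> j; exact: (H1_ext0 _ Hv).
Qed.

Lemma Vspace_ext0r i tau : Hdiv (C i) tau -> Vspace T (0, ext0 i tau).
Proof.
move=> Ht; have [v1 v2 _] := Ht; apply: (Vspace_inr oOm).
  by split; [exact: (L2v_extend0 mOm (mC i))|exact: (L2_extend0 mOm (mC i))].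
by move=> j; exact: (Hdiv_ext0 _ Ht).
Qed.

(* Testing the equation that defines Theta z with one component at a time
   identifies the skeleton components of z as traces of fields built from z
   and Theta z. *)
Lemma lifts_Theta z : Uspace z -> let t := Theta z in
  lifts z (u_of z - t.2.2, sigma_of z - t.2.1) (sigma_of z - t.1.2, u_of z - t.1.1).
Proof.
move=> Uz t; have Vt : Vspace T t := Theta_Vspace oOm Uz.
have [[t11 t12] [t21 t22]] := Vspace_L2 oOm Vt.
have [w0 [q0 hz]] := lifts_exist Uz.
have [[zu zs [zt _] _] [Hw0 sw0] [Hq0 sq0]] := hz.
have [w01 w02 _] := Hw0; have [q01 q02 _] := Hq0.
set p : dvf := (_, u_of z - t.1.1); set w : sob := (u_of z - t.2.2, _).
have s1 := L2_subspace mOm; have s2 := L2v_subspace mOm.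
have L0 := s1.1; have Lv0 := s2.1.
have p1 : L2v Om p.1 := subspaceB s2 zs t12.
have p2 : L2 Om p.2 := subspaceB s1 zu t11.
have w1 : L2 Om w.1 := subspaceB s1 zu t22.
have w2 : L2v Om w.2 := subspaceB s2 zs t21.
have a1 := subspaceB s1 zu w01; have a2 := subspaceB s2 zs w02.
have a3 := subspaceB s1 zu q02; have a4 := subspaceB s2 zs q01.
(* With a vanishing second test component [w0] drops out, and the equation of [Theta z] becomes
   equality of the Green functionals of [p] and [q0]. *)
have keyp v : Vspace T (v, 0) -> ntrace Om p v = ntrace Om q0 v.
  move=> Vv; have [[v1 v2] _] := Vspace_L2 oOm Vv; rewrite /= in v1 v2.
  have := ipV_Theta oOm Uz Vv; rewrite (bformE oOm hz Vv) /ipV /riesz_field/=.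
  rewrite (sin0r i1 t22) (sin0r i2 t21) (sin0r i1 a1) (sin0r i2 a2).
  rewrite /ntrace /p/= !(sinBl i1)// !(sinBl i2)// -/t; lra.
have keyw tau : Vspace T (0, tau) -> ntrace Om tau w = ntrace Om tau w0.
  move=> Vv; have [_ [v1 v2]] := Vspace_L2 oOm Vv; rewrite /= in v1 v2.
  have := ipV_Theta oOm Uz Vv; rewrite (bformE oOm hz Vv) /ipV /riesz_field/=.
  rewrite (sin0r i1 t11) (sin0r i2 t12) (sin0r i1 a3) (sin0r i2 a4).
  rewrite /ntrace /w/= (ipC _ tau.2) (ipvC _ tau.1) (ipC _ tau.2) (ipvC _ tau.1) !(sinBl i1)// !(sinBl i2)// -/t; lra.
(* The functional of [q0] vanishes on global test functions, hence so does that of [p], which is the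
   weak divergence identity. *)
have Hp : Hdiv Om p.
  split => // phi tphi; apply/eqP; rewrite -addr_eq0; apply/eqP.
  have V1 : Vspace T ((phi, grad phi), 0).
    apply: (Vspace_inl oOm); last by move=> i; exact: test_H1 tphi.
    by split; [exact: test_L2 tphi|exact: test_grad_L2v tphi].
  by have := keyp _ V1; rewrite (ntrace_test Hq0 tphi).
have Hw : H1 Om w.
  split => // phi i tphi; apply/eqP; rewrite -addr_eq0; apply/eqP.
  have V1 : Vspace T (0, (fun x => phi x *: delta_mx 0 i, partial i phi)).
    have [h1 h2 _] := test_Hdiv i mOm tphi.
    by apply: (Vspace_inr oOm) => // j; exact: test_Hdiv tphi.
  have [_ _ /(_ _ i tphi) e0] := Hw0.
  have := keyw _ V1; rewrite /ntrace/= !ipv_deltal ![ip Om (partial i phi) _]ipC e0.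
  by rewrite ![ip Om phi _]ipC subrr addrC.
split; first exact: Uz.
(* Traces on a single cell are compared by testing with the fields of that cell, extended by
   zero. *)
- split; [exact: Hw|move=> i]; apply/(H10P _ (mC i)); have Hwi := H1_cell oOm i Hw.
  have Hw0i := H1_cell oOm i Hw0.
  split; first exact: (subspaceB (H1_subspace (mC i)) (zt i) Hwi).
  move=> tau Ht; have Vx := Vspace_ext0r Ht.
  have := ntrace_linr (-1) (mC i) Ht Hwi (zt i).
  rewrite scaleN1r addrC mulN1r => ->.
  rewrite (ntrace_same_trace Ht (zt i) Hw0i (sw0 i)).
  by rewrite -!ntrace_ext0l keyw// addNr.
- split; [exact: Hp|move=> i v Hv]; rewrite -ntrace_ext0r keyp; last exact: Vspace_ext0l.
  by rewrite ntrace_ext0r; exact: sq0.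
Qed.

(** For the fields of [lifts_Theta], energy and boundary pairing decouple into a scalar and a vector
    instance of the form in [sin_coercive], with (a, d) equal to (t.1.1, t.2.2) and (t.1.2, t.2.1),
    where t is [Theta z]. *)
Lemma coercive z (beta : R) : 2 <= beta -> Uspace z ->
  normU z ^+ 2 <= 10 * (beta * bform z (Theta z) + pairG (gamman z) (gamma0 z)).
Proof.
move=> b2 Uz; have hz := lifts_Theta Uz; have Vt := Theta_Vspace oOm Uz.
rewrite -ipV_Theta// (pairG_lifts oOm hz hz).
have := normU_le_energy oOm hz; rewrite /energy /ipH1 /ipHdiv /sum_form /ntrace /ipV/=.
have [[t11 t12] [t21 t22]] := Vspace_L2 oOm Vt.
have [zu zs _ _] := Uz.
move=> hn; apply: le_trans hn _.
have h1 := sin_coercive i1 zu t11 t22; have h2 := sin_coercive i2 zs t12 t21.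
have pa := sin_ge0 i1 t11; have pd := sin_ge0 i1 t22.
have pg := sin_ge0 i2 t12; have pb := sin_ge0 i2 t21.
move: (Theta z).1.1 (Theta z).1.2 (Theta z).2.1 (Theta z).2.2 h1 h2 pa pd pg pb.
move=> a g b d h1 h2 pa pd pg pb.
have tt : 2 * (ip Om a a + ipv Om g g + ipv Om b b + ip Om d d) <=
    beta * (ip Om a a + ipv Om g g + ipv Om b b + ip Om d d).
  by rewrite ler_wpM2r// !addr_ge0.
by move: (beta * _) tt h1 h2 => *; lra.
Qed.

End optimal_test.

(** * Variational inequalities *)

Section variational_inequality.
Variables (R : realType) (n : nat) (Om : set 'rV[R]_n.+1) (T : mesh Om).
Hypothesis oOm : open Om.
Local Notation sob := (sob R n).
Local Notation dvf := (dvf R n).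
Local Notation U := (Ucarrier T).
Local Notation V := (Vcarrier R n).
Implicit Types (z d : U) (w v : sob) (q tau : dvf) (star : variant).

Let mOm : measurable Om := measurable_dom oOm.
Let i1 := ip_semi_inner mOm.
Let i2 := ipv_semi_inner mOm.
Let s1 := L2_subspace mOm.
Let s2 := L2v_subspace mOm.
Let sH := H1_subspace mOm.
Let sD := Hdiv_subspace mOm.
Let iD := ipHdiv_semi_inner mOm.

Definition nonneg_flux q : Prop :=
  forall v, H1 Om v -> nonneg_half Om v -> 0 <= ntrace Om q v.

(** The cones, and with [bdry] the boundary terms, are restated for lifting fields, so that the
    residual argument deals with volume integrals only. *)
Definition cone star w q : Prop := match star with
  | Var0 => nonneg_half Om w
  | Varn => nonneg_flux q
  | Vars => nonneg_half Om w /\ nonneg_flux q end.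

Definition bdry star w q w' q' : R := match star with
  | Var0 => ntrace Om q w'
  | Varn => ntrace Om q' w
  | Vars => 2^-1 * (ntrace Om q w' + ntrace Om q' w) end.

Lemma KconeP star z w q : lifts z w q -> Kcone T star z <-> cone star w q.
Proof.
move=> hz; case: star; [exact: (K0P oOm hz)|exact: (KnP oOm hz)|].
split=> [[h1 h2]|[h1 h2]].
  by split; [apply/(K0P oOm hz)|apply/(KnP oOm hz)].
by split; [apply/(K0P oOm hz)|apply/(KnP oOm hz)].
Qed.

Lemma test_H10 phi : test_fun Om phi -> H10 Om (phi, grad phi).
Proof.
move=> tphi; apply/(H10P _ mOm); split; first exact: test_H1 tphi.
by move=> tau Ht; exact: ntrace_test.
Qed.

Lemma ntraceZr tau (a : R) v : (L2v Om `*` L2 Om) tau -> (L2 Om `*` L2v Om) v ->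
  ntrace Om tau (a *: v) = a * ntrace Om tau v.
Proof.
move=> Lt [v1 v2]; rewrite !ntrace_ipHdiv.
exact: (sinZr iD a (conj v2 v1 : (L2v Om `*` L2 Om) (v.2, v.1)) Lt).
Qed.

Lemma ntrace0l v : H1 Om v -> ntrace Om 0 v = 0.
Proof.
move=> [v1 v2 _]; rewrite ntrace_ipHdiv.
exact: (sin0l iD (conj v2 v1 : (L2v Om `*` L2 Om) (v.2, v.1))).
Qed.

Lemma ntrace0r tau : (L2v Om `*` L2 Om) tau -> ntrace Om tau 0 = 0.
Proof. by move=> Lt; rewrite ntrace_ipHdiv; exact: (sin0r iD Lt). Qed.

Lemma ntraceDl q q' v : Hdiv Om q -> Hdiv Om q' -> H1 Om v ->
  ntrace Om (q + q') v = ntrace Om q v + ntrace Om q' v.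
Proof.
move=> Hq Hq' [v1 v2 _]; have := ntrace_linl 1 mOm Hq Hq' v1 v2.
by rewrite scale1r mul1r.
Qed.

Lemma ntraceZl (a : R) q v : Hdiv Om q -> H1 Om v ->
  ntrace Om (a *: q) v = a * ntrace Om q v.
Proof.
move=> Hq Hv; have [v1 v2 _] := Hv; have := ntrace_linl a mOm Hq (sin_set0 (Hdiv_semi_inner mOm)) v1 v2.
by rewrite addr0 ntrace0l// addr0.
Qed.

Lemma ntraceDr q v v' : Hdiv Om q -> H1 Om v -> H1 Om v' ->
  ntrace Om q (v + v') = ntrace Om q v + ntrace Om q v'.
Proof.
by move=> Hq Hv Hv'; have := ntrace_linr 1 mOm Hq Hv Hv'; rewrite scale1r mul1r.
Qed.

(* Variations of the two L^2 components reduce e to its H(div) component tau,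
   and variations supported inside the domain put tau in H(div, Om).  It remains
   to choose admissible boundary variations: - tau, or, when both traces are
   constrained, q / 2 - beta tau (a nonnegative flux) and the one leading to 0. *)
Lemma residual_eq0 star (beta : R) w q (e : V) : 0 < beta ->
  H1 Om w -> Hdiv Om q -> L2prod Om e -> cone star w q ->
  (forall d w' q', lifts d w' q' -> cone star (w + w') (q + q') ->
    0 <= beta * ipV Om (riesz_field d w' q') e + bdry star w q w' q') ->
  ipV Om e e = 0.
Proof.
move=> b0 Hw Hq Le cwq vi; have [[e11 e12] [e21 e22]] := Le.
have H0 := sin_set0 (H1_semi_inner mOm); have D0 := sin_set0 (Hdiv_semi_inner mOm).
have LHq := Hdiv_L2 Hq.
(* Varying the L^2 components by [- (e.1.1 + e.2.2)] and [- (e.1.2 + e.2.1)] leaves the traces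
   alone. Both sums vanish almost everywhere, and [e] is determined by its second half. *)
have [m0 k0] : ip Om (e.1.1 + e.2.2) (e.1.1 + e.2.2) = 0 /\
    ipv Om (e.1.2 + e.2.1) (e.1.2 + e.2.1) = 0.
  have Lm := subspaceD s1 e11 e22; have Lk := subspaceD s2 e12 e21.
  have Lm' := subspaceN s1 Lm; have Lk' := subspaceN s2 Lk.
  have := vi _ _ _ (lifts_mkU T oOm Lm' Lk' H0 D0).
  rewrite !addr0 => /(_ cwq).
  have -> : bdry star w q 0 0 = 0.
    by rewrite /bdry; case: star {vi cwq}; rewrite ?ntrace0r ?ntrace0l// addr0 mulr0.
  rewrite /ipV /riesz_field/= /u_of /sigma_of /= !subr0 addr0.
  rewrite !(sinNl i1)// !(sinNl i2)//.
  have m1 := sin_ge0 i1 Lm; have k1 := sin_ge0 i2 Lk.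
  have -> : - ip Om (e.1.1 + e.2.2) e.1.1 - ipv Om (e.1.2 + e.2.1) e.1.2
     - ipv Om (e.1.2 + e.2.1) e.2.1 - ip Om (e.1.1 + e.2.2) e.2.2
     = - (ip Om (e.1.1 + e.2.2) (e.1.1 + e.2.2) + ipv Om (e.1.2 + e.2.1) (e.1.2 + e.2.1)).
    rewrite (sinDr i1 e11 e22 Lm) (sinDr i2 e12 e21 Lk); ring.
  rewrite pmulr_rge0// oppr_ge0 => h.
  by split; apply/eqP; rewrite eq_le ?m1 ?k1 andbT; apply: le_trans h; rewrite ?lerDl ?lerDr.
have Lm := subspaceD s1 e11 e22; have Lk := subspaceD s2 e12 e21.
have r1 x : L2 Om x -> ip Om x e.1.1 = - ip Om x e.2.2.
  move=> Lx; have := sin_eq0 i1 Lm Lx m0.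
  by rewrite (sinDl i1)// addrC => /eqP; rewrite addr_eq0 !(ipC _ x) => /eqP ->; rewrite opprK.
have r2 x : L2v Om x -> ipv Om x e.1.2 = - ipv Om x e.2.1.
  move=> Lx; have := sin_eq0 i2 Lk Lx k0.
  by rewrite (sinDl i2)// addrC => /eqP; rewrite addr_eq0 !(ipvC _ x) => /eqP ->; rewrite opprK.
set tau := e.2 in e21 e22 r1 r2 *.
have Lt : (L2v Om `*` L2 Om) tau by [].
have vi2 w' q' : H1 Om w' -> Hdiv Om q' -> cone star (w + w') (q + q') ->
    0 <= beta * (ipHdiv Om q' tau - ntrace Om tau w') + bdry star w q w' q'.
  move=> Hw' Hq' hc; have := vi _ _ _ (lifts_mkU T oOm s1.1 s2.1 Hw' Hq') hc.
  have [w1 w2 _] := Hw'; have [q1 q2 _] := Hq'.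
  congr (0 <= beta * _ + _); rewrite /ipV /riesz_field/= /u_of /sigma_of /= !sub0r.
  rewrite !(sinNl i1)// !(sinNl i2)// (r1 _ q2) (r2 _ q1).
  rewrite /ipHdiv /ntrace /sum_form (ipC _ tau.2) (ipvC _ tau.1) -/tau; ring.
have Ht : Hdiv Om tau.
  split => // phi tphi; apply/eqP; rewrite -addr_eq0; apply/eqP.
  change (ntrace Om tau (phi, grad phi) = 0).
  have Hphi := test_H1 mOm tphi; have tphi0 := test_H10 tphi.
  (* A multiple of a test function changes no trace: the cone condition is preserved and the
     boundary term is zero. The two signs of [a] then give equality. *)
  have hs a : 0 <= a * ntrace Om tau (phi, grad phi).
    have Ha := subspaceZ (- a) sH Hphi.
    have := vi2 _ _ Ha D0; rewrite addr0.
    have sm : same_trace Om w (w + (- a) *: ((phi, grad phi) : sob)).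
      rewrite /same_trace opprD addNKr -scaleNr opprK.
      exact: (subspaceZ a (H10_subspace mOm) tphi0).
    have hc : cone star (w + (- a) *: ((phi, grad phi) : sob)) q.
      move: cwq; rewrite /cone; case: star {vi vi2} => // [h|[h1 h2]].
        exact: (nonneg_half_same Hw (subspaceD sH Hw Ha) sm h).
      by split => //; exact: (nonneg_half_same Hw (subspaceD sH Hw Ha) sm h1).
    move=> /(_ hc).
    have -> : bdry star w q ((- a) *: ((phi, grad phi) : sob)) 0 = 0.
      have z1 : ntrace Om q ((- a) *: ((phi, grad phi) : sob)) = 0.
        by rewrite ntraceZr ?(ntrace_test Hq tphi) ?mulr0//; exact: (H1_L2 Hphi).
      by rewrite /bdry; case: star {vi vi2 cwq hc}; rewrite ?z1 ?ntrace0l ?addr0 ?mulr0.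
    rewrite (sin0l iD Lt) sub0r addr0 pmulr_rge0// ntraceZr//; last exact: (H1_L2 Hphi).
    by rewrite mulNr opprK.
  apply/eqP; rewrite eq_le; have := hs 1; have := hs (-1).
  by rewrite mulN1r oppr_ge0 mul1r => -> ->.
have t0 : 0 <= ipHdiv Om tau tau by exact: (sin_ge0 iD).
have Hnt := subspaceN sD Ht.
have tt : ipHdiv Om tau tau = 0.
  apply/eqP; rewrite eq_le t0 andbT.
  have minus : cone star (w + 0) (q - tau) -> bdry star w q 0 (- tau) = 0 ->
      ipHdiv Om tau tau <= 0.
    move=> hc hb; have := vi2 _ _ H0 Hnt hc; rewrite hb addr0 (sinNl iD)//.
    by rewrite (ntrace0r Lt) subr0 pmulr_rge0// oppr_ge0.
  case: star vi2 cwq minus {vi} => vi2 cwq minus.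
  - by apply: minus; [rewrite addr0|exact: ntrace0r].
  (* Here [w'] is unconstrained, which forces the normal trace of [tau] to vanish; the variation
     [- tau] then leaves the constrained flux unchanged. *)
  - have nt w' : H1 Om w' -> ntrace Om tau w' = 0.
      move=> Hw'; have hs a : 0 <= a * ntrace Om tau w'.
        have := vi2 _ _ (subspaceZ (- a) sH Hw') D0; rewrite addr0 => /(_ cwq).
        rewrite /bdry ntrace0l// addr0 (sin0l iD Lt) sub0r pmulr_rge0//.
        by rewrite ntraceZr ?mulNr ?opprK//; exact: (H1_L2 Hw').
      apply/eqP; rewrite eq_le; have := hs 1; have := hs (-1).
      by rewrite mulN1r oppr_ge0 mul1r => -> ->.
    apply: minus => /=.
      move=> v Hv nv; rewrite ntraceDl// -scaleN1r ntraceZl// nt// mulr0 addr0.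
      exact: cwq.
    by rewrite -scaleN1r ntraceZl// nt// mulr0.
  - have [nw nq] := cwq.
    (* The variation (v, 0) with a non-negative [v] yields exactly [0 <= ntrace Om P v]. So [P] is a
       non-negative flux and may be added to [q]. *)
    pose P : dvf := 2^-1 *: q + (- beta) *: tau.
    have HP1 := subspaceZ 2^-1 sD Hq; have HP2 := subspaceZ (- beta) sD Ht.
    have HP : Hdiv Om P := subspaceD sD HP1 HP2.
    have PE v : H1 Om v -> ntrace Om P v = 2^-1 * ntrace Om q v - beta * ntrace Om tau v.
      by move=> Hv; rewrite /P ntraceDl// !ntraceZl// mulNr.
    have nP : nonneg_flux P.
      move=> v Hv nv; have := vi2 _ _ Hv D0; rewrite addr0 => /(_ (conj _ nq)).
      move=> /(_ (nonneg_halfD oOm Hw Hv nw nv)).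
      by rewrite /bdry (sin0l iD Lt) ntrace0l// PE//; lra.
    have a1 := vi2 _ _ H0 HP; rewrite addr0 in a1.
    have nqP : nonneg_flux (q + P).
      by move=> v Hv nv; rewrite ntraceDl//; apply: addr_ge0; [exact: nq|exact: nP].
    have {}a1 := a1 (conj nw nqP).
    have Hmw := subspaceN sH Hw; have Hmq := subspaceN sD Hq.
    have nz0 : nonneg_half Om (0 : sob) := nonneg_half0 oOm.
    have nf0 : nonneg_flux 0 by move=> v Hv _; rewrite ntrace0l.
    have a2 := vi2 _ _ Hmw Hmq; rewrite !subrr in a2; have {}a2 := a2 (conj nz0 nf0).
    have X0 : 0 <= ntrace Om q w by exact: nq.
    move: a1 a2; rewrite /bdry PE// !(ntrace0r Lt) !(ntrace0r LHq).
    rewrite /P (sinDl iD (Hdiv_L2 HP1) (Hdiv_L2 HP2) Lt).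
    rewrite (sinZl iD _ LHq Lt) (sinZl iD _ Lt Lt) (sinNl iD LHq Lt).
    rewrite -!(scaleN1r w) -(scaleN1r q) !ntraceZr ?ntraceZl//; try exact: (H1_L2 Hw).
    move: (ipHdiv Om tau tau) (ipHdiv Om q tau) (ntrace Om q w) (ntrace Om tau w) X0 b0 t0.
    move=> tt qt X tw X0 b0 t0 a1 a2.
    (* This is [a1] plus half of [a2]: the terms in [qt] and [tw] cancel, and 1/4 - 1/2 gives the
       coefficient of [X]. *)
    have : 0 <= - (beta ^+ 2 * tt) - 4^-1 * X by move: a1 a2; nra.
    move=> h; have : beta ^+ 2 * tt <= 0 by lra.
    by rewrite pmulr_rle0// exprn_gt0.
have [t1' t2'] : ipv Om tau.1 tau.1 = 0 /\ ip Om tau.2 tau.2 = 0.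
  have h1 := sin_ge0 i2 e21; have h2 := sin_ge0 i1 e22.
  move: tt; rewrite /ipHdiv /sum_form => /eqP; rewrite paddr_eq0//.
  by move=> /andP[/eqP -> /eqP ->].
rewrite /ipV -/tau t1' t2' (r1 _ e11) (r2 _ e12) (ipC _ e.1.1) (ipvC _ e.1.2).
by rewrite (sin_eq0 i1 e22 e11 t2') (sin_eq0 i2 e21 e12 t1') !oppr0 !addr0.
Qed.

End variational_inequality.

Lemma vi_error (R : realFieldType) (H : zmodType) (D : H -> Prop)
    (a g : H -> H -> R) (F : H -> R) (u uh vh : H) :
  (forall x y, D x -> D y -> D (x - y)) ->
  (forall x y z, D x -> D y -> D z -> a (x - y) z = a x z - a y z) ->
  (forall x y z, D x -> D y -> D z -> a z (x - y) = a z x - a z y) ->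
  (forall x y z, D x -> D y -> D z -> g z (x - y) = g z x - g z y) ->
  D u -> D uh -> D vh ->
  (forall d, D d -> F d = a u d - g u d) ->
  F (vh - uh) <= a uh (vh - uh) -> 0 <= g u (uh - u) ->
  a (u - uh) (u - uh) <= a (u - uh) (u - vh) + g u (vh - u).
Proof.
move=> DB aBl aBr gBr Du Dh Dv FE; rewrite FE; last exact: DB.
by rewrite !aBl ?gBr ?aBr//; try exact: DB; lra.
Qed.

(** The parameter [(10 * D)^-1] leaves only half of [Ne] on the right after multiplication by the
    coercivity constant: [Ne <= Ne / 2 + 50 * D ^+ 2 * Nd + 10 * B]. *)
Lemma quasi_optimal_bound (R : realFieldType) (D Ne Nd a b B : R) : 9 <= D -> 0 <= Nd ->
  Ne <= 10 * a -> 2 * b <= D * ((10 * D)^-1 * Ne + 10 * D * Nd) ->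
  a <= b + B -> 0 <= B -> Ne <= 100 * D ^+ 2 * (Nd + B).
Proof.
move=> D9 Nd0 co yo key B0; move: yo; rewrite mulrDr.
have -> : D * ((10 * D)^-1 * Ne) = 10^-1 * Ne by field; lra.
have -> : 100 * D ^+ 2 * (Nd + B) = D * (100 * D * Nd) + 100 * D ^+ 2 * B by ring.
have hD : 20 * B <= 100 * D ^+ 2 * B by apply: ler_wpM2r => //; nra.
have : D * (10 * D * Nd) = 10^-1 * (D * (100 * D * Nd)) by field.
move: hD; move: (D * (10 * D * Nd)) (D * (100 * D * Nd)) (100 * D ^+ 2 * B) => X Y Z *; lra.
Qed.

(** * Quasi-optimality of the discrete solution *)

Section quasi_optimality.
Variables (R : realType) (n : nat) (Om : set 'rV[R]_n.+1) (T : mesh Om).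
Hypothesis oOm : open Om.
Local Notation sob := (sob R n).
Local Notation dvf := (dvf R n).
Local Notation U := (Ucarrier T).
Local Notation V := (Vcarrier R n).
Implicit Types (x y z d u v : U) (w : sob) (q : dvf) (star : variant).

Let mOm : measurable Om := measurable_dom oOm.
Let iV := ipV_semi_inner oOm.
Let iVT := Vspace_semi_inner T oOm.

Definition bdryG star x y : R := match star with
  | Var0 => pairG (gamman x) (gamma0 y)
  | Varn => pairG (gamman y) (gamma0 x)
  | Vars => 2^-1 * (pairG (gamman x) (gamma0 y) + pairG (gamman y) (gamma0 x)) end.

Lemma UspaceB z z' : Uspace z -> Uspace z' -> Uspace (z - z').
Proof.
move=> /lifts_exist[w [q h]] /lifts_exist[w' [q' h']].
by have [] := liftsB oOm h h'.
Qed.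

Lemma Kcone_Uspace star z : Kcone T star z -> Uspace z.
Proof. by case: star => [[]|[]|[[]]]. Qed.

Lemma Theta_betaE (beta : R) z : Theta_beta beta z = beta *: Theta z.
Proof. by rewrite /Theta_beta; case: (Theta z) => [[? ?] [? ?]]. Qed.

Lemma bdryG_lifts star z z' w w' q q' : lifts z w q -> lifts z' w' q' ->
  bdryG star z z' = bdry Om star w q w' q'.
Proof.
move=> h h'; rewrite /bdryG /bdry.
by rewrite (pairG_lifts oOm h h') (pairG_lifts oOm h' h).
Qed.

Lemma bform_Theta_beta (beta : R) z z' : Uspace z -> Uspace z' ->
  bform z (Theta_beta beta z') = beta * ipV Om (Theta z) (Theta z').
Proof.
move=> Uz Uz'; have Vt := Theta_Vspace oOm Uz; have Vt' := Theta_Vspace oOm Uz'.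
rewrite Theta_betaE -(ipV_Theta oOm Uz); first exact: (sinZr iVT).
exact: (subspaceZ _ (sin_subspace iVT) Vt').
Qed.

Lemma aformE star (beta : R) z z' : Uspace z -> Uspace z' ->
  aform star beta z z' = beta * ipV Om (Theta z) (Theta z') + bdryG star z z'.
Proof.
move=> Uz Uz'; rewrite -bform_Theta_beta//.
by case: star; rewrite /aform /bdryG /a_0 /a_n /a_s.
Qed.

Lemma riesz_fieldB x y w w' q q' :
  riesz_field (x - y) (w - w') (q - q') = riesz_field x w q - riesz_field y w' q'.
Proof.
have e (W : zmodType) (a b c s : W) : (a - b) - (c - s) = (a - c) - (b - s).
  by rewrite !opprB addrACA [RHS]addrACA (addrC (- b)).
congr pair; congr pair.
- exact: (e _ (u_of x) (u_of y) q.2 q'.2).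
- exact: (e _ (sigma_of x) (sigma_of y) q.1 q'.1).
- exact: (e _ (sigma_of x) (sigma_of y) w.2 w'.2).
- exact: (e _ (u_of x) (u_of y) w.1 w'.1).
Qed.

(** [Theta] is a chosen representative, so its additivity is available only after testing, through
    the linear dependence of [riesz_field] on the liftings. *)
Lemma ipV_ThetaBl x y z : Uspace x -> Uspace y -> Uspace z ->
  ipV Om (Theta (x - y)) (Theta z) = ipV Om (Theta x) (Theta z) - ipV Om (Theta y) (Theta z).
Proof.
move=> Ux Uy Uz; have Vt := Theta_Vspace oOm Uz; have Uxy := UspaceB Ux Uy.
have [w [q h]] := lifts_exist Ux; have [w' [q' h']] := lifts_exist Uy.
have h2 := liftsB oOm h h'.
rewrite !(ipV_Theta oOm)// (bformE oOm h2)// (bformE oOm h)// (bformE oOm h')//.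
rewrite riesz_fieldB; apply: (sinBl iV).
- exact: riesz_field_L2 h.
- exact: riesz_field_L2 h'.
- exact: Vspace_L2 Vt.
Qed.

Lemma ipV_ThetaBr x y z : Uspace x -> Uspace y -> Uspace z ->
  ipV Om (Theta z) (Theta (x - y)) = ipV Om (Theta z) (Theta x) - ipV Om (Theta z) (Theta y).
Proof.
move=> Ux Uy Uz; have V2 := Theta_Vspace oOm (UspaceB Ux Uy).
have Vx := Theta_Vspace oOm Ux; have Vy := Theta_Vspace oOm Uy.
have Vz := Theta_Vspace oOm Uz.
rewrite (sinC iVT Vz V2) (sinC iVT Vz Vx) (sinC iVT Vz Vy).
exact: ipV_ThetaBl.
Qed.

Lemma pairGBl x y z : Uspace x -> Uspace y -> Uspace z ->
  pairG (gamman (x - y)) (gamma0 z) = pairG (gamman x) (gamma0 z) - pairG (gamman y) (gamma0 z).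
Proof.
move=> /lifts_exist[w [q h]] /lifts_exist[w' [q' h']] /lifts_exist[w2 [q2 h2]].
rewrite (pairG_lifts oOm (liftsB oOm h h') h2) (pairG_lifts oOm h h2) (pairG_lifts oOm h' h2).
have [_ _ [Hq _]] := h; have [_ _ [Hq' _]] := h'; have [_ [Hw _] _] := h2.
have Hn := subspaceN (Hdiv_subspace mOm) Hq'.
by rewrite (ntraceDl oOm Hq Hn Hw) -scaleN1r (ntraceZl oOm)// mulN1r.
Qed.

Lemma pairGBr x y z : Uspace x -> Uspace y -> Uspace z ->
  pairG (gamman z) (gamma0 (x - y)) = pairG (gamman z) (gamma0 x) - pairG (gamman z) (gamma0 y).
Proof.
move=> /lifts_exist[w [q h]] /lifts_exist[w' [q' h']] /lifts_exist[w2 [q2 h2]].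
apply: (etrans (pairG_lifts oOm h2 (liftsB oOm h h'))); apply: esym.
apply: (etrans (f_equal2 (fun a b => a - b) (pairG_lifts oOm h2 h) (pairG_lifts oOm h2 h'))).
have [_ [Hw _] _] := h; have [_ [Hw' _] _] := h'; have [_ _ [Hq _]] := h2.
have Hn := subspaceN (H1_subspace mOm) Hw'.
rewrite (ntraceDr oOm Hq Hw Hn) -scaleN1r (ntraceZr oOm) ?mulN1r//.
  exact: Hdiv_L2 Hq.
exact: H1_L2 Hw'.
Qed.

Lemma bdryGBl star x y z : Uspace x -> Uspace y -> Uspace z ->
  bdryG star (x - y) z = bdryG star x z - bdryG star y z.
Proof.
move=> Ux Uy Uz; have h1 := pairGBl Ux Uy Uz; have h2 := pairGBr Ux Uy Uz.
case: star; [exact: h1|exact: h2|].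
apply: (etrans (f_equal2 (fun a b => 2^-1 * (a + b)) h1 h2)).
have e (a b c d : R) : 2^-1 * (a - b + (c - d)) = 2^-1 * (a + c) - 2^-1 * (b + d) by ring.
exact: e.
Qed.

Lemma bdryGBr star x y z : Uspace x -> Uspace y -> Uspace z ->
  bdryG star z (x - y) = bdryG star z x - bdryG star z y.
Proof.
move=> Ux Uy Uz; have h1 := pairGBr Ux Uy Uz; have h2 := pairGBl Ux Uy Uz.
case: star; [exact: h1|exact: h2|].
apply: (etrans (f_equal2 (fun a b => 2^-1 * (a + b)) h1 h2)).
have e (a b c d : R) : 2^-1 * (a - b + (c - d)) = 2^-1 * (a + c) - 2^-1 * (b + d) by ring.
exact: e.
Qed.

Lemma aformBl star (beta : R) x y z : Uspace x -> Uspace y -> Uspace z ->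
  aform star beta (x - y) z = aform star beta x z - aform star beta y z.
Proof.
move=> Ux Uy Uz; apply: (etrans (aformE star beta (UspaceB Ux Uy) Uz)).
rewrite (aformE star beta Ux Uz) (aformE star beta Uy Uz).
apply: (etrans (f_equal2 (fun a b => beta * a + b) (ipV_ThetaBl Ux Uy Uz) (bdryGBl star Ux Uy Uz))).
have e (a b c d : R) : beta * (a - b) + (c - d) = beta * a + c - (beta * b + d) by ring.
exact: e.
Qed.

Lemma aformBr star (beta : R) x y z : Uspace x -> Uspace y -> Uspace z ->
  aform star beta z (x - y) = aform star beta z x - aform star beta z y.
Proof.
move=> Ux Uy Uz; apply: (etrans (aformE star beta Uz (UspaceB Ux Uy))).
rewrite (aformE star beta Uz Ux) (aformE star beta Uz Uy).
apply: (etrans (f_equal2 (fun a b => beta * a + b) (ipV_ThetaBr Ux Uy Uz) (bdryGBr star Ux Uy Uz))).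
have e (a b c d : R) : beta * (a - b) + (c - d) = beta * a + c - (beta * b + d) by ring.
exact: e.
Qed.

(** On the diagonal the three boundary terms coincide, so that one estimate serves all variants. *)
Lemma aform_coercive star (beta : R) z : 2 <= beta -> Uspace z ->
  normU z ^+ 2 <= 10 * aform star beta z z.
Proof.
move=> b2 Uz; have Vt := Theta_Vspace oOm Uz.
have := coercive oOm b2 Uz; rewrite -(ipV_Theta oOm Uz Vt) aformE//.
by case: star => //=; move: (ipV _ _ _) (pairG _ _) => *; lra.
Qed.

(** Here [4 * beta] stems from the bound on [Theta] and 1 from the boundary pairing. Where the
    pairing has its arguments swapped it is estimated with [t^-1] for [t], which gives the same
    right-hand side. *)
Lemma aform_young star (beta : R) (t : R) x y : 0 <= beta -> 0 < t ->
  Uspace x -> Uspace y ->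
  2 * aform star beta x y <= (4 * beta + 1) * (t * normU x ^+ 2 + t^-1 * normU y ^+ 2).
Proof.
have e1 (p q s : R) : 2 * p <= s -> 2 * q <= s -> 2 * (2^-1 * (p + q)) <= s by lra.
have e (b g s : R) : beta * (2 * b) <= beta * (4 * s) -> 2 * g <= s ->
    2 * (beta * b + g) <= (4 * beta + 1) * s by move=> *; lra.
move=> b0 t0 Ux Uy; rewrite aformE// (ipV_Theta oOm Ux (Theta_Vspace oOm Uy)).
have h1 := ler_wpM2l b0 (bform_Theta_young oOm Ux Uy t0).
have h2 := pairG_young oOm Ux Uy t0.
have ti : 0 < t^-1 by rewrite invr_gt0.
have h3 := pairG_young oOm Uy Ux ti; rewrite invrK in h3.
have : 2 * bdryG star x y <= t * normU x ^+ 2 + t^-1 * normU y ^+ 2.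
  by rewrite addrC in h3; case: star; [exact: h2|exact: h3|exact: e1 h2 h3].
exact: e.
Qed.

(** With [r] the Riesz representative of the load, [Theta u - r] is the residual, and the inequality
    at [v = u + d] is the hypothesis of [residual_eq0]. *)
Lemma ultraweak_solution star (beta : R) f u : 0 < beta -> L2 Om f -> Kcone T star u ->
  (forall v, Kcone T star v ->
    Fform beta f (v - u) <= aform star beta u (v - u)) ->
  forall v : V, Vspace T v -> bform u v = Lform Om f v.
Proof.
move=> b0 Lf Ku vi; have Uu := Kcone_Uspace Ku.
have [w [q hu]] := lifts_exist Uu; have [_ [Hw _] [Hq _]] := hu.
have LF : L2prod Om ((f, 0), 0) by split; split => //=;
  [exact: (L2v_subspace mOm).1|exact: (L2v_subspace mOm).1|exact: (L2_subspace mOm).1].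
have [r [Vr rE]] := Vspace_riesz T oOm LF.
have rL (v : V) : Vspace T v -> ipV Om r v = Lform Om f v.
  move=> Vv; rewrite rE// /ipV /Lform/=; have [[v1 v2] [v3 v4]] := Vspace_L2 oOm Vv.
  rewrite (sin0l (ipv_semi_inner mOm) v2) (sin0l (ipv_semi_inner mOm) v3).
  by rewrite (sin0l (ip_semi_inner mOm) v4) !addr0.
have Vu := Theta_Vspace oOm Uu; pose e : V := Theta u - r.
have Ve : Vspace T e := subspaceB (sin_subspace iVT) Vu Vr.
have ee : ipV Om e e = 0.
  apply: (residual_eq0 oOm b0 Hw Hq (Vspace_L2 oOm Ve) ((KconeP oOm star hu).1 Ku)).
  move=> d w' q' hd hc; have hv := liftsD oOm hu hd.
  have := vi _ ((KconeP oOm star hv).2 hc); rewrite addrC addKr.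
  have [Ud _ _] := hd; have Vd := Theta_Vspace oOm Ud.
  rewrite aformE// (bdryG_lifts star hu hd) /Fform Theta_betaE.
  have -> : Lform Om f (beta *: Theta d) = beta * ipV Om r (Theta d).
    rewrite -(rL _ (subspaceZ beta (sin_subspace iVT) Vd)).
    exact: (sinZr iVT beta Vd Vr).
  rewrite -subr_ge0 addrAC -mulrBr -(sinBl iVT Vu Vr Vd) (sinC iVT Ve Vd).
  by rewrite (ipV_Theta oOm Ud Ve) (bformE oOm hd Ve).
move=> v Vv; rewrite -rL// -(ipV_Theta oOm Uu Vv).
by have := sin_eq0 iVT Ve Vv ee; rewrite (sinBl iVT Vu Vr Vv) => /eqP; rewrite subr_eq0 => /eqP.
Qed.

Lemma quasi_optimal star (beta : R) f u uh vh : 2 <= beta -> L2 Om f ->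
  Kcone T star u ->
  (forall v, Kcone T star v ->
    Fform beta f (v - u) <= aform star beta u (v - u)) ->
  Kcone T star uh -> Kcone T star vh ->
  Fform beta f (vh - uh) <= aform star beta uh (vh - uh) ->
  normU (u - uh) ^+ 2 <=
    100 * (4 * beta + 1) ^+ 2 * (normU (u - vh) ^+ 2 + bdryG star u (vh - u)).
Proof.
move=> b2; have b0 : 0 < beta by lra.
have D9 : 9 <= 4 * beta + 1 by lra.
have D0 : 0 < 4 * beta + 1 by lra.
move=> Lf Ku vi Kuh Kvh vih.
have Uu := Kcone_Uspace Ku; have Uuh := Kcone_Uspace Kuh; have Uvh := Kcone_Uspace Kvh.
have FE d : Uspace d -> Fform beta f d = aform star beta u d - bdryG star u d.
  move=> Ud; have Vd := Theta_Vspace oOm Ud.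
  rewrite /Fform -(ultraweak_solution b0 Lf Ku vi).
    by rewrite bform_Theta_beta// aformE// addrK.
  by rewrite Theta_betaE; exact: (subspaceZ _ (sin_subspace iVT) Vd).
(* Once the load is rewritten, the exact inequality says just that the boundary term is
   non-negative. It applies to [uh] and [vh] because the discrete cone lies in the continuous
   one. *)
have g0 v : Kcone T star v -> 0 <= bdryG star u (v - u).
  move=> Kv; have := vi v Kv; rewrite FE; last by apply: UspaceB => //; exact: Kcone_Uspace Kv.
  by rewrite lerBlDr lerDl.
have Ue := UspaceB Uu Uuh; have Ud := UspaceB Uu Uvh.
have h1 := g0 _ Kuh; have h2 := g0 _ Kvh.
have co := aform_coercive star b2 Ue.
have t0 : 0 < (10 * (4 * beta + 1))^-1 by rewrite invr_gt0 mulr_gt0.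
have yo := aform_young star (ltW b0) t0 Ue Ud.
rewrite invrK in yo.
have key := vi_error UspaceB (aformBl star beta) (aformBr star beta) (bdryGBr star)
  Uu Uuh Uvh FE vih h1.
apply: (quasi_optimal_bound D9 _ co yo key h2); exact: sqr_ge0.
Qed.

End quasi_optimality.

Theorem theorem3 (R : realType) (n : nat) (dim23 : n.+1 = 2%N \/ n.+1 = 3%N)
    (Om : set 'rV[R]_n.+1) (hOm : admissible_domain Om)
    (star : variant) (beta : R) (hbeta : 2 <= beta) :
  exists C : R, 0 < C /\
    forall (T : mesh Om) (f : 'rV[R]_n.+1 -> R) (u uh : Ucarrier T),
      L2 Om f ->
      Kcone T star u ->
      (forall v, Kcone T star v ->
         aform star beta u (v - u) >= Fform beta f (v - u)) ->
      Kcone_h T star uh ->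
      (forall vh, Kcone_h T star vh ->
         aform star beta uh (vh - uh) >= Fform beta f (vh - uh)) ->
      ((normU (u - uh) ^+ 2)%:E <= C%:E * ereal_inf
        [set (normU (u - vh) ^+ 2 +
              match star with
              | Var0 => pairG (gamman u) (gamma0 (vh - u))
              | Varn => pairG (gamman (vh - u)) (gamma0 u)
              | Vars => 2^-1 * (pairG (gamman u) (gamma0 (vh - u))
                                + pairG (gamman (vh - u)) (gamma0 u))
              end)%:E | vh in Kcone_h T star])%E.
Proof.
have [oOm _] : open Om /\ Om !=set0 by case: hOm.
have D0 : 0 < 100 * (4 * beta + 1) ^+ 2 by rewrite mulr_gt0// exprn_gt0//; lra.
exists (100 * (4 * beta + 1) ^+ 2); split=> // T f u uh Lf Ku vi [Kuh _] vih.
(* Dividing by the constant turns the claim into a lower bound for the infimum, to be checked for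
   one [vh] at a time. *)
rewrite -lee_pdivrMl//; apply: le_ereal_inf_tmp => _ [vh Kvh <-].
rewrite lee_pdivrMl// -EFinM lee_fin.
have [Kvh' _] := Kvh.
have := quasi_optimal oOm hbeta Lf Ku vi Kuh Kvh' (vih _ Kvh).
by case: star {vi vih Ku Kuh Kvh Kvh'}.
Qed.
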